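(* Let $f_\mu$ ($\mu\in\mathbb{R}^n$) be a family of maps as in the context, with $\lambda(\mathbf{0})=\alpha$, $\sigma(\mathbf{0})=\frac{\chi_{\rm eig}}{\alpha}$, where $0<\alpha<1$ and $\chi_{\rm eig}\in\{-1,1\}$, and $$c_0(\mathbf{0})=1,\quad d_0(\mathbf{0})=0,\quad d_1(\mathbf{0})=\chi\in\{-1,1\},\quad d_2(\mathbf{0})=0,\quad d_5(\mathbf{0})=d_{5,0}\neq0 .$$ Suppose $a_{1,0}+b_{1,0}=0$, $\Delta_0>0$ and $-1<c_{2,0}<1-\frac{\sqrt{\Delta_0}}{2}$, where $$\Delta_0=\left(1-c_{2,0}-\chi d_{4,0}\right)^2-4d_{5,0}\left(d_{3,0}+\chi c_{1,0}\right).$$ Let $\mathbf{v}\in\mathbb{R}^n$. (i) If $\mathbf{n}_{\rm tang}^{\sf T}\mathbf{v}\neq0$, then there exists $k_{\min}\in\mathbb{Z}$ such that for all $k\in K(k_{\min})$ there exist $\varepsilon_k^-<0$ and $\varepsilon_k^+>0$, with $\varepsilon_k^\pm=\mathcal{O}(\alpha^{2k})$, such that $f_\mu$ has an asymptotically stable period-$(k+m)$ solution for all $\mu=\varepsilon\mathbf{v}$ with $\varepsilon_k^-<\varepsilon<\varepsilon_k^+$. Moreover, one of the sequences $\{\varepsilon_k^-\}$, $\{\varepsilon_k^+\}$ corresponds to saddle-node bifurcations of the periodic solutions and the other to period-doubling bifurcations of the periodic solutions. (ii) If instead $\mathbf{n}_{\rm tang}^{\sf T}\mathbf{v}=0$ and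 $\mathbf{n}_{\rm eig}^{\sf T}\mathbf{v}\neq0$, then the same results hold except that now $\varepsilon_k^\pm=\mathcal{O}\!\left(\frac{\alpha^k}{k}\right)$.
   Context: Setting. $f_\mu$ is a $C^\infty$ map on $\mathbb{R}^2$ depending in a $C^\infty$ way on $\mu\in\mathbb{R}^n$; $\mathbf{0}$ denotes the origin of parameter space. For all $\mu$ in some region containing $\mathbf{0}$ the point $(x,y)=(0,0)$ is a fixed point of $f_\mu$ with eigenvalues $\lambda(\mu),\sigma(\mu)$ ($C^\infty$ in $\mu$). For all sufficiently small $\mu$ coordinates are chosen so that $f_\mu=T_0$ on a convex neighbourhood $\mathcal{N}$ of $(0,0)$, where $$T_0(x,y)=\begin{bmatrix}\lambda x\,\big(1+a_1xy+\mathcal{O}(x^2y^2)\big)\\ \sigma y\,\big(1+b_1xy+\mathcal{O}(x^2y^2)\big)\end{bmatrix},$$ with $\lambda,\sigma,a_1,b_1$ functions of $\mu$; in the case $\chi_{\rm eig}=-1$ coordinates are chosen with $a_1=b_1=0$. When $\mu=\mathbf{0}$ the points $(1,0),(\lambda,0),(0,\frac1\sigma),(0,\frac1{\sigma^2})$ belong to $\mathcal{N}$. For a fixed $m\ge1$ write $T_1=f_\mu^m$, with Taylor expansion about $(0,1)$ $$T_1(x,y)=\begin{bmatrix} c_0+c_1x+c_2(y-1)+\mathcal{O}\big((x,y-1)^2\big)\\ d_0+d_1x+d_2(y-1)+d_3x^2+d_4x(y-1)+d_5(y-1)^2+\mathcal{O}\big((x,y-1)^3\big)\end{bmatrix},$$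 the coefficients $c_i,d_i$ being functions of $\mu$. (Thus when $c_0(\mathbf 0)=1$ and $d_0(\mathbf 0)=0$, $f_{\mathbf 0}$ has an orbit homoclinic to the origin through $(1,0)$ and $(0,1)$.) Notation. $a_{1,0}=a_1(\mathbf{0})$, $b_{1,0}=b_1(\mathbf{0})$, $c_{1,0}=c_1(\mathbf{0})$, $c_{2,0}=c_2(\mathbf{0})$, $d_{3,0}=d_3(\mathbf{0})$, $d_{4,0}=d_4(\mathbf{0})$, $d_{5,0}=d_5(\mathbf{0})$. The vectors $\mathbf{n}_{\rm tang},\mathbf{n}_{\rm eig}\in\mathbb{R}^n$ are the gradients at $\mu=\mathbf{0}$ of $d_0(\mu)$ and of $\lambda(\mu)\sigma(\mu)$, respectively, i.e. $$d_0(\mu)=\mathbf{n}_{\rm tang}^{\sf T}\mu+\mathcal{O}(\|\mu\|^2),\qquad \lambda(\mu)\sigma(\mu)=\chi_{\rm eig}+\mathbf{n}_{\rm eig}^{\sf T}\mu+\mathcal{O}(\|\mu\|^2).$$ For $k_{\min}\in\mathbb{Z}$, $$K(k_{\min})=\{k\in\mathbb{Z}: k\ge k_{\min},\ (\chi_{\rm eig})^k=\chi\}.$$ Terminology. A period-$p$ solution of $f_\mu$ is asymptotically stable if its points are asymptotically stable fixed points of $f_\mu^p$. A saddle-node (respectively period-doubling) bifurcation of a period-$p$ solution is one at which the Jacobian of $f_\mu^p$ at a point of the solution has an eigenvalue equal to $1$ (respectively $-1$). *)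

(* Defs.v *)
From HB Require Import structures.
From mathcomp Require Import all_boot all_order all_algebra.
From mathcomp Require Import all_classical all_reals all_analysis.

Set Implicit Arguments.
Unset Strict Implicit.
Unset Printing Implicit Defensive.

Import Order.TTheory GRing.Theory Num.Theory.
Import numFieldNormedType.Exports.

Local Open Scope classical_set_scope.
Local Open Scope ring_scope.

Section Smoothness.
Variables (R : realType) (V W : normedModType R).

Fixpoint iter_derive (s : seq V) (g : V -> W) : V -> W :=
  if s is u :: s' then (fun x => 'D_u (iter_derive s' g) x) else g.

(* For V finite-dimensional and A open this is C^oo on A: differentiability of
   every iterated directional derivative makes all of them continuous. *)
Definition smooth_on (A : set V) (g : V -> W) : Prop :=
  forall (s : seq V) (x : V), A x -> differentiable (iter_derive s g) x.

End Smoothness.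

Section ParameterSpace.
Variables (R : realType) (n : nat).

Definition gradient (g : 'rV[R]_n -> R) (p : 'rV[R]_n) : 'rV[R]_n :=
  \row_i 'D_(delta_mx 0 i) g p.

Definition dot (u v : 'rV[R]_n) : R := \sum_i u 0 i * v 0 i.

End ParameterSpace.

Section Plane.
Variable R : realType.

(* R^2 is 'rV[R]_2, so that the library's Jacobian 'J applies. The latter acts
   on row vectors (it is the transpose of the usual Jacobian matrix), which
   does not affect eigenvalues. *)
Definition pt (x y : R) : 'rV[R]_2 := \row_j (if j == 0 then x else y).
Definition xc (p : 'rV[R]_2) : R := p 0 0.
Definition yc (p : 'rV[R]_2) : R := p 0 1.

(* "Period-p" is read as least period p. *)
Definition periodic_point (F : 'rV[R]_2 -> 'rV[R]_2) (p : nat) (z : 'rV[R]_2) :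
    Prop :=
  [/\ (0 < p)%N, iter p F z = z
    & forall j : nat, (0 < j < p)%N -> iter j F z <> z].

Definition asymptotically_stable_fixed_point
    (G : 'rV[R]_2 -> 'rV[R]_2) (z : 'rV[R]_2) : Prop :=
  [/\ G z = z,
      forall U, nbhs z U -> exists2 V, nbhs z V &
        forall w, V w -> forall j : nat, U (iter j G w)
    & exists2 V, nbhs z V &
        forall w, V w -> iter j G w @[j --> \oo] --> z].

Definition asymptotically_stable_solution
    (F : 'rV[R]_2 -> 'rV[R]_2) (p : nat) (z : 'rV[R]_2) : Prop :=
  forall i : nat, asymptotically_stable_fixed_point (iter p F) (iter i F z).

Definition has_multiplier
    (F : 'rV[R]_2 -> 'rV[R]_2) (p : nat) (z : 'rV[R]_2) (a : R) : Prop :=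
  exists i : nat, eigenvalue ('J (iter p F) (iter i F z)) a.

Definition saddle_node (F : 'rV[R]_2 -> 'rV[R]_2) (p : nat) (z : 'rV[R]_2) :=
  has_multiplier F p z 1.

Definition period_doubling (F : 'rV[R]_2 -> 'rV[R]_2) (p : nat)
    (z : 'rV[R]_2) :=
  has_multiplier F p z (-1).

End Plane.

Section Family.
Variables (R : realType) (n : nat).
Implicit Types (f : 'rV[R]_n -> 'rV[R]_2 -> 'rV[R]_2).

Definition smooth_family f : Prop :=
  smooth_on setT (fun q : 'rV[R]_n * 'rV[R]_2 => f q.1 q.2).

Definition origin_fixed_with_eigenvalues f (lambda sigma : 'rV[R]_n -> R)
    (Omega : set 'rV[R]_n) : Prop :=
  forall mu, Omega mu ->
    f mu 0 = 0 /\
    char_poly ('J (f mu) 0) =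
      ('X - (lambda mu)%:P) * ('X - (sigma mu)%:P).

(* The O(x^2 y^2) terms are uniform over the region N and over small mu. *)
Definition local_form f (lambda sigma a1 b1 : 'rV[R]_n -> R)
    (N : set 'rV[R]_2) : Prop :=
  exists C : R, \forall mu \near (0 : 'rV[R]_n), forall x y : R, N (pt x y) ->
    exists r s : R,
      [/\ `|r| <= C * (x ^+ 2 * y ^+ 2),
          `|s| <= C * (x ^+ 2 * y ^+ 2)
        & f mu (pt x y) =
          pt (lambda mu * x * (1 + a1 mu * (x * y) + r))
             (sigma mu * y * (1 + b1 mu * (x * y) + s))].

Definition taylor_x f (m : nat) (c0 c1 c2 : 'rV[R]_n -> R) : Prop :=
  \forall mu \near (0 : 'rV[R]_n),
    (fun p : 'rV[R]_2 => xc (iter m (f mu) p)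
       - (c0 mu + c1 mu * xc p + c2 mu * (yc p - 1)) : R^o)
    =O_ (nbhs (pt 0 1)) (fun p => `|p - pt 0 1| ^+ 2 : R^o).

Definition taylor_y f (m : nat) (d0 d1 d2 d3 d4 d5 : 'rV[R]_n -> R) : Prop :=
  \forall mu \near (0 : 'rV[R]_n),
    (fun p : 'rV[R]_2 => yc (iter m (f mu) p)
       - (d0 mu + d1 mu * xc p + d2 mu * (yc p - 1)
          + d3 mu * xc p ^+ 2 + d4 mu * (xc p * (yc p - 1))
          + d5 mu * (yc p - 1) ^+ 2) : R^o)
    =O_ (nbhs (pt 0 1)) (fun p => `|p - pt 0 1| ^+ 3 : R^o).

Definition K (chi_eig chi : R) (kmin : int) : set int :=
  [set k | (kmin <= k) /\ chi_eig ^ k = chi].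

(* z k is the branch of periodic solutions over the closed window
   [em k, ep k]; the bifurcations at the end points are those of this branch. *)
Definition stable_windows f (m : nat) (chi_eig chi : R) (v : 'rV[R]_n)
    (rate : int -> R) : Prop :=
  exists (kmin : int) (em ep : int -> R) (z : int -> R -> 'rV[R]_2),
    let Kmin := K chi_eig chi kmin in
    let p (k : int) := absz (k + m%:Z) in
    [/\ forall k, Kmin k -> 0 < k + m%:Z /\ em k < 0 < ep k,
        exists C : R, forall k, Kmin k ->
          `|em k| <= C * `|rate k| /\ `|ep k| <= C * `|rate k|,
        forall k, Kmin k ->
          {within `[em k, ep k], continuous (z k)} /\
          forall eps, em k <= eps <= ep k ->
            periodic_point (f (eps *: v)) (p k) (z k eps),
        forall k, Kmin k -> forall eps, em k < eps < ep k ->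
          asymptotically_stable_solution (f (eps *: v)) (p k) (z k eps)
      & (forall k, Kmin k ->
           saddle_node (f (em k *: v)) (p k) (z k (em k)) /\
           period_doubling (f (ep k *: v)) (p k) (z k (ep k))) \/
        (forall k, Kmin k ->
           period_doubling (f (em k *: v)) (p k) (z k (em k)) /\
           saddle_node (f (ep k *: v)) (p k) (z k (ep k)))].

End Family.

(* Main.v *)
(* A solution of period k + m corresponds to a fixed point (X, Y) of T_0^k o T_1 near
   (0, 1). With a = alpha^k, put X = a (1 + a b psi), Y = 1 + a (b p + g) and
   eps = omega_k e, where b = - 1 / (2 chi d_5) and omega_k is a constant multiple of
   alpha^(2k) in case (i), of alpha^k / k in case (ii). As k tends to infinity the return
   map becomes C^1-close to a map (psi, p, e) |-> (P, Q) with first derivatives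
   (0, c_2, kappa) and (1, 1 - c_2 - p, 1 - kappa), whose fixed points form the parabola
   e = (p^2 - Delta_0) / 2. Along it 1 - tr + det = p, 1 + tr + det = 2 (1 - c_2) - p and
   det = - c_2, so the branch is stable from its saddle-node at p = 0, where e < 0, to its
   period-doubling at p = 2 (1 - c_2), where e > 0 because 2 (1 - c_2) > sqrt Delta_0;
   this picture survives C^1-small perturbations.

   The derivatives of T_0^k are controlled through the logarithmic derivatives of the
   coordinates, which per step change by a parameter term and an error of order alpha^k.
   The value of the return map is needed only at eps = 0 and Y = 1, where a_1 + b_1 = 0
   makes the product x y invariant under T_0, up to sign, to third order. *)

Require Import Defs.
From HB Require Import structures.
From mathcomp Require Import all_boot all_order all_algebra.
From mathcomp Require Import all_classical all_reals all_analysis.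
From mathcomp Require Import ring lra zify.

Set Implicit Arguments.
Unset Strict Implicit.
Unset Printing Implicit Defensive.

Import Order.TTheory GRing.Theory Num.Theory.
Import numFieldNormedType.Exports.

Local Open Scope classical_set_scope.
Local Open Scope ring_scope.

(** * A branch of planar fixed points from fold to flip *)

(** Only first derivatives of the return map are compared with the limit. This suffices because the
    branch is parametrised by p: the parameter e increases along it where 1 - tr + det > 0, so the
    fold needs neither a second derivative nor the implicit function theorem. The limits kappa and 1
    - kappa matter only through their sum, since psi is eliminated with coefficient 1; the constant
    in omega_k normalises that sum to 1. The size of omega_k reflects where the parameter acts. In
    case (i) it moves d_0, an effect that the passage magnifies by alpha^(-k) and that has to match
    a displacement of order alpha^k in Y. In case (ii) it changes the eigenvalues, and the
    logarithmic derivatives collect this change k times. The obstacle is the normal form: it bounds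
    the remainders but not their derivatives, and a_1, b_1 are not assumed continuous. Smoothness of
    the family, with the vanishing of the remainders on the axes, supplies the missing bounds. The
    value of the return map is taken from the product x y because the separate errors of x and y, of
    order k alpha^k, would be too large. *)

Lemma eq_of_sub (V : zmodType) (a b x y : V) : a = b -> x - y = a - b -> x = y.
Proof. by move=> ->; rewrite subrr => /eqP; rewrite subr_eq0 => /eqP. Qed.

Section LineDerive.
Variables (R : realType) (U W : normedModType R).

Lemma is_derive_line (g : U -> W) (a d : U) (t : R) :
  derivable g (a + t *: d) d ->
  is_derive t 1 (fun s : R => g (a + s *: d)) ('D_d g (a + t *: d)).
Proof.
have e : (fun h : R => h^-1 *: (((fun s : R => g (a + s *: d)) \o shift t) (h *: 1)
            - g (a + t *: d))) =
         (fun h : R => h^-1 *: ((g \o shift (a + t *: d)) (h *: d) - g (a + t *: d))).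
  apply/funext => h /=; congr (_ *: (g _ - _)).
  by rewrite [h *: 1]mulr1 scalerDl addrCA.
by move=> dg; apply: DeriveDef; rewrite /derivable/derive e.
Qed.

End LineDerive.

(* Locked, because unification is slow to tell the three of them apart. *)
HB.lock Definition D1 (R : realType) (g : R * R * R -> R) : R * R * R -> R :=
  'D_(1, 0, 0) g.
HB.lock Definition D2 (R : realType) (g : R * R * R -> R) : R * R * R -> R :=
  'D_(0, 1, 0) g.
HB.lock Definition D3 (R : realType) (g : R * R * R -> R) : R * R * R -> R :=
  'D_(0, 0, 1) g.

Section Space3.
Variable R : realType.
Local Notation V := (R * R * R)%type.
Implicit Types (g : V -> R) (z : V).

Definition C1 g :=
  (forall z, differentiable g z) /\ forall u : V, continuous ('D_u g : V -> R).

Lemma deriveV3E g z (u : V) : differentiable g z ->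
  'D_u g z = u.1.1 * D1 g z + u.1.2 * D2 g z + u.2 * D3 g z.
Proof.
move=> dg; rewrite D1.unlock D2.unlock D3.unlock !deriveE//.
have {1}-> : u = u.1.1 *: (1, 0, 0) + u.1.2 *: (0, 1, 0) + u.2 *: (0, 0, 1) :> V.
  case: u => -[a b] c; congr (_, _, _) => /=;
  rewrite /GRing.scale/=; ring.
by rewrite !linearD/= !linearZ/=.
Qed.

(* Removing a quadratic in the second coordinate costs nothing here, whereas its
   derivative at the unknown intermediate point would be useless. *)
Lemma mvt3_quad g (dg : forall z, differentiable g z) (k1 k2 k3 k4 : R) (a b : V) :
  exists2 t, 0 <= t <= 1 & let z := a + t *: (b - a) in
  g b - g a - ((b.1.1 - a.1.1) * k1 + (b.1.2 - a.1.2) * k2 + (b.2 - a.2) * k3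
               + (b.1.2 ^+ 2 - a.1.2 ^+ 2) * k4) =
  (b.1.1 - a.1.1) * (D1 g z - k1) + (b.1.2 - a.1.2) * (D2 g z - k2 - 2 * k4 * z.1.2)
  + (b.2 - a.2) * (D3 g z - k3).
Proof.
pose dp := b.1.2 - a.1.2.
pose l := (b.1.1 - a.1.1) * k1 + dp * k2 + (b.2 - a.2) * k3.
pose h (t : R) : R := g (a + t *: (b - a)) - (t * l + (a.1.2 + t * dp) ^+ 2 * k4).
have dh (t : R) : is_derive t 1 h
    ('D_(b - a) g (a + t *: (b - a)) - (l + (2 * (a.1.2 + t * dp) * dp) * k4)).
  have dg' : is_derive t 1 (fun t => g (a + t *: (b - a)))
      ('D_(b - a) g (a + t *: (b - a))).
    by apply: is_derive_line; apply: diff_derivable.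
  apply: is_deriveB; apply: is_derive_eq.
  rewrite /GRing.scale/=; ring.
have [|t t01] := @MVT_segment R _ _ 0 1 ler01 (fun x _ => dh x).
  apply: continuous_subspaceT => x; apply: differentiable_continuous.
  by apply/derivable1_diffP; case: (dh x).
rewrite subr0 mulr1 /h scale1r scale0r addr0 addrC subrKC => E.
exists t; first by move: t01; rewrite in_itv.
rewrite deriveV3E// in E; rewrite [RHS]/=.
move: E; rewrite /= /l/dp /GRing.scale/= => E.
apply: (eq_of_sub E); ring.
Qed.

Lemma mvt3 g (dg : forall z, differentiable g z) (a b : V) :
  exists2 t, 0 <= t <= 1 & let z := a + t *: (b - a) in
  g b - g a = (b.1.1 - a.1.1) * D1 g z + (b.1.2 - a.1.2) * D2 g z
              + (b.2 - a.2) * D3 g z.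
Proof.
have [t t01 E] := mvt3_quad dg 0 0 0 0 a b.
exists t => //; move: E; cbv zeta.
by set d1 := D1 g _; set d2 := D2 g _; set d3 := D3 g _ => E; apply: (eq_of_sub E); ring.
Qed.

End Space3.

(** * Continuous functions on a closed interval *)

Section Interval.
Variable R : realType.
Implicit Types (a b x y : R) (g : R -> R).

(** An epsilon-delta form relative to the closed interval, which makes restriction and composition
    elementary; [cont_on_within] converts it to the subspace topology at the end. *)
Definition cont_on a b g := forall x, a <= x <= b -> forall e : R, 0 < e ->
  exists2 d : R, 0 < d & forall y, a <= y <= b -> `|y - x| < d -> `|g y - g x| < e.

Lemma cont_on_within a b g : cont_on a b g -> {within `[a, b], continuous g}.
Proof.
move=> cg; apply/subspace_continuousP => x /=; rewrite in_itv/= => xab.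
apply/cvgrPdist_lt => e e0.
have [d d0 dP] := cg x xab e e0.
rewrite near_withinE; apply/nbhs_ballP; exists d => //= y.
rewrite -ball_normE/= in_itv/= => xy yab.
by rewrite distrC; apply: dP => //; rewrite distrC.
Qed.

Lemma cont_on_sub a b c d g : a <= c -> d <= b -> cont_on a b g -> cont_on c d g.
Proof.
move=> ac db cg x /andP[cx xd] e e0.
have [|r r0 rP] := cg x _ e e0; first by rewrite (le_trans ac)// (le_trans xd).
by exists r => // y /andP[cy yd]; apply: rP; rewrite (le_trans ac)// (le_trans yd).
Qed.

(** The zero is the supremum of the points where g <= 0. Unlike an arbitrary zero from the
    intermediate value theorem, it comes with a sign up to the end of the interval. *)
Lemma last_zero a b g : a <= b -> cont_on a b g -> g a < 0 -> 0 < g b ->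
  exists2 c, a < c < b & g c = 0 /\ forall x, c < x <= b -> 0 < g x.
Proof.
move=> ab cg ga gb.
pose A := [set x | a <= x <= b /\ g x <= 0].
have Aa : A a by split; [rewrite lexx|exact: ltW].
have ubA : ubound A b by move=> x [/andP[]].
have supA : has_sup A by split; [exists a|exists b].
set c := sup A.
have ac : a <= c by apply: ub_le_sup => //; exists b.
have cb : c <= b by apply: ge_sup => //; exists a.
have gc : g c = 0.
  apply/eqP; rewrite eq_le; apply/andP; split; rewrite leNgt; apply/negP => gc.
    have [|d d0 dP] := cg c _ _ gc; first by rewrite ac cb.
    have [x [xab gx] xc] := sup_adherent d0 supA.
    have xc' : x <= c by apply: ub_le_sup => //; exists b.
    have : `|g x - g c| < g c.
      by apply: dP => //; rewrite ler0_norm ?subr_le0// opprB ltrBlDr -ltrBlDl.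
    by rewrite ltr_norml => /andP[]; rewrite ltrBrDl subrr => /(le_lt_trans gx); rewrite ltxx.
  have [||d d0 dP] := cg c _ (- g c) _; [by rewrite ac cb|by rewrite oppr_gt0|].
  have cltb : c < b.
    by rewrite lt_neqAle cb andbT; apply/eqP => E; move: (lt_trans gc gb); rewrite E ltxx.
  pose x := Num.min b (c + d / 2).
  have cx : c < x by rewrite /x lt_min cltb ltrDl divr_gt0.
  have xb : x <= b by rewrite /x ge_min lexx.
  have xab : a <= x <= b by rewrite xb (le_trans ac) // ltW.
  have : `|g x - g c| < - g c.
    apply: dP => //; rewrite gtr0_norm ?subr_gt0//.
    apply: (@le_lt_trans _ _ (d / 2)); last by rewrite ltr_pdivrMr// mulr2n mulrDr mulr1 ltrDl.
    by rewrite lerBlDl /x ge_min lexx orbT.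
  rewrite ltr_norml => /andP[_]; rewrite ltrBlDl subrr => gx.
  have : x <= c by apply: ub_le_sup; [exists b|split => //; exact: ltW].
  by rewrite leNgt cx.
exists c.
  rewrite !lt_neqAle ac cb !andbT; apply/andP; split; apply/eqP => E.
    by move: ga; rewrite E gc ltxx.
  by move: gb; rewrite -E gc ltxx.
split=> // x /andP[cx xb]; rewrite ltNge; apply/negP => gx.
have : x <= c.
  by apply: ub_le_sup; [exists b|split => //; rewrite xb (le_trans ac)// ltW].
by rewrite leNgt cx.
Qed.

Lemma first_zero a b g : a <= b -> cont_on a b g -> 0 < g a -> g b < 0 ->
  exists2 c, a < c < b & g c = 0 /\ forall x, a <= x < c -> 0 < g x.
Proof.
move=> ab cg ga gb.
have [||||c /andP[bc ca] [gc cP]] := @last_zero (- b) (- a) (fun x => g (- x)).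
- by rewrite lerN2.
- move=> x /andP[bx xa] e e0.
  have [|d d0 dP] := cg (- x) _ e e0; first by rewrite lerNr xa lerNl bx.
  exists d => // y /andP[yb ya] yx; apply: dP; first by rewrite lerNr ya lerNl yb.
  by rewrite -opprD normrN.
- by rewrite opprK.
- by rewrite opprK.
exists (- c); first by rewrite ltrNr ca ltrNl bc.
split=> // x /andP[ax xc]; rewrite -[x]opprK; apply: cP.
by rewrite ltrNr xc lerN2.
Qed.

(** On a segment g attains its maximum, and a point from which g increases to the right cannot be a
    maximum unless it is the right end. The increase is asked at interior points only: at the fold,
    the left end in the application, 1 - tr + det vanishes and gives none. *)
Lemma strict_mono_right a b g : cont_on a b g ->
  (forall x, a < x < b -> exists2 d : R, 0 < d &
    forall y, x < y < x + d -> y <= b -> g x < g y) ->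
  forall x y, a <= x -> x < y -> y <= b -> g x < g y.
Proof.
move=> cg gP.
have open_case x y : a < x -> x < y -> y <= b -> g x < g y.
  move=> ax xy yb.
  have ncont : {within `[x, y], continuous g}.
    by apply: cont_on_within; apply: (cont_on_sub _ _ cg) => //; exact: ltW.
  have [c] := EVT_max (ltW xy) ncont.
  rewrite in_itv/= => /andP[xc cy] cmax.
  have notmax z : x <= z < y -> ~ (forall t, t \in `[x, y] -> g t <= g z).
    move=> /andP[xz zy] zmax.
    have [|d d0 dP] := gP z; first by rewrite (lt_le_trans ax xz) (lt_le_trans zy yb).
    pose t := Num.min y (z + d / 2).
    have zt : z < t by rewrite lt_min zy ltrDl divr_gt0.
    have ty : t <= y by rewrite ge_min lexx.
    have td : t < z + d.
      apply: (@le_lt_trans _ _ (z + d / 2)); first by rewrite ge_min lexx orbT.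
      by rewrite ltrD2l ltr_pdivrMr// mulr2n mulrDr mulr1 ltrDl.
    have := dP t; rewrite zt td (le_trans ty yb) => /(_ isT isT).
    by rewrite ltNge zmax// in_itv/= ty (le_trans xz)// ltW.
  have cE : c = y.
    apply/eqP; rewrite eq_le cy leNgt; apply/negP => c_y.
    by apply: (notmax c) => //; rewrite xc.
  rewrite lt_neqAle; have := cmax x; rewrite cE in_itv/= lexx (ltW xy) => /(_ isT) ->.
  rewrite andbT; apply/eqP => E; apply: (notmax x); first by rewrite lexx.
  by rewrite E; move: cmax; rewrite cE.
move=> x y ax xy yb.
case: (ltgtP a x) ax => // [ax|E] _; first exact: open_case.
rewrite -E in xy *; rewrite ltNge; apply/negP => gya.
(* If g y <= g a, the midpoint m has g m < g a, and all points of (a, m] have values at most g m,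
   against continuity at a. *)
pose m := (a + y) / 2.
have [am my] : a < m /\ m < y by rewrite /m; split; lra.
have gm : g m < g a by apply: lt_le_trans gya; apply: open_case.
have [||d d0 dP] := cg a _ (g a - g m); [by rewrite lexx; lra|by rewrite subr_gt0|].
pose t := Num.min m (a + d / 2).
have at_ : a < t by rewrite lt_min am ltrDl divr_gt0.
have tm : t <= m by rewrite ge_min lexx.
have gtm : g t <= g m.
  case: (ltgtP t m) tm => // [tm|->] _ //; apply/ltW/open_case => //; lra.
have td : t <= a + d / 2 by rewrite ge_min lexx orbT.
have := dP t; rewrite [`|g t - g a|]ltr0_norm; last by rewrite subr_lt0 (le_lt_trans gtm gm).
rewrite gtr0_norm ?subr_gt0//.
have -> : t - a < d by lra.
have -> : a <= t <= b by apply/andP; split; lra.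
by move=> /(_ isT isT); lra.
Qed.

Lemma mono_inverse a b g : a <= b -> cont_on a b g ->
  (forall x y, a <= x -> x < y -> y <= b -> g x < g y) ->
  exists h, [/\ cont_on (g a) (g b) h,
    forall y, g a <= y <= g b -> a <= h y <= b /\ g (h y) = y
    & forall x, a <= x <= b -> h (g x) = x].
Proof.
move=> ab cg gP.
have gle x y : a <= x -> x <= y -> y <= b -> g x <= g y.
  by move=> ax; case: ltgtP => // [xy _ yb|-> _ _]//; apply/ltW/gP.
have ex y : exists x, g a <= y <= g b -> a <= x <= b /\ g x = y.
  have [yab|] := boolP (g a <= y <= g b); last by exists 0.
  have [->|ya] := eqVneq y (g a); first by exists a => _; rewrite lexx ab.
  have [->|yb] := eqVneq y (g b); first by exists b => _; rewrite lexx ab.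
  have [|||c /andP[ac cb] [gc _]] := @last_zero a b (fun x => g x - y) ab.
  - move=> x xab e e0; have [d d0 dP] := cg x xab e e0; exists d => // z zab zx.
    by rewrite opprB addrA subrK; apply: dP.
  - by rewrite subr_lt0 lt_neqAle eq_sym ya; case/andP: yab.
  - by rewrite subr_gt0 lt_neqAle yb; case/andP: yab.
  exists c => _; rewrite !ltW//; split=> //; apply/eqP; rewrite -subr_eq0; exact/eqP.
have [h hP] := choice ex.
have inj x x' : a <= x <= b -> a <= x' <= b -> g x = g x' -> x = x'.
  move=> /andP[ax xb] /andP[ax' xb'] E.
  case: (ltgtP x x') => // l; [have := gP _ _ ax l xb'|have := gP _ _ ax' l xb];
  by rewrite E ltxx.
exists h; split => //; last first.
  move=> x /andP[ax xb].
  have [|hx gh] := hP (g x); first by rewrite !gle.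
  by apply: inj => //; rewrite ax.
move=> y yab e e0; have [hab ghy] := hP y yab.
case/andP: (hab) => ah hb.
(* At distance at least e to the right of h y, the values of g stay away from y; if h y + e exceeds
   b there is no such point and 1 serves as default. The left side is similar. *)
have [d1 d10 d1P] : exists2 d : R, 0 < d & forall x, a <= x <= b -> h y + e <= x -> d <= g x - y.
  have [hyb|hyb] := leP (h y + e) b.
    exists (g (h y + e) - y).
      by rewrite subr_gt0 -{1}ghy; apply: gP => //; rewrite ltrDl.
    by move=> x /andP[ax xb] hx; rewrite lerD2r; apply: gle => //; lra.
  by exists 1 => // x /andP[_ xb] hx; lra.
have [d2 d20 d2P] : exists2 d : R, 0 < d & forall x, a <= x <= b -> x <= h y - e -> d <= y - g x.
  have [hyb|hyb] := leP a (h y - e).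
    exists (y - g (h y - e)).
      by rewrite subr_gt0 -{2}ghy; apply: gP => //; rewrite gtrDl oppr_lt0.
    by move=> x /andP[ax xb] hx; rewrite lerD2l lerN2; apply: gle => //; lra.
  by exists 1 => // x /andP[ax _] hx; lra.
exists (Num.min d1 d2); first by rewrite lt_min d10.
move=> y' y'ab; rewrite lt_min => /andP[y1 y2].
have [h'ab gh'] := hP y' y'ab.
rewrite ltr_norml !ltNge; apply/andP; split; apply/negP => H.
  have := d2P (h y') h'ab; rewrite gh' => /(_ ltac:(lra)) => A.
  by move: (lt_le_trans y2 A); rewrite ltNge -normrN opprB ler_norm.
have := d1P (h y') h'ab; rewrite gh' => /(_ ltac:(lra)) => A.
by move: (lt_le_trans y1 A); rewrite ltNge ler_norm.
Qed.

End Interval.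

(** * Fixed points of a map close to the limit return map *)

Section FoldFlip.
Variable R : realType.
Local Notation V := (R * R * R)%type.

Lemma lipschitz_cont_on (a b C : R) (g : R -> R) :
  (forall x y, a <= x <= b -> a <= y <= b -> `|g y - g x| <= C * `|y - x|) ->
  cont_on a b g.
Proof.
move=> gC x xab e e0; exists (e / (`|C| + 1)); first by rewrite divr_gt0// ltr_pwDr.
move=> y yab; rewrite ltr_pdivlMr ?ltr_pwDr// => yx.
apply: le_lt_trans (gC _ _ xab yab) _; apply: le_lt_trans yx.
rewrite mulrC ler_wpM2l// (le_trans (ler_norm C))// lerDl ler01//.
Qed.

Lemma norm3_lt (z : V) (d : R) :
  (`|z| < d) = [&& `|z.1.1| < d, `|z.1.2| < d & `|z.2| < d].
Proof. by case: z => -[x y] w; rewrite !prod_normE/= !gt_max andbA. Qed.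

Lemma cont_on_comp3 (a b : R) (x y w : R -> R) (g : V -> R) : continuous g ->
  cont_on a b x -> cont_on a b y -> cont_on a b w ->
  cont_on a b (fun t => g (x t, y t, w t)).
Proof.
move=> cg cx cy cw t tab e e0.
have /cvgrPdist_lt/(_ e e0)/nbhs_normP[d/= d0 dP] := cg (x t, y t, w t).
have [d1 d10 d1P] := cx t tab d d0.
have [d2 d20 d2P] := cy t tab d d0.
have [d3 d30 d3P] := cw t tab d d0.
exists (Num.min d1 (Num.min d2 d3)); first by rewrite !lt_min d10 d20.
move=> s sab; rewrite !lt_min => /and3P[s1 s2 s3].
rewrite distrC; apply: dP; rewrite /= norm3_lt/=.
rewrite distrC d1P//=; rewrite distrC d2P//=; by rewrite distrC d3P.
Qed.

(** The first coordinate has its own bound: in the application [M] grows with k while [L] is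
    fixed. *)
Definition inbox (M L : R) (z : V) :=
  [/\ `|z.1.1| <= M, `|z.1.2| <= L & `|z.2| <= L].

Lemma between_norm (x y M s : R) : 0 <= s <= 1 -> `|x| <= M -> `|y| <= M ->
  `|x + s * (y - x)| <= M.
Proof.
rewrite !ler_norml => /andP[s0 s1] /andP[x1 x2] /andP[y1 y2].
apply/andP; split; nra.
Qed.

Lemma inbox_between (M L s : R) (a b : V) : 0 <= s <= 1 ->
  inbox M L a -> inbox M L b -> inbox M L (a + s *: (b - a)).
Proof. by move=> s01 [? ? ?] [? ? ?]; split; apply: between_norm. Qed.

Lemma dist_between (s d : R) (a b : V) : 0 <= s <= 1 ->
  `|b - a| < d -> `|a - (a + s *: (b - a))| < d.
Proof.
move=> /andP[s0 s1] ab; rewrite opprD addNKr normrN normrZ.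
by rewrite ger0_norm//; apply: le_lt_trans ab; rewrite ler_piMl.
Qed.

Definition jdet (P Q : V -> R) (z : V) := D1 P z * D2 Q z - D2 P z * D1 Q z.
Definition jtr (P Q : V -> R) (z : V) := D1 P z + D2 Q z.

Lemma C1_D1 (g : V -> R) : C1 g -> continuous (D1 g).
Proof. by move=> [_]; rewrite D1.unlock; apply. Qed.

Lemma C1_D2 (g : V -> R) : C1 g -> continuous (D2 g).
Proof. by move=> [_]; rewrite D2.unlock; apply. Qed.

Lemma C1_D3 (g : V -> R) : C1 g -> continuous (D3 g).
Proof. by move=> [_]; rewrite D3.unlock; apply. Qed.

Lemma jdet_continuous (P Q : V -> R) : C1 P -> C1 Q -> continuous (jdet P Q).
Proof.
move=> cP cQ z; apply: cvgB; apply: cvgM.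
- exact: C1_D1 cP z.
- exact: C1_D2 cQ z.
- exact: C1_D2 cP z.
- exact: C1_D1 cQ z.
Qed.

Lemma jtr_continuous (P Q : V -> R) : C1 P -> C1 Q -> continuous (jtr P Q).
Proof.
by move=> cP cQ z; apply: cvgD; [exact: C1_D1 cP z|exact: C1_D2 cQ z].
Qed.

(** The expression is 1 - tr + det with the derivatives of P and of Q taken at different points,
    since the mean value theorem gives each function its own intermediate point. *)
Lemma jdet_sub_near (P Q : V -> R) z : C1 P -> C1 Q ->
  0 < 1 - jtr P Q z + jdet P Q z ->
  exists2 d : R, 0 < d & forall u w : V, `|z - u| < d -> `|z - w| < d ->
    0 < (1 - D1 P u) * (1 - D2 Q w) - D2 P u * D1 Q w.
Proof.
move=> cP cQ S0.
pose h (x : V * V) := (1 - D1 P x.1) * (1 - D2 Q x.2) - D2 P x.1 * D1 Q x.2.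
have : h @ (z, z) --> h (z, z).
  have c1 (g : V -> R) : continuous g -> (fun x : V * V => g x.1) @ (z, z) --> g z.
    by move=> cg; apply: (@cvg_comp _ _ _ fst g _ (nbhs z)) (cg z); exact: cvg_fst.
  have c2 (g : V -> R) : continuous g -> (fun x : V * V => g x.2) @ (z, z) --> g z.
    by move=> cg; apply: (@cvg_comp _ _ _ snd g _ (nbhs z)) (cg z); exact: cvg_snd.
  apply: cvgB; apply: cvgM.
  - by apply: cvgB; [exact: cvg_cst|exact: (c1 _ (C1_D1 cP))].
  - by apply: cvgB; [exact: cvg_cst|exact: (c2 _ (C1_D2 cQ))].
  - exact: (c1 _ (C1_D2 cP)).
  - exact: (c2 _ (C1_D1 cQ)).
have h0 : 0 < h (z, z) by rewrite /h/=; move: S0; rewrite /jtr/jdet; congr (_ < _); ring.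
move=> /cvgrPdist_lt/(_ _ h0)/nbhs_normP[d/= d0 dP].
exists d => // u w zu zw.
have := dP (u, w); rewrite /= prod_normE/= gt_max zu zw => /(_ isT).
by rewrite ltr_norml => /andP[_]; rewrite /h/=; lra.
Qed.

Lemma normM_le (x y a b : R) : `|x| <= a -> `|y| <= b -> `|x * y| <= a * b.
Proof. by move=> xa yb; rewrite normrM ler_pM. Qed.

Lemma jacobian_bounds (c t L p a1 a2 b1 b2 : R) :
  -1 < c < 1 -> 0 < t -> t <= 1 / 4 -> `|p| <= L ->
  `|a1| <= t -> `|a2 - c| <= t -> `|b1 - 1| <= t -> `|b2 - (1 - c - p)| <= t ->
  [/\ `|1 - (a1 + b2) + (a1 * b2 - a2 * b1) - p| <= t * (L + 10),
      `|1 + (a1 + b2) + (a1 * b2 - a2 * b1) - (2 * (1 - c) - p)| <= t * (L + 10)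
    & `|(a1 * b2 - a2 * b1) + c| <= t * (L + 10)].
Proof.
move=> /andP[c1 c2] t0 t4 pL h1 h2 h3 h4.
have nc : `|c| <= 1 by rewrite ler_norml; lra.
have h14 : `|b2 - (1 - c - p)| <= 1 / 4 by lra.
have h13 : `|b1 - 1| <= 1 / 4 by lra.
have := normM_le h1 nc; have := normM_le h1 pL; have := normM_le h1 h14.
have := normM_le nc h3; have := normM_le h2 h13.
move: h1 h2 h3 h4; set x1 := a1; set x2 := a2 - c; set y1 := b1 - 1.
set y2 := b2 - (1 - c - p).
have -> : a2 = c + x2 by rewrite /x2; ring.
have -> : b1 = 1 + y1 by rewrite /y1; ring.
have -> : b2 = 1 - c - p + y2 by rewrite /y2; ring.
rewrite !ler_norml => /andP[? ?] /andP[? ?] /andP[? ?] /andP[? ?].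
move=> /andP[? ?] /andP[? ?] /andP[? ?] /andP[? ?] /andP[? ?].
by split; apply/andP; split; lra.
Qed.

Section Box.
Variables (c kappa t L M : R) (P Q : V -> R).
Hypotheses (c1 : -1 < c < 1) (t0 : 0 < t) (t4 : t <= 1 / 4).
Hypotheses (dP : forall z, differentiable P z) (dQ : forall z, differentiable Q z).
Hypothesis boxP : forall z, inbox M L z ->
  [/\ `|P z| < M, `|D1 P z| <= t, `|D2 P z - c| <= t & `|D3 P z - kappa| <= t].
Hypothesis boxQ : forall z, inbox M L z ->
  [/\ `|D1 Q z - 1| <= t, `|D2 Q z - (1 - c - z.1.2)| <= t
    & `|D3 Q z - (1 - kappa)| <= t].

(** A Lipschitz constant for solutions phi of P = phi as functions of the other two coordinates. *)
Let A := 2 * (1 + `|kappa|) + 2.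

Lemma box_first a b : inbox M L a -> inbox M L b ->
  `|P b - P a| <= (`|b.1.1 - a.1.1| + `|b.1.2 - a.1.2| + `|b.2 - a.2|) * (2 + `|kappa|).
Proof.
have [t0' t4' c1'] := And3 t0 t4 c1; move=> ba bb; have [s s01] := mvt3 dP a b.
have [] := boxP (inbox_between s01 ba bb).
move: (a + s *: (b - a)) => z _; cbv zeta.
move: (D1 P z) (D2 P z) (D3 P z) => u1 u2 u3 h1 h2 h3 ->.
have k0 := normr_ge0 kappa.
have nD2 : `|u2| <= 2 + `|kappa|.
  by move: h2; rewrite !ler_norml; case/andP: c1' => ? ? /andP[? ?]; apply/andP; split; lra.
have nD3 : `|u3| <= 2 + `|kappa|.
  have := ler_normD (u3 - kappa) kappa; rewrite subrK; lra.
have nD1 : `|u1| <= 2 + `|kappa| by lra.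
apply: le_trans (ler_normD _ _) _; rewrite !(mulrDl _ _ (2 + _)).
apply: lerD; last by apply: normM_le.
by apply: le_trans (ler_normD _ _) _; apply: lerD; apply: normM_le.
Qed.

(** As [D1 P] is at most 1/4, the increment of phi on the right-hand side can be absorbed on the
    left. *)
Lemma box_dphi a b : inbox M L a -> inbox M L b -> P a = a.1.1 -> P b = b.1.1 ->
  `|b.1.1 - a.1.1| <= A * (`|b.1.2 - a.1.2| + `|b.2 - a.2|).
Proof.
have [t0' t4' c1'] := And3 t0 t4 c1; move=> ba bb Pa Pb; have [s s01] := mvt3 dP a b.
have [] := boxP (inbox_between s01 ba bb).
move: (a + s *: (b - a)) => z _; cbv zeta.
move: (D1 P z) (D2 P z) (D3 P z) => u1 u2 u3 h1 h2 h3; rewrite Pa Pb => E.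
have h1' : `|u1| <= 1 / 4 by lra.
have := normM_le (lexx `|b.1.1 - a.1.1|) h1'.
have h2' : `|u2| <= 5 / 4.
  by move: h2; rewrite !ler_norml; case/andP: c1' => ? ? /andP[? ?]; apply/andP; split; lra.
have := normM_le (lexx `|b.1.2 - a.1.2|) h2'.
have h3' : `|u3| <= `|kappa| + 1 / 4.
  have := ler_normD (u3 - kappa) kappa; rewrite subrK; lra.
have := normM_le (lexx `|b.2 - a.2|) h3'.
have := ler_normD ((b.1.1 - a.1.1) * u1 + (b.1.2 - a.1.2) * u2) ((b.2 - a.2) * u3).
have := ler_normD ((b.1.1 - a.1.1) * u1) ((b.1.2 - a.1.2) * u2).
rewrite -E /A => *.
have n2 := normr_ge0 (b.1.2 - a.1.2); have n3 := normr_ge0 (b.2 - a.2).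
have k0 := normr_ge0 kappa.
have := mulr_ge0 k0 n2; have := mulr_ge0 k0 n3; lra.
Qed.

(** Adding the mean value identities of P and Q eliminates phi up to small terms, because [D1 Q] is
    close to 1. The remaining coefficients are close to c + (1 - c - p) - 1 = - p and kappa + (1 -
    kappa) = 1, so Q - p varies like e - p^2 / 2 along solutions of P = phi. *)
Lemma box_F a b : inbox M L a -> inbox M L b -> P a = a.1.1 -> P b = b.1.1 ->
  `|(Q b - b.1.2) - (Q a - a.1.2)
    - ((b.2 - a.2) - (b.1.2 ^+ 2 - a.1.2 ^+ 2) / 2)| <=
  t * (3 * A) * (`|b.1.2 - a.1.2| + `|b.2 - a.2|).
Proof.
have [t0' t4' c1'] := And3 t0 t4 c1; move=> ba bb Pa Pb.
have [s s01 E1] := mvt3 dP a b.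
have [_ h1 h2 h3] := boxP (inbox_between s01 ba bb).
have [s' s'01 E2] := mvt3_quad dQ 1 (1 - c) (1 - kappa) (- (1 / 2)) a b.
have [k1 k2 k3] := boxQ (inbox_between s'01 ba bb).
have bd := box_dphi ba bb Pa Pb.
move: E1 E2 h1 h2 h3 k1 k2 k3; cbv zeta.
move: (a + s *: (b - a)) (a + s' *: (b - a)) => z z'.
move: (D1 P z) (D2 P z) (D3 P z) (D1 Q z') (D2 Q z') (D3 Q z') => p1 p2 p3 q1 q2 q3.
move=> E1 E2 h1 h2 h3 k1 k2 k3.
have k2' : `|q2 - (1 - c) - 2 * (- (1 / 2)) * z'.1.2| <= t.
  by move: k2; congr (`|_| <= _); field.
rewrite Pa Pb in E1.
have -> : Q b - b.1.2 - (Q a - a.1.2) - (b.2 - a.2 - (b.1.2 ^+ 2 - a.1.2 ^+ 2) / 2) =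
  (b.1.1 - a.1.1) * (p1 + (q1 - 1)) +
  (b.1.2 - a.1.2) * ((p2 - c) + (q2 - (1 - c) - 2 * (- (1 / 2)) * z'.1.2)) +
  (b.2 - a.2) * ((p3 - kappa) + (q3 - (1 - kappa))).
  have E := f_equal2 (fun x y : R => x + y) E1 E2.
  by apply: (eq_of_sub E); field.
have n1 : `|p1 + (q1 - 1)| <= 2 * t.
  by apply: le_trans (ler_normD _ _) _; lra.
have n2 : `|(p2 - c) + (q2 - (1 - c) - 2 * (- (1 / 2)) * z'.1.2)| <= 2 * t.
  by apply: le_trans (ler_normD _ _) _; lra.
have n3 : `|(p3 - kappa) + (q3 - (1 - kappa))| <= 2 * t.
  by apply: le_trans (ler_normD _ _) _; lra.
have := normM_le (lexx `|b.1.1 - a.1.1|) n1.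
have := normM_le (lexx `|b.1.2 - a.1.2|) n2.
have := normM_le (lexx `|b.2 - a.2|) n3.
move: n1 n2 n3; set u1 := _ + _; set u2 := _ + _; set u3 := _ + _ => n1 n2 n3 m1 m2 m3.
have t1 := ler_normD ((b.1.1 - a.1.1) * u1 + (b.1.2 - a.1.2) * u2) ((b.2 - a.2) * u3).
have t2 := ler_normD ((b.1.1 - a.1.1) * u1) ((b.1.2 - a.1.2) * u2).
have bd' := ler_wpM2r (ltW t0) bd.
have nn : 0 <= t * (`|b.1.2 - a.1.2| + `|b.2 - a.2|) by rewrite mulr_ge0 ?addr_ge0// ltW.
have nA : 0 <= (A - 2) * (t * (`|b.1.2 - a.1.2| + `|b.2 - a.2|)).
  by rewrite mulr_ge0// /A addrK mulr_ge0// addr_ge0.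
nra.
Qed.

End Box.

Lemma cont_on_comp (a b c d : R) (h g : R -> R) : cont_on a b h ->
  (forall x, a <= x <= b -> c <= h x <= d) -> cont_on c d g ->
  cont_on a b (fun x => g (h x)).
Proof.
move=> ch hab cg x xab e e0; have [r r0 rP] := cg _ (hab x xab) e e0.
have [q q0 qP] := ch x xab r r0; exists q => // y yab yx.
by apply: rP; [exact: hab|exact: qP].
Qed.

(** The bracket is the coefficient of the increment of e after phi is eliminated between the two
    fixed point equations; its limit is kappa + (1 - kappa) = 1. *)
Lemma bracket_gt0 (kappa t u1 u3 w1 w3 : R) : 0 < t -> t <= 1 / 4 ->
  t * (2 * `|kappa| + 4) < 1 -> `|u1| <= t -> `|u3 - kappa| <= t ->
  `|w1 - 1| <= t -> `|w3 - (1 - kappa)| <= t -> 0 < w1 * u3 + w3 * (1 - u1).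
Proof.
move=> t0 t4 tk h1 h2 h3 h4.
have h2' : `|u3 - kappa| <= 1 / 4 by lra.
have h4' : `|w3 - (1 - kappa)| <= 1 / 4 by lra.
have := normM_le h3 (lexx `|kappa|); have := normM_le h3 h2'.
have := normM_le h1 h4'; have := normM_le h1 (lexx `|kappa|).
have -> : w1 * u3 + w3 * (1 - u1) = 1 + ((w1 - 1) * kappa) + ((w1 - 1) * (u3 - kappa))
  + (u3 - kappa) + (w3 - (1 - kappa)) - u1 + u1 * kappa - u1 * (w3 - (1 - kappa)) by ring.
move: h1 h2 h4; rewrite !ler_norml.
do 7 (case/andP=> ? ?); lra.
Qed.

(** For each p the equation P = phi is solved for phi and then Q = p for e, both by the intermediate
    value theorem; the bounds on increments make the chosen solutions Lipschitz. One value of Q, at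
    p = p0 and e = 0, is enough because [box_F] carries it to every other p and e. The tolerance t
    does not depend on M, which is what allows M to grow with k. *)
Lemma fold_flip_branch (c kappa p0 Delta : R) :
  0 < Delta -> -1 < c < 1 - Num.sqrt Delta / 2 ->
  exists t L : R, [/\ 0 < t, 0 < L & forall (P Q : V -> R) (M : R),
    C1 P -> C1 Q -> 0 < M ->
    (forall z, inbox M L z ->
      [/\ `|P z| < M, `|D1 P z| <= t, `|D2 P z - c| <= t & `|D3 P z - kappa| <= t]) ->
    (forall z, inbox M L z ->
      [/\ `|D1 Q z - 1| <= t, `|D2 Q z - (1 - c - z.1.2)| <= t
        & `|D3 Q z - (1 - kappa)| <= t]) ->
    (forall phi, `|phi| <= M -> P (phi, p0, 0) = phi ->
      `|Q (phi, p0, 0) - p0 - (Delta - p0 ^+ 2) / 2| <= t) ->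
    exists (em ep : R) (phi p : R -> R), let z e := (phi e, p e, e) in
    [/\ [/\ - L <= em, em < 0, 0 < ep & ep <= L],
        cont_on em ep phi /\ cont_on em ep p,
        forall e : R, em <= e <= ep -> [/\ inbox M L (z e), P (z e) = phi e & Q (z e) = p e],
        forall e : R, em < e < ep -> [/\ 0 < 1 - jtr P Q (z e) + jdet P Q (z e),
          0 < 1 + jtr P Q (z e) + jdet P Q (z e) & jdet P Q (z e) < 1]
      & 1 - jtr P Q (z em) + jdet P Q (z em) = 0 /\
        1 + jtr P Q (z ep) + jdet P Q (z ep) = 0]].
Proof.
move=> D0 /andP[c1 cD]; set r := Num.sqrt Delta in cD.
have r0 : 0 < r by rewrite sqrtr_gt0.
have rE : r ^+ 2 = Delta by rewrite sqr_sqrtr// ltW.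
have c2 : -1 < c < 1 by lra.
(* The gap between the limit flip p = 2 (1 - c) and p = r, where the limit parabola crosses e =
   0. *)
set g := 2 * (1 - c) - r; have g0 : 0 < g by rewrite /g; lra.
(* [s] is the final tolerance. The bound by (1 + c) / 2 keeps det < 1; those by r / 4 and g / 4
   separate fold and flip from p = r; those by Delta / 8 and g r / 4 fix the sign of e at the two
   ends. *)
have [s [s0 s4 sc [sr sg] [sD sgr]]] : exists s : R, [/\ 0 < s, s <= 1 / 4, s <= (1 + c) / 2,
    s <= r / 4 /\ s <= g / 4 & s <= Delta / 8 /\ s <= g * r / 4].
  exists (Num.min (1 / 4) (Num.min ((1 + c) / 2) (Num.min (r / 4) (Num.min (g / 4)
    (Num.min (Delta / 8) (g * r / 4)))))).
  have gr := mulr_gt0 g0 r0.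
  split; [|by rewrite !ge_min lexx ?orbT..|split|split]; rewrite ?ge_min ?lexx ?orbT//.
  rewrite !lt_min; apply/and5P; split; [lra..|]; apply/andP; split; lra.
(* [L] exceeds the values of |e| that are needed, p^2 / 2 <= 11 on [I] and Delta / 2, each plus the
   tolerance, and also |p0|. *)
pose L := `|p0| + Delta + 20; pose A := 2 * (1 + `|kappa|) + 2.
have p0n := normr_ge0 p0; have kn := normr_ge0 kappa.
have L20 : 20 <= L by rewrite /L; lra.
have p0L : `|p0| <= L by rewrite /L; lra.
have DL : Delta + 20 <= L by rewrite /L; lra.
have A4 : 4 <= A by rewrite /A; lra.
have kA : 2 * `|kappa| + 4 <= A by rewrite /A; lra.
(* [B] dominates the factors that multiply t in the errors below, so that each of these errors is at
   most s. *)
pose B := 1 + 3 * A * (3 * L) + (L + 10).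
have AL : 0 <= 3 * A * (3 * L) by apply: mulr_ge0; lra.
have B1 : 1 <= B by rewrite /B; lra.
pose t := s / B.
have t0 : 0 < t by rewrite divr_gt0// (lt_le_trans ltr01).
have tB : t * B = s by rewrite /t divfK// gt_eqF// (lt_le_trans ltr01).
have tle x : x <= B -> t * x <= s by move=> xB; rewrite -tB ler_wpM2l// ltW.
have ts : t <= s by have := tle 1 B1; rewrite mulr1.
have t4 : t <= 1 / 4 by lra.
have t3A : t * (3 * A) <= s.
  apply: tle; apply: (@le_trans _ _ (3 * A * (3 * L))); last by rewrite /B; lra.
  by rewrite ler_peMr//; clear -L20 A4; lra.
have tL10 : t * (L + 10) <= s by apply: tle; rewrite /B; lra.
have tV : t + t * (3 * A) * (3 * L) <= s.
  have -> : t + t * (3 * A) * (3 * L) = t * (1 + 3 * A * (3 * L)) by ring.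
  by apply: tle; rewrite /B; lra.
have tk : t * (2 * `|kappa| + 4) < 1.
  apply: (@le_lt_trans _ _ (1 / 4)); last lra.
  apply: (@le_trans _ _ s) => //; apply: tle; apply: (le_trans kA).
  apply: (@le_trans _ _ (3 * A * (3 * L))); last by rewrite /B; lra.
  by rewrite [3 * A]mulrC -mulrA ler_peMr//; clear -L20 A4; lra.
(* As c > -1 and s <= 1/4, this interval contains every p from - 2 s to 2 (1 - c) + 2 s. *)
pose I (p : R) := - (1 / 2) <= p <= 9 / 2.
have Ir : I r by rewrite /I; clear -r0 cD c1; apply/andP; split; lra.
have Ia : I (- (2 * s)) by rewrite /I; clear -s0 s4; apply/andP; split; lra.
have Ib : I (2 * (1 - c) + 2 * s).
  by rewrite /I; clear -r0 cD c1 s0 s4; apply/andP; split; lra.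
have IL p : I p -> `|p| <= L by rewrite ler_norml /I; clear -L20 => /andP[? ?]; apply/andP; split; lra.
have p2 p : I p -> p ^+ 2 / 2 <= 11 by rewrite /I expr2; clear => /andP[? ?]; nra.
have gE : 2 * (1 - c) = r + g by rewrite /g; ring.
exists t, L; split => //; first by clear -L20; lra.
move=> P Q M CP CQ M0 boxP boxQ base.
have dP := CP.1; have dQ := CQ.1.
(* For fixed p and e the map P sends [-M, M] strictly inside itself. Outside the range of p and e
   the value 0 is a placeholder. *)
have exphi (x : R * R) : exists f : R, `|x.1| <= L -> `|x.2| <= L ->
    `|f| <= M /\ P (f, x.1, x.2) = f.
  case: x => p e /=.
  have [pL|pL] := boolP (`|p| <= L); last by exists 0.
  have [eL|eL] := boolP (`|e| <= L); last by exists 0.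
  have inb x : - M <= x <= M -> inbox M L (x, p, e) by rewrite -ler_norml.
  have [||||f /andP[f1 f2] [fE _]] := @last_zero _ (- M) M (fun f => f - P (f, p, e)).
  - by clear -M0; lra.
  - apply: (@lipschitz_cont_on _ _ (1 + (2 + `|kappa|))) => x y xM yM.
    have := box_first c2 t0 t4 dP boxP (inb _ xM) (inb _ yM).
    rewrite /= !subrr normr0 !addr0 => h.
    have -> : y - P (y, p, e) - (x - P (x, p, e)) =
      (y - x) - (P (y, p, e) - P (x, p, e)) by ring.
    by apply: le_trans (ler_normB _ _) _; rewrite mulrDl mul1r lerD2l mulrC.
  - have [|+ _ _ _] := boxP (- M, p, e); first by apply: inb; clear -M0; lra.
    by rewrite ltr_norml => /andP[+ _]; rewrite subr_lt0.
  - have [|+ _ _ _] := boxP (M, p, e); first by apply: inb; clear -M0; lra.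
    by rewrite ltr_norml => /andP[_ +]; rewrite subr_gt0.
  exists f => _ _; split; first by rewrite ler_norml !ltW.
  by apply/esym/eqP; rewrite -subr_eq0 fE.
have [Phi PhiP] := choice exphi.
pose G p e : V := (Phi (p, e), p, e).
have GP p e : `|p| <= L -> `|e| <= L -> inbox M L (G p e) /\ P (G p e) = (G p e).1.1.
  by move=> pL eL; have [/= h1 h2] := PhiP (p, e) pL eL; split.
pose F p e := Q (G p e) - p.
have FF p e p' e' : `|p| <= L -> `|e| <= L -> `|p'| <= L -> `|e'| <= L ->
    `|F p' e' - F p e - ((e' - e) - (p' ^+ 2 - p ^+ 2) / 2)| <=
    t * (3 * A) * (`|p' - p| + `|e' - e|).
  move=> pL eL pL' eL'; have [b1 P1] := GP _ _ pL eL; have [b2 P2] := GP _ _ pL' eL'.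
  exact: (box_F c2 t0 t4 dP dQ boxP boxQ b1 b2 P1 P2).
have F0 p e : `|p| <= L -> `|e| <= L -> `|F p e - (e + (Delta - p ^+ 2) / 2)| <= s.
  move=> pL eL.
  have z0 : `|0 : R| <= L by rewrite normr0; clear -L20; lra.
  have [f1 f2] := PhiP (p0, 0) p0L z0.
  have base' := base _ f1 f2.
  apply: le_trans tV.
  have -> : F p e - (e + (Delta - p ^+ 2) / 2) =
    (Q (Phi (p0, 0), p0, 0) - p0 - (Delta - p0 ^+ 2) / 2) +
    (F p e - F p0 0 - ((e - 0) - (p ^+ 2 - p0 ^+ 2) / 2)) by rewrite /F /G; field.
  apply: le_trans (ler_normD _ _) _; apply: lerD => //.
  apply: le_trans (FF _ _ _ _ p0L z0 pL eL) _.
  apply: ler_wpM2l; first by clear -t0 A4; apply: mulr_ge0; lra.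
  by have := ler_normB p p0; rewrite subr0; clear -pL p0L eL; lra.
have exE (p : R) : exists e, I p -> `|e| <= L /\ F p e = 0.
  have [Ip|] := boolP (I p); last by exists 0.
  have [||||e /andP[e1 e2] [eE _]] := @last_zero _ (- L) L (F p).
  - by clear -L20; lra.
  - apply: (@lipschitz_cont_on _ _ (1 + s)) => x y xL yL.
    rewrite -!ler_norml in xL yL.
    have := FF _ _ _ _ (IL _ Ip) xL (IL _ Ip) yL.
    rewrite !subrr normr0 add0r mul0r subr0 => h.
    have -> : F p y - F p x = (y - x) + (F p y - F p x - (y - x)) by ring.
    apply: le_trans (ler_normD _ _) _; rewrite mulrDl mul1r lerD2l.
    by apply: le_trans h _; apply: ler_wpM2r.
  - have := F0 p (- L) (IL _ Ip); rewrite normrN ger0_norm; last by clear -L20; lra.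
    move=> /(_ (lexx _)); rewrite ler_norml => /andP[_].
    have := sqr_ge0 p; move: (F _ _) (p ^+ 2); clear -s4 L20 DL => ? ?; lra.
  - have := F0 p L (IL _ Ip); rewrite ger0_norm; last by clear -L20; lra.
    move=> /(_ (lexx _)); rewrite ler_norml => /andP[+ _].
    have := p2 p Ip; move: (F _ _) (p ^+ 2); clear -s4 L20 D0 => ? ?; lra.
  by exists e => _; split => //; rewrite ler_norml !ltW.
have [E EP] := choice exE.
have Eval p : I p -> `|E p - (p ^+ 2 - Delta) / 2| <= s.
  move=> Ip; have [EL EF] := EP p Ip; have := F0 p (E p) (IL _ Ip) EL.
  by rewrite EF -normrN; congr (`|_| <= _); field.
have Elip p p' : I p -> I p' -> `|E p' - E p| <= 7 * `|p' - p|.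
  move=> Ip Ip'; have [EL EF] := EP p Ip; have [EL' EF'] := EP p' Ip'.
  have := FF _ _ _ _ (IL _ Ip) EL (IL _ Ip') EL'; rewrite EF EF' !subrr sub0r normrN => h.
  have {}h : `|E p' - E p - (p' ^+ 2 - p ^+ 2) / 2| <= 1 / 4 * (`|p' - p| + `|E p' - E p|).
    by apply: le_trans h _; apply: ler_wpM2r; [rewrite addr_ge0|exact: le_trans s4].
  have sq : `|(p' ^+ 2 - p ^+ 2) / 2| <= `|p' - p| * (9 / 2).
    have -> : (p' ^+ 2 - p ^+ 2) / 2 = (p' - p) * ((p' + p) / 2) by field.
    apply: normM_le => //; rewrite ler_norml; case/andP: Ip Ip'; clear=> ? ? /andP[? ?].
    by apply/andP; split; lra.
  have := ler_normD (E p' - E p - (p' ^+ 2 - p ^+ 2) / 2) ((p' ^+ 2 - p ^+ 2) / 2).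
  rewrite subrK; have := normr_ge0 (p' - p).
  by move: (`|E p' - E p|) (`|p' - p|) h sq; clear=> ? ?; lra.
pose f p := Phi (p, E p); pose Z p : V := (f p, p, E p).
have ZP p : I p -> [/\ inbox M L (Z p), P (Z p) = f p & Q (Z p) = p].
  move=> Ip; have [EL EF] := EP p Ip; have [h1 h2] := GP p (E p) (IL _ Ip) EL.
  by split => //; apply/eqP; rewrite -subr_eq0; apply/eqP.
have flip p p' : I p -> I p' -> `|f p' - f p| <= 8 * A * `|p' - p|.
  move=> Ip Ip'; have [b1 P1 _] := ZP p Ip; have [b2 P2 _] := ZP p' Ip'.
  have /= h := box_dphi c2 t0 t4 dP boxP b1 b2 P1 P2.
  rewrite -/A in h; apply: (le_trans h); rewrite [8 * A]mulrC -mulrA; apply: ler_wpM2l; first by clear -A4; lra.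
  by have := Elip p p' Ip Ip'; clear; lra.
have lipI (a b C : R) (h : R -> R) : (forall p p', I p -> I p' -> `|h p' - h p| <= C * `|p' - p|) ->
    I a -> I b -> cont_on a b h.
  move=> hC /andP[ga _] /andP[_ gb]; apply: (@lipschitz_cont_on _ _ C) => x y /andP[? ?] /andP[? ?].
  by apply: hC; rewrite /I; apply/andP; split; by [apply: le_trans ga _|apply: le_trans gb].
have cZ (a b : R) (h : V -> R) : continuous h -> I a -> I b -> cont_on a b (fun p => h (Z p)).
  move=> ch Ha Hb; apply: cont_on_comp3 => //.
  - exact: lipI flip Ha Hb.
  - by apply: (lipI _ _ 1) => // p p' _ _; rewrite mul1r.
  - exact: lipI Elip Ha Hb.
have [Sf SfE] : exists Sf : R -> R, forall p, Sf p = 1 - jtr P Q (Z p) + jdet P Q (Z p).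
  by exists (fun p => 1 - jtr P Q (Z p) + jdet P Q (Z p)).
have [Df DfE] : exists Df : R -> R, forall p, Df p = 1 + jtr P Q (Z p) + jdet P Q (Z p).
  by exists (fun p => 1 + jtr P Q (Z p) + jdet P Q (Z p)).
have bnd p : I p -> [/\ `|Sf p - p| <= s, `|Df p - (2 * (1 - c) - p)| <= s & jdet P Q (Z p) < 1].
  move=> Ip; have [bz _ _] := ZP p Ip; have [_ h1 h2 _] := boxP _ bz; have [k1 k2 _] := boxQ _ bz.
  have [b1 b2 b3] := jacobian_bounds c2 t0 t4 (IL _ Ip) h1 h2 k1 k2.
  rewrite SfE DfE; split; [exact: le_trans b1 tL10|exact: le_trans b2 tL10|].
  move: (le_trans b3 tL10); rewrite ler_norml /jdet => /andP[_].
  by move: (D1 P (Z p) * D2 Q (Z p)) (D2 P (Z p) * D1 Q (Z p)); clear -sc c1 => ? ? ?; lra.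
have cS (a b : R) : I a -> I b -> cont_on a b Sf.
  have -> : Sf = (fun p => 1 - jtr P Q (Z p) + jdet P Q (Z p)) by apply/funext.
  apply: (cZ a b (fun z => 1 - jtr P Q z + jdet P Q z)) => z.
  apply: cvgD; last exact: (jdet_continuous CP CQ).
  by apply: cvgB; [exact: cvg_cst|exact: (jtr_continuous CP CQ)].
have cD' (a b : R) : I a -> I b -> cont_on a b Df.
  have -> : Df = (fun p => 1 + jtr P Q (Z p) + jdet P Q (Z p)) by apply/funext.
  apply: (cZ a b (fun z => 1 + jtr P Q z + jdet P Q z)) => z.
  apply: cvgD; last exact: (jdet_continuous CP CQ).
  by apply: cvgD; [exact: cvg_cst|exact: (jtr_continuous CP CQ)].
have Sp p : I p -> p - s <= Sf p <= p + s.
  by move=> /bnd[+ _ _]; rewrite ler_distl.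
have Dp p : I p -> 2 * (1 - c) - p - s <= Df p <= 2 * (1 - c) - p + s.
  by move=> /bnd[_ + _]; rewrite ler_distl.
(* 1 - tr + det is within s of p, so its last zero before r is the fold, and to the right of r it is
   positive anyway. In the same way the first zero of 1 + tr + det after r is the flip. *)
have [||||sn /andP[sn1 sn2] [sn0 snP]] := @last_zero _ (- (2 * s)) r Sf.
- by clear -s0 r0; lra.
- exact: cS.
- by have /andP[_] := Sp _ Ia; clear -s0; lra.
- by have /andP[+ _] := Sp _ Ir; clear -r0 sr; lra.
have [||||pd /andP[pd1 pd2] [pd0 pdP]] := @first_zero _ r (2 * (1 - c) + 2 * s) Df.
- by rewrite gE; clear -g0 s0; lra.
- exact: cD'.
- by have /andP[+ _] := Dp _ Ir; rewrite gE; clear -sg g0; lra.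
- by have /andP[_ +] := Dp _ Ib; clear -s0; lra.
have Isp p : sn <= p <= pd -> I p.
  case/andP: Ia Ib; rewrite /I; clear -sn1 pd2 => ? ? /andP[? ?] /andP[? ?].
  by apply/andP; split; lra.
have snpd : sn <= pd by clear -sn2 pd1; lra.
have Isn : I sn by apply: Isp; rewrite lexx.
have Ipd : I pd by apply: Isp; rewrite lexx andbT.
have Isp' p : sn < p < pd -> I p by move=> /andP[? ?]; apply: Isp; rewrite !ltW.
have Spos p : sn < p < pd -> 0 < Sf p.
  move=> /andP[p1 p2']; have [pr|pr] := leP p r; first by apply: snP; rewrite p1.
  have /Sp/andP[+ _] : I p by apply: Isp'; rewrite p1.
  by apply: lt_le_trans; clear -pr sr r0; lra.
have Dpos p : sn < p < pd -> 0 < Df p.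
  move=> /andP[p1 p2']; have [pr|pr] := leP r p; first by apply: pdP; rewrite pr.
  have /Dp/andP[+ _] : I p by apply: Isp'; rewrite p1.
  by apply: lt_le_trans; rewrite gE; clear -pr sg g0; lra.
have cE : cont_on sn pd E by exact: lipI Elip Isn Ipd.
(* Eliminating the increment of phi gives (bracket) * dE = (1 - tr + det) * dp, with the derivatives
   at intermediate points; the factor of dp stays positive for y near x by [jdet_sub_near]. *)
have mono (x y : R) : sn <= x -> x < y -> y <= pd -> E x < E y.
  apply: strict_mono_right => // {}x /andP[x1 x2].
  have Ix : I x by apply: Isp'; rewrite x1.
  have := Spos x; rewrite x1 x2 => /(_ isT).
  rewrite SfE => /(jdet_sub_near CP CQ)[d d0 dn].
  exists (d / (8 * A + 8)); first by apply: divr_gt0 => //; clear -A4; lra.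
  move=> {}y /andP[xy yd] ypd; have Iy : I y by apply: Isp; rewrite ypd (ltW (lt_trans x1 xy)).
  have [bx Px Qx] := ZP x Ix; have [by_ Py Qy] := ZP y Iy.
  have yx : (y - x) * (8 * A + 8) < d by rewrite -ltr_pdivlMr; clear -yd A4; lra.
  have near : `|Z y - Z x| < d.
    have yxn : `|y - x| = y - x by rewrite gtr0_norm// subr_gt0.
    have := flip x y Ix Iy; have := Elip x y Ix Iy.
    have yA : 0 <= (y - x) * A by clear -A4 xy; apply: mulr_ge0; lra.
    rewrite norm3_lt/= yxn => h1 h2; apply/and3P; split.
    - by apply: le_lt_trans h2 _; clear -xy yx yA; lra.
    - by clear -xy yx yA; lra.
    - by apply: le_lt_trans h1 _; clear -xy yx yA; lra.
  have [a a01] := mvt3 dP (Z x) (Z y); have [b b01] := mvt3 dQ (Z x) (Z y).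
  have := dn _ _ (dist_between a01 near) (dist_between b01 near).
  have [_ h1 _ h3] := boxP _ (inbox_between a01 bx by_).
  have [k1 _ k3] := boxQ _ (inbox_between b01 bx by_).
  move: h1 h3 k1 k3; cbv zeta; rewrite Px Py Qx Qy.
  move: (Z x + a *: _) (Z x + b *: _) => u w.
  move: (D1 P u) (D2 P u) (D3 P u) (D1 Q w) (D2 Q w) (D3 Q w) => u1 u2 u3 w1 w2 w3.
  rewrite [(Z y).1.1]/= [(Z x).1.1]/= [(Z y).1.2]/= [(Z x).1.2]/= [(Z y).2]/= [(Z x).2]/=.
  move=> h1 h3 k1 k3 S0 E2 E1.
  have br := bracket_gt0 t0 t4 tk h1 h3 k1 k3.
  rewrite -subr_gt0 -(pmulr_rgt0 _ br).
  have -> : (w1 * u3 + w3 * (1 - u1)) * (E y - E x) = ((1 - u1) * (1 - w2) - u2 * w1) * (y - x).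
    have E3 := f_equal2 (fun p q : R => p * w1 + q * (1 - u1)) E1 E2.
    by apply: (eq_of_sub (esym E3)); ring.
  by apply: mulr_gt0 => //; rewrite subr_gt0.
have [h [ch hP hE]] := mono_inverse snpd cE mono.
(* At the fold |p| <= 2 s, hence p^2 <= s, and E is within s of (p^2 - Delta) / 2. *)
have Esn : E sn < 0.
  have := Eval sn Isn; rewrite ler_norml => /andP[_].
  have : sn <= s by have /andP[+ _] := Sp _ Isn; rewrite sn0 subr_le0.
  move: sn1 (E sn) => sn1 e sns h1.
  have : sn ^+ 2 <= s.
    have h2 : 0 <= (sn + 2 * s) * (2 * s - sn) by clear -sn1 sns s0; apply: mulr_ge0; lra.
    have h3 : 0 <= s * (1 / 4 - s) by clear -s0 s4; apply: mulr_ge0; lra.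
    by rewrite expr2; clear -h2 h3; nra.
  by move: (sn ^+ 2) h1; clear -s0 s4 sD D0 => ? ?; lra.
(* At the flip p >= r + g - s, hence p^2 - Delta >= g r, which exceeds twice the tolerance. *)
have Epd : 0 < E pd.
  have := Eval pd Ipd; rewrite ler_norml => /andP[+ _].
  have : 2 * (1 - c) - s <= pd by have /andP[+ _] := Dp _ Ipd; rewrite pd0; clear; lra.
  rewrite gE; move: (E pd) => e pdg h1.
  have : g * r <= pd ^+ 2 - Delta by rewrite -rE !expr2; clear -pdg sg g0 r0; nra.
  by move: (pd ^+ 2) (g * r) h1 sgr; clear -s0 => ? ? ? ?; lra.
exists (E sn), (E pd), (fun e => f (h e)), h => z.
have zE (e : R) : E sn <= e <= E pd -> z e = Z (h e).
  by move=> /hP[_ he]; rewrite /z /Z he.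
have zI (e : R) : E sn <= e <= E pd -> I (h e) by move=> /hP[/Isp].
have snpdE : E sn <= E pd by rewrite ltW// (lt_trans Esn).
have sne : E sn <= E sn <= E pd by rewrite lexx.
have pde : E sn <= E pd <= E pd by rewrite lexx andbT.
have hsn : h (E sn) = sn by apply: hE; rewrite lexx.
have hpd : h (E pd) = pd by apply: hE; rewrite lexx andbT.
split.
- have [l1 _] := EP _ Isn; have [l2 _] := EP _ Ipd.
  by move: l1 l2; rewrite !ler_norml => /andP[? _] /andP[_ ?].
- split => //; apply: (cont_on_comp ch _ (lipI _ _ _ _ flip Isn Ipd)) => e /hP[]//.
- by move=> e eI; have [h1 h2 h3] := ZP _ (zI e eI); rewrite zE.
- move=> e /andP[e1 e2]; have eI : E sn <= e <= E pd by rewrite !ltW.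
  have [/andP[i1 i2] he] := hP e eI.
  have hI : sn < h e < pd.
    rewrite !lt_neqAle i1 i2 !andbT; apply/andP; split; apply/eqP => H.
      by move: e1; rewrite -he -H ltxx.
    by move: e2; rewrite -he H ltxx.
  rewrite zE//; split; [by rewrite -SfE; exact: Spos|by rewrite -DfE; exact: Dpos|].
  by have [] := bnd _ (zI _ eI).
- by rewrite !zE// hsn hpd -SfE -DfE.
Qed.

End FoldFlip.

(** * Linear stability in the plane *)

Section PlanarStability.
Variable R : realType.

(* The form [(1 + D) (|v|^2 + |A v|^2) - 2 tau <v, A v>], with tau and D the trace
   and determinant of A, decreases by [(1 - D) |A^2 v - v|^2] under v |-> A v
   (Cayley-Hamilton), and A^2 - 1 has determinant (1 - tau + D) (1 + tau + D). *)
Lemma jury_lyapunov (a b c d : R) :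
  0 < 1 - (a + d) + (a * d - b * c) -> 0 < 1 + (a + d) + (a * d - b * c) ->
  a * d - b * c < 1 ->
  exists (al be ga m0 M0 k0 : R), let W x y := al * x ^+ 2 + 2 * be * (x * y) + ga * y ^+ 2 in
  [/\ 0 < m0, 0 < M0, 0 < k0,
      forall x y, m0 * (x ^+ 2 + y ^+ 2) <= W x y <= M0 * (x ^+ 2 + y ^+ 2)
    & forall x y, W (x * a + y * c) (x * b + y * d) <= W x y - k0 * (x ^+ 2 + y ^+ 2)].
Proof.
set tau := a + d; set D := a * d - b * c => S0 D0 D1.
pose al := (1 + D) * (1 + a ^+ 2 + b ^+ 2) - 2 * tau * a.
pose be := (1 + D) * (a * c + b * d) - tau * (c + b).
pose ga := (1 + D) * (1 + c ^+ 2 + d ^+ 2) - 2 * tau * d.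
pose p := a ^+ 2 + b * c - 1; pose q := c * tau; pose r := b * tau.
pose s := d ^+ 2 + b * c - 1.
pose del := p * s - q * r.
have delE : del = (1 - tau + D) * (1 + tau + D) by rewrite /del/p/q/r/s/tau/D; ring.
have del0 : 0 < del by rewrite delE mulr_gt0.
pose S2 := p ^+ 2 + q ^+ 2 + r ^+ 2 + s ^+ 2.
have S20 : 0 < S2.
  have : 0 <= (p - s) ^+ 2 + (q + r) ^+ 2 by rewrite addr_ge0// sqr_ge0.
  have -> : (p - s) ^+ 2 + (q + r) ^+ 2 = S2 - 2 * del by rewrite /S2/del; ring.
  by clear -del0; lra.
pose m0 := 1 + D - `|tau|.
have m00 : 0 < m0.
  by rewrite /m0 subr_gt0 ltr_norml; clear -S0 D0; apply/andP; split; lra.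
(* With p, q, r, s the entries of A^2 - 1, [S2] is its squared Frobenius norm, and |(A^2 - 1) v|^2
   >= (det^2 / S2) |v|^2. *)
pose k0 := (1 - D) * (del ^+ 2 / S2).
have k00 : 0 < k0 by rewrite mulr_gt0 ?subr_gt0// divr_gt0// exprn_gt0.
have taum : `|tau| = 1 + D - m0 by rewrite /m0; ring.
exists al, be, ga, m0, (`|al| + 2 * `|be| + `|ga| + 1), k0 => W.
have WE x y : W x y = (1 + D) * (x ^+ 2 + y ^+ 2 + (x * a + y * c) ^+ 2 + (x * b + y * d) ^+ 2)
    - 2 * tau * (x * (x * a + y * c) + y * (x * b + y * d)).
  by rewrite /W/al/be/ga; ring.
split => //.
- move=> x y; apply/andP; split.
    (* Twice the form is (1 + D - tau) |v + A v|^2 + (1 + D + tau) |v - A v|^2; replacing 1 + D by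
       |tau| keeps both coefficients nonnegative. *)
    rewrite WE; set u := x * a + _; set v := x * b + _.
    have tt : - (1 + D - m0) <= tau <= 1 + D - m0 by rewrite -ler_norml taum.
    have h1 : 0 <= (1 + D - m0 - tau) * ((x + u) ^+ 2 + (y + v) ^+ 2).
      by apply: mulr_ge0; [case/andP: tt; clear; lra|rewrite addr_ge0// sqr_ge0].
    have h2 : 0 <= (1 + D - m0 + tau) * ((x - u) ^+ 2 + (y - v) ^+ 2).
      by apply: mulr_ge0; [case/andP: tt; clear; lra|rewrite addr_ge0// sqr_ge0].
    have h3 : 0 <= m0 * (u ^+ 2 + v ^+ 2) by apply: mulr_ge0; [exact: ltW|apply: addr_ge0; exact: sqr_ge0].
    by clear -h1 h2 h3; nra.
  have h1 : 0 <= (`|al| - al) * x ^+ 2 by rewrite mulr_ge0 ?sqr_ge0// subr_ge0 ler_norm.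
  have h2 : 0 <= (`|ga| - ga) * y ^+ 2 by rewrite mulr_ge0 ?sqr_ge0// subr_ge0 ler_norm.
  have h3 : 0 <= (`|be| - be) * (x + y) ^+ 2 by rewrite mulr_ge0 ?sqr_ge0// subr_ge0 ler_norm.
  have h4 : 0 <= (`|be| + be) * (x - y) ^+ 2.
    by rewrite mulr_ge0 ?sqr_ge0// -lerBlDr sub0r -normrN ler_norm.
  have h5 : 0 <= `|al| * y ^+ 2 by rewrite mulr_ge0 ?sqr_ge0.
  have h6 : 0 <= `|ga| * x ^+ 2 by rewrite mulr_ge0 ?sqr_ge0.
  have h7 : 0 <= `|be| * (x ^+ 2 + y ^+ 2) by rewrite mulr_ge0 ?addr_ge0 ?sqr_ge0.
  have h8 : 0 <= x ^+ 2 + y ^+ 2 by rewrite addr_ge0 ?sqr_ge0.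
  rewrite /W; move: (`|al|) (`|be|) (`|ga|) h1 h2 h3 h4 h5 h6 h7 h8.
  by move: (al) (be) (ga); clear; intros; nra.
- move=> x y.
  set u := p * x + q * y; set v := r * x + s * y.
  have -> : W (x * a + y * c) (x * b + y * d) = W x y - (1 - D) * (u ^+ 2 + v ^+ 2).
    by rewrite !WE /u/v/p/q/r/s/tau/D; ring.
  rewrite lerD2l lerN2 /k0 -mulrA ler_wpM2l//; first by rewrite subr_ge0 ltW.
  rewrite mulrAC ler_pdivrMr//.
  have -> : del ^+ 2 * (x ^+ 2 + y ^+ 2) = (s * u - q * v) ^+ 2 + (p * v - r * u) ^+ 2.
    by rewrite /del/u/v; ring.
  rewrite -subr_ge0.
  have -> : (u ^+ 2 + v ^+ 2) * S2 - ((s * u - q * v) ^+ 2 + (p * v - r * u) ^+ 2) =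
    (s * v + q * u) ^+ 2 + (p * u + r * v) ^+ 2 by rewrite /S2; ring.
  by rewrite addr_ge0 ?sqr_ge0.
Qed.

Lemma mx_coord_le (m n : nat) (v : 'M[R]_(m, n)) i j : `|v i j| <= `|v|.
Proof.
have -> : `|v| = mx_norm v by [].
by rewrite mx_normrE; apply/bigmax_geP; right; exists (i, j).
Qed.

Lemma rv2_norm_le (v : 'rV[R]_2) (r : R) : `|v 0 0| <= r -> `|v 0 1| <= r -> `|v| <= r.
Proof.
move=> v0 v1; have -> : `|v| = mx_norm v by [].
rewrite mx_normrE; apply/bigmax_leP; split.
  exact: le_trans v0.
move=> [i j] _ /=; rewrite ord1; case: j => -[|[|//]] jP.
  by have -> : Ordinal jP = 0 by apply/val_inj.
by have -> : Ordinal jP = 1 by apply/val_inj.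
Qed.

Lemma det_mx22 (A : 'M[R]_2) : \det A = A 0 0 * A 1 1 - A 0 1 * A 1 0.
Proof.
rewrite (expand_det_row _ 0) !big_ord_recl big_ord0 addr0 /cofactor !det_mx11 !mxE/=.
have -> : lift 0 0 = 1 :> 'I_2 by apply/val_inj.
have -> : lift 1 0 = 0 :> 'I_2 by apply/val_inj.
by rewrite expr0 mul1r expr1 mulN1r mulrN.
Qed.

Lemma tr_mx22 (A : 'M[R]_2) : \tr A = A 0 0 + A 1 1.
Proof.
rewrite /mxtrace !big_ord_recl big_ord0 addr0.
by have -> : lift 0 0 = 1 :> 'I_2 by apply/val_inj.
Qed.

Lemma mulmx_rv2 (v : 'rV[R]_2) (A : 'M[R]_2) j :
  (v *m A) 0 j = v 0 0 * A 0 j + v 0 1 * A 1 j.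
Proof.
rewrite mxE !big_ord_recl big_ord0 addr0.
by have -> : lift 0 0 = 1 :> 'I_2 by apply/val_inj.
Qed.

(** A sublevel set of W inside the ball of radius [del] is mapped into itself, and there W decays
    like q^j; the two-sided comparison with the squared norm turns this into stability and
    attraction. *)
Lemma lyapunov_stable (G : 'rV[R]_2 -> 'rV[R]_2) (z : 'rV[R]_2)
    (W : 'rV[R]_2 -> R) (m0 M0 q del : R) :
  G z = z -> 0 < m0 -> 0 < M0 -> 0 <= q < 1 -> 0 < del ->
  (forall v, m0 * `|v| ^+ 2 <= W v <= M0 * `|v| ^+ 2) ->
  (forall v, `|v| < del -> W (G (z + v) - z) <= q * W v) ->
  asymptotically_stable_fixed_point G z.
Proof.
move=> Gz m00 M00 /andP[q0 q1] del0 WP WG.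
have key r : 0 < r -> r <= del -> exists2 rho : R, 0 < rho & forall w j, `|w - z| < rho ->
    W (iter j G w - z) <= q ^+ j * W (w - z) /\ `|iter j G w - z| < r.
  move=> r0 rdel; pose t := Num.min 1 (m0 / (2 * M0)).
  have t0 : 0 < t by rewrite lt_min ltr01 divr_gt0// mulr_gt0.
  have t1 : t <= 1 by rewrite ge_min lexx.
  have tm : M0 * t <= m0 / 2.
    rewrite mulrC -ler_pdivlMr//; apply: (le_trans (_ : t <= m0 / (2 * M0))); first by rewrite ge_min lexx orbT.
    by rewrite invfM mulrA.
  exists (r * t); first exact: mulr_gt0.
  move=> w j wz.
  have Ww : W (w - z) < m0 * r ^+ 2.
    have /andP[_ h] := WP (w - z).
    apply: (le_lt_trans h).
    have h1 : `|w - z| ^+ 2 <= (r * t) ^+ 2 by rewrite lerXn2r ?nnegrE ?(ltW wz)// mulr_ge0// ltW.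
    have h2 : M0 * `|w - z| ^+ 2 <= M0 * (r * t) ^+ 2 by rewrite ler_wpM2l// ltW.
    apply: (le_lt_trans h2).
    have -> : M0 * (r * t) ^+ 2 = (M0 * t) * t * r ^+ 2 by ring.
    rewrite ltr_pM2r ?exprn_gt0//.
    have : M0 * t * t <= m0 / 2 * 1 by rewrite ler_pM// ?mulr_ge0// ltW.
    by clear -m00; lra.
  have Ww0 : 0 <= W (w - z).
    by have /andP[+ _] := WP (w - z); apply: le_trans; rewrite mulr_ge0 ?sqr_ge0// ltW.
  have small v : W v < m0 * r ^+ 2 -> `|v| < r.
    have /andP[h _] := WP v; move=> /(le_lt_trans h); rewrite ltr_pM2l// => h'.
    by rewrite -(ltr_pXn2r (ltn0Sn 1)) ?nnegrE// ltW.
  elim: j => [|j [IH1 IH2]] /=; first by rewrite expr0 mul1r; split => //; exact: small.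
  have step : W (G (iter j G w) - z) <= q ^+ j.+1 * W (w - z).
    have := WG (iter j G w - z) (lt_le_trans IH2 rdel); rewrite subrKC.
    by move=> h; apply: (le_trans h); rewrite exprS -mulrA ler_wpM2l.
  split => //; apply: small; apply: (le_lt_trans step); apply: le_lt_trans Ww.
  by rewrite ler_piMl// exprn_ile1// ltW.
split => //.
- move=> U /nbhs_normP[r/= r0 rU].
  have [rho rho0 rhoP] := key (Num.min r del) ltac:(by rewrite lt_min r0) ltac:(by rewrite ge_min lexx orbT).
  exists (ball z rho); first exact: nbhsx_ballx.
  move=> w; rewrite -ball_normE/= distrC => wz j; apply: rU => /=; rewrite distrC.
  by have [_] := rhoP w j wz; rewrite lt_min => /andP[].
- have [rho rho0 rhoP] := key del del0 (lexx _).
  exists (ball z rho); first exact: nbhsx_ballx.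
  move=> w; rewrite -ball_normE/= distrC => wz.
  apply/cvgrPdist_lt => e e0.
  have cq : q ^+ j * W (w - z) @[j --> \oo] --> (0 : R).
    rewrite -[X in _ --> X](mul0r (W (w - z))); apply: cvgMl.
    by apply: cvg_expr; rewrite ger0_norm.
  have e2 : 0 < m0 * e ^+ 2 by rewrite mulr_gt0// exprn_gt0.
  have /cvgrPdist_lt/(_ _ e2) := cq.
  apply: filterS => j; rewrite sub0r normrN => h.
  rewrite distrC; have [h1 _] := rhoP w j wz.
  have /andP[h2 _] := WP (iter j G w - z).
  have := le_lt_trans (le_trans h2 (le_trans h1 (ler_norm _))) h.
  by rewrite ltr_pM2l// ltr_pXn2r// ?nnegrE// ltW.
Qed.

Lemma differentiable_littleo (U W : normedModType R) (f : U -> W) (x : U) (e : R) :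
  differentiable f x -> 0 < e -> exists2 d : R, 0 < d &
    forall v, `|v| < d -> `|f (x + v) - f x - 'd f x v| <= e * `|v|.
Proof.
move=> df e0; have := diff_locally df; move/eqaddoP/(_ e e0)/nbhs_normP => [d/= d0 dP].
exists d => // v vd; have := dP v; rewrite /= sub0r normrN => /(_ vd).
by rewrite !fctE /= opprD addrA [v + x]addrC.
Qed.

(** The quadratic form of the linear part still decreases under G: a remainder of at most eta |v|
    changes the form by C eta |v|^2, and eta is chosen so that this costs at most half of the
    decrease. *)
Lemma jury_stable (G : 'rV[R]_2 -> 'rV[R]_2) (z : 'rV[R]_2) :
  differentiable G z -> G z = z ->
  0 < 1 - \tr ('J G z) + \det ('J G z) -> 0 < 1 + \tr ('J G z) + \det ('J G z) ->
  \det ('J G z) < 1 -> asymptotically_stable_fixed_point G z.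
Proof.
move=> dG Gz; rewrite det_mx22 tr_mx22.
have Jd v : 'd G z v = v *m 'J G z by rewrite -deriveEjacobian// deriveE.
set A := 'J G z in Jd *; set a := A 0 0; set b := A 0 1; set c := A 1 0; set d := A 1 1.
move=> S0 D0 D1; have [al [be [ga [m0 [M0 [k0]]]]]] := jury_lyapunov S0 D0 D1.
clear S0 D0 D1; move=> [m00 M00 k00 WP WA].
pose W x y := al * x ^+ 2 + 2 * be * (x * y) + ga * y ^+ 2.
pose K := `|a| + `|b| + `|c| + `|d|.
have K0 : 0 <= K by rewrite !addr_ge0.
pose C := (`|al| + 2 * `|be| + `|ga| + 1) * (2 * K + 2).
have C0 : 0 < C.
  by rewrite mulr_gt0// ltr_wpDl// ?addr_ge0 ?mulr_ge0.
(* Needed for the contraction factor 1 - k0 / (4 M0) to be nonnegative. *)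
have kM : k0 <= 2 * M0.
  have /andP[W0 _] := WP (1 * a + 0 * c) (1 * b + 0 * d).
  have : 0 <= W (1 * a + 0 * c) (1 * b + 0 * d).
    by apply: le_trans W0; apply: mulr_ge0; [exact: ltW|apply: addr_ge0; exact: sqr_ge0].
  move=> /le_trans/(_ (WA 1 0)); have /andP[_] := WP 1 0.
  by rewrite expr1n expr0n/= addr0 !mulr1 => h1 h2; clear -h1 h2 M00; lra.
have WC (u1 u2 e1 e2 n eta : R) : 0 <= eta <= 1 -> 0 <= n -> `|u1| <= K * n -> `|u2| <= K * n ->
    `|e1| <= eta * n -> `|e2| <= eta * n ->
    W (u1 + e1) (u2 + e2) <= W u1 u2 + C * eta * n ^+ 2.
  move=> /andP[eta0 eta1] n0 h1 h2 h3 h4; rewrite -lerBlDl.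
  have -> : W (u1 + e1) (u2 + e2) - W u1 u2 = al * (2 * (u1 * e1) + e1 * e1) +
    be * (2 * (u1 * e2 + u2 * e1 + e1 * e2)) + ga * (2 * (u2 * e2) + e2 * e2).
    by rewrite /W; ring.
  pose X := eta * n ^+ 2.
  have X0 : 0 <= X by rewrite mulr_ge0// sqr_ge0.
  have en (x : R) : `|x| <= eta * n -> `|x| <= n by move=> h; apply: (le_trans h); rewrite ler_piMl.
  have ue (u e : R) : `|u| <= K * n -> `|e| <= eta * n -> `|u * e| <= K * X.
    by move=> hu he; have := normM_le hu he; congr (_ <= _); rewrite /X; ring.
  have ee (e e' : R) : `|e| <= eta * n -> `|e'| <= eta * n -> `|e * e'| <= X.
    by move=> he he'; have := normM_le (en _ he) he'; congr (_ <= _); rewrite /X; ring.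
  have b1 : `|2 * (u1 * e1) + e1 * e1| <= (2 * K + 2) * X.
    have := ue _ _ h1 h3; have := ee _ _ h3 h3; rewrite !ler_norml.
    by clear -X0 => /andP[? ?] /andP[? ?]; apply/andP; split; lra.
  have b3 : `|2 * (u2 * e2) + e2 * e2| <= (2 * K + 2) * X.
    have := ue _ _ h2 h4; have := ee _ _ h4 h4; rewrite !ler_norml.
    by clear -X0 => /andP[? ?] /andP[? ?]; apply/andP; split; lra.
  have b2 : `|2 * (u1 * e2 + u2 * e1 + e1 * e2)| <= 2 * ((2 * K + 2) * X).
    have := ue _ _ h1 h4; have := ue _ _ h2 h3; have := ee _ _ h3 h4; rewrite !ler_norml.
    by clear -X0 => /andP[? ?] /andP[? ?] /andP[? ?]; apply/andP; split; lra.
  apply: (le_trans (ler_norm _)); apply: (le_trans (ler_normD _ _)).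
  have := normM_le (lexx `|ga|) b3; have := ler_normD (al * (2 * (u1 * e1) + e1 * e1))
    (be * (2 * (u1 * e2 + u2 * e1 + e1 * e2))).
  have := normM_le (lexx `|al|) b1; have := normM_le (lexx `|be|) b2.
  have Y0 : 0 <= (2 * K + 2) * X by rewrite mulr_ge0// addr_ge0// mulr_ge0.
  have -> : C * eta * n ^+ 2 = (`|al| + 2 * `|be| + `|ga| + 1) * ((2 * K + 2) * X).
    by rewrite /C/X; ring.
  move: Y0; clear; move: (`|_ + _|) => T1; move: (`|al * _|) (`|be * _|) (`|ga * _|) => T2 T3 T4.
  by move: ((2 * K + 2) * X) => Y *; lra.
pose eta := Num.min 1 (k0 / (2 * C)).
have eta0 : 0 < eta by rewrite lt_min ltr01 divr_gt0// mulr_gt0.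
have eta1 : eta <= 1 by rewrite ge_min lexx.
have etaC : C * eta <= k0 / 2.
  rewrite mulrC -ler_pdivlMr//; apply: (le_trans (_ : eta <= k0 / (2 * C))); first by rewrite ge_min lexx orbT.
  by rewrite invfM mulrA.
have [del del0 delP] := differentiable_littleo dG eta0.
have sq2 (v : 'rV[R]_2) : `|v| ^+ 2 <= v 0 0 ^+ 2 + v 0 1 ^+ 2 <= 2 * `|v| ^+ 2.
  have h0 := mx_coord_le v 0 0; have h1 := mx_coord_le v 0 1.
  rewrite -(real_normK (num_real (v 0 0))) -(real_normK (num_real (v 0 1))).
  apply/andP; split.
    have [l|l] := leP `|v 0 0| `|v 0 1|.
      have hv := rv2_norm_le l (lexx _).
      have : `|v| ^+ 2 <= `|v 0 1| ^+ 2 by rewrite lerXn2r ?nnegrE.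
      by move=> /le_trans; apply; rewrite lerDr sqr_ge0.
    have hv := rv2_norm_le (lexx _) (ltW l).
    have : `|v| ^+ 2 <= `|v 0 0| ^+ 2 by rewrite lerXn2r ?nnegrE.
    by move=> /le_trans; apply; rewrite lerDl sqr_ge0.
  have h0' : `|v 0 0| ^+ 2 <= `|v| ^+ 2 by rewrite lerXn2r ?nnegrE.
  have h1' : `|v 0 1| ^+ 2 <= `|v| ^+ 2 by rewrite lerXn2r ?nnegrE.
  by rewrite mulr2n mulrDl mul1r lerD.
(* The norm is the maximum norm, so x^2 + y^2 <= 2 |v|^2 and M0 is doubled. The factor uses a
   quarter of the decrease k0 (x^2 + y^2), where half was left. *)
apply: (@lyapunov_stable G z (fun v => W (v 0 0) (v 0 1)) m0 (2 * M0) (1 - k0 / (4 * M0)) del) => //.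
- by rewrite mulr_gt0.
- apply/andP; split; last by rewrite gtrBl divr_gt0// mulr_gt0.
  by rewrite subr_ge0 ler_pdivrMr ?mulr_gt0//; clear -kM M00; lra.
- move=> v; have /andP[w1 w2] := WP (v 0 0) (v 0 1); have /andP[s1 s2] := sq2 v.
  apply/andP; split.
    by apply: le_trans w1; rewrite ler_wpM2l// ltW.
  by apply: (le_trans w2); rewrite [2 * M0]mulrC -mulrA ler_wpM2l// ltW.
- move=> v vd; have := delP v vd; rewrite Gz Jd => h.
  set e : 'rV[R]_2 := G (z + v) - z - v *m A in h.
  have -> : G (z + v) - z = v *m A + e by rewrite /e subrKC.
  clearbody e; have h0 := mx_coord_le v 0 0; have h1 := mx_coord_le v 0 1.
  have u0 (x y : R) : `|x| + `|y| <= K -> `|v 0 0 * x + v 0 1 * y| <= K * `|v|.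
    move=> xy; apply: (le_trans (ler_normD _ _)).
    apply: (@le_trans _ _ (`|v| * `|x| + `|v| * `|y|)).
      by apply: lerD; apply: normM_le.
    by rewrite -mulrDr mulrC ler_wpM2r.
  have addE (x y : 'rV[R]_2) j : (x + y) 0 j = x 0 j + y 0 j by rewrite mxE.
  rewrite !addE !mulmx_rv2 -/a -/b -/c -/d.
  have eta01 : 0 <= eta <= 1 by rewrite ltW.
  have ac : `|a| + `|c| <= K by rewrite /K; have := normr_ge0 b; have := normr_ge0 d; lra.
  have bd : `|b| + `|d| <= K by rewrite /K; have := normr_ge0 a; have := normr_ge0 c; lra.
  have := WC _ _ _ _ _ _ eta01 (normr_ge0 v) (u0 _ _ ac) (u0 _ _ bd)
    (le_trans (mx_coord_le e 0 0) h) (le_trans (mx_coord_le e 0 1) h).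
  move=> /le_trans; apply.
  have := WA (v 0 0) (v 0 1); rewrite -!/(W _ _).
  have /andP[_] := WP (v 0 0) (v 0 1); rewrite -/(W _ _).
  have /andP[s1 _] := sq2 v.
  have v20 : 0 <= `|v| ^+ 2 by rewrite sqr_ge0.
  have e1 : C * eta * `|v| ^+ 2 <= k0 / 2 * `|v| ^+ 2 by rewrite ler_wpM2r.
  move: s1 v20 e1; move: (W (v 0 0 * a + v 0 1 * c) _) (W (v 0 0) (v 0 1)) (C * eta * _) => w2 w1 w3.
  move: (v 0 0 ^+ 2 + v 0 1 ^+ 2) (`|v| ^+ 2) => x2 n2 s1 v20 e1 WM WA'.
  have k1 : k0 * n2 <= k0 * x2 by rewrite ler_wpM2l// ltW.
  have k2 : (k0 / (4 * M0)) * w1 <= (k0 / (4 * M0)) * (M0 * x2).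
    by rewrite ler_wpM2l// divr_ge0 ?mulr_ge0// ltW.
  have k3 : (k0 / (4 * M0)) * (M0 * x2) = k0 * x2 / 4 by field; rewrite gt_eqF.
  rewrite k3 in k2; rewrite mulrBl mul1r.
  have k4 : 0 <= k0 * n2 by rewrite mulr_ge0// ltW.
  by move: k1 k2 k4 e1 WA'; clear; lra.
Qed.

Lemma eigenvalue22 (A : 'M[R]_2) (a : R) : a ^+ 2 - a * \tr A + \det A = 0 ->
  eigenvalue A a.
Proof.
rewrite det_mx22 tr_mx22 => E.
have /eqP/det0P[v v0 vA] : \det (A - a%:M) = 0.
  by rewrite det_mx22 !mxE/= !mulr1n !mulr0n; apply: etrans E; ring.
apply/eigenvalueP; exists v => //; apply/eqP; rewrite -subr_eq0.
by rewrite -mul_mx_scalar -mulmxBr vA.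
Qed.

(** With r = i p - i, the point F^r w is near z when w is near F^i z, and (F^p)^(j + i) w = F^i
    ((F^p)^j (F^r w)). Stability is thus carried from z by continuity alone, without inverting F. *)
Lemma asymptotically_stable_iter (F : 'rV[R]_2 -> 'rV[R]_2) (p i : nat) z :
  continuous F -> (0 < p)%N -> asymptotically_stable_fixed_point (iter p F) z ->
  asymptotically_stable_fixed_point (iter p F) (iter i F z).
Proof.
move=> cF p0 [Gz lyap [V0 V0z V0P]].
have ciF j : continuous (iter j F).
  elim: j => [|j IH] x /=; first exact: cvg_id.
  by apply: (@continuous_comp _ _ _ (iter j F) F); [exact: IH|exact: cF].
have iG j w : iter j (iter p F) w = iter (j * p) F w.
  by elim: j => [//|j IH]; rewrite iterS IH -iterD mulSn.
have Gj j : iter j (iter p F) z = z by elim: j => [//|j IH]; rewrite iterS IH.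
pose r := (i * p - i)%N.
have rE : (r + i = i * p)%N by rewrite /r subnK// leq_pmulr.
have Fr : iter r F (iter i F z) = z by rewrite -iterD rE -iG.
have Gi : iter p F (iter i F z) = iter i F z by rewrite -iterD addnC iterD Gz.
have Gij j : iter j (iter p F) (iter i F z) = iter i F z.
  by elim: j => [//|j IH]; rewrite iterS IH.
have shift j w : iter (j + i) (iter p F) w = iter i F (iter j (iter p F) (iter r F w)).
  by rewrite !iG -!iterD mulnDl -rE; congr (iter _ F w); lia.
have preim (q : nat) (A : set 'rV[R]_2) x : nbhs (iter q F x) A -> nbhs x (iter q F @^-1` A).
  by move=> ?; apply: ciF.
split => //.
- move=> U Uz.
  have [V Vz VP] := lyap _ (preim _ _ _ Uz).
  (* The identity [shift] misses the first i iterates; these are finitely many and are handled by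
     continuity. *)
  have near_small n : nbhs (iter i F z) [set w | forall j, (j < n)%N -> U (iter j (iter p F) w)].
    elim: n => [|n IH]; first by apply: (filterS _ filterT) => w _ j; rewrite ltn0.
    have cGn : nbhs (iter i F z) (iter (n * p) F @^-1` U).
      by apply: preim; rewrite -iG Gij.
    apply: filterS2 IH cGn => w h1 h2 j; rewrite ltnS leq_eqVlt => /orP[/eqP->|]; last exact: h1.
    by rewrite iG.
  exists ((iter r F @^-1` V) `&` [set w | forall j, (j < i)%N -> U (iter j (iter p F) w)]).
    by apply: filterI; [apply: preim; rewrite Fr|exact: near_small].
  move=> w [Vw sw] j; have [ji|ij] := ltnP j i; first exact: sw.
  by rewrite -(subnK ij) shift; apply: VP.
- exists (iter r F @^-1` V0); first by apply: preim; rewrite Fr.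
  move=> w Vw; rewrite -(cvg_shiftn i).
  under eq_fun do rewrite shift.
  by apply: (cvg_comp _ _ (V0P _ Vw)); apply: ciF.
Qed.

End PlanarStability.

(** * Iterates of skew maps *)

Section Smooth3.
Variable R : realType.
Local Notation V := (R * R * R)%type.

Lemma differentiable_fst (U W : normedModType R) (x : U * W) :
  differentiable (fst : U * W -> U) x.
Proof. by apply: (@linear_differentiable _ _ _ fst) => y; exact: cvg_fst. Qed.

Lemma differentiable_snd (U W : normedModType R) (x : U * W) :
  differentiable (snd : U * W -> W) x.
Proof. by apply: (@linear_differentiable _ _ _ snd) => y; exact: cvg_snd. Qed.

Lemma differentiable_c1 (z : V) : differentiable (fun z : V => z.1.1) z.
Proof.
by apply: (@differentiable_comp _ _ _ _ fst fst); exact: differentiable_fst.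
Qed.

Lemma differentiable_c2 (z : V) : differentiable (fun z : V => z.1.2) z.
Proof.
apply: (@differentiable_comp _ _ _ _ fst snd); [exact: differentiable_fst|exact: differentiable_snd].
Qed.

Lemma differentiable_c3 (z : V) : differentiable (fun z : V => z.2) z.
Proof. exact: differentiable_snd. Qed.

(** Second derivatives need not be continuous: what is used is that the first derivatives are
    continuous and have first-order expansions. *)
Definition C2 (g : V -> R) :=
  (forall z, differentiable g z) /\ forall u z, differentiable ('D_u g : V -> R) z.

Lemma C2_C1 (g : V -> R) : C2 g -> C1 g.
Proof.
move=> [dg ddg]; split => // u z; exact: differentiable_continuous (ddg u z).
Qed.

Lemma C2_smooth (g : V -> R) : smooth_on setT g -> C2 g.
Proof.
by move=> sg; split=> [z|u z]; [exact: (sg [::] z I)|exact: (sg [:: u] z I)].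
Qed.

Lemma derive_pair (U W1 W2 : normedModType R) (g : U -> W1) (h : U -> W2) (z u : U) :
  differentiable g z -> differentiable h z ->
  'D_u (fun z => (g z, h z)) z = ('D_u g z, 'D_u h z).
Proof.
move=> dg dh; rewrite !deriveE//; last exact: differentiable_pair.
by rewrite diff_pair.
Qed.

Lemma derive_c3 (z u : V) : 'D_u (fun z : V => z.2) z = u.2.
Proof.
rewrite deriveE; last exact: differentiable_c3.
by rewrite (@diff_lin _ _ _ snd)// => y; exact: cvg_snd.
Qed.

Section Chain.
Variables (h g1 g2 : V -> R).
Hypotheses (dh : forall z, differentiable h z)
  (d1 : forall z, differentiable g1 z) (d2 : forall z, differentiable g2 z).
Let G (z : V) : V := (g1 z, g2 z, z.2).

Lemma differentiable_G z : differentiable G z.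
Proof.
apply: differentiable_pair; last exact: differentiable_c3.
exact: differentiable_pair.
Qed.

Lemma differentiable_chain3 z : differentiable (fun z => h (g1 z, g2 z, z.2)) z.
Proof. by apply: (@differentiable_comp _ _ _ _ G h) => //; exact: differentiable_G. Qed.

Lemma derive_chain3 z u : 'D_u (fun z => h (g1 z, g2 z, z.2)) z =
  'D_u g1 z * D1 h (G z) + 'D_u g2 z * D2 h (G z) + u.2 * D3 h (G z).
Proof.
have -> : 'D_u (fun z => h (g1 z, g2 z, z.2)) z = 'D_('D_u G z) h (G z).
  rewrite deriveE; last exact: differentiable_chain3.
  rewrite (@diff_comp _ _ _ _ G h)//; last exact: differentiable_G.
  by rewrite /= deriveE// deriveE//; exact: differentiable_G.
rewrite deriveV3E//.
have -> : 'D_u G z = ('D_u g1 z, 'D_u g2 z, u.2).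
  rewrite derive_pair; [|exact: differentiable_pair|exact: differentiable_c3].
  by rewrite derive_pair// derive_c3.
by [].
Qed.

End Chain.

Lemma C2_chain (h g1 g2 : V -> R) : C2 h -> C2 g1 -> C2 g2 ->
  C2 (fun z => h (g1 z, g2 z, z.2)).
Proof.
move=> [dh ddh] [d1 dd1] [d2 dd2]; split => [z|u z]; first exact: differentiable_chain3.
have -> : 'D_u (fun z => h (g1 z, g2 z, z.2)) = fun z =>
  'D_u g1 z * D1 h (g1 z, g2 z, z.2) + 'D_u g2 z * D2 h (g1 z, g2 z, z.2)
  + u.2 * D3 h (g1 z, g2 z, z.2).
  by apply/funext => w; rewrite derive_chain3.
rewrite D1.unlock D2.unlock D3.unlock.
have dc w : differentiable (fun z => 'D_w h (g1 z, g2 z, z.2)) z.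
  exact: (differentiable_chain3 (ddh w) d1 d2).
apply: differentiableD; last exact: (differentiableM (differentiable_cst u.2 z) (dc _)).
by apply: differentiableD; [exact: (differentiableM (dd1 u z) (dc _))|
  exact: (differentiableM (dd2 u z) (dc _))].
Qed.

Lemma C2_c1 : C2 (fun z => z.1.1).
Proof.
split=> [z|u z]; first exact: differentiable_c1.
suff -> : 'D_u (fun z : V => z.1.1) = cst u.1.1 by exact: differentiable_cst.
apply/funext => y /=; rewrite deriveE; last exact: differentiable_c1.
have cl : continuous (fun z : V => z.1.1).
  by move=> w; exact: differentiable_continuous (differentiable_c1 w).
by rewrite (@diff_lin _ _ _ (fst \o fst : {linear V -> R})).
Qed.

Lemma C2_c2 : C2 (fun z => z.1.2).
Proof.
split=> [z|u z]; first exact: differentiable_c2.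
suff -> : 'D_u (fun z : V => z.1.2) = cst u.1.2 by exact: differentiable_cst.
apply/funext => y /=; rewrite deriveE; last exact: differentiable_c2.
have cl : continuous (fun z : V => z.1.2).
  by move=> w; exact: differentiable_continuous (differentiable_c2 w).
by rewrite (@diff_lin _ _ _ (snd \o fst : {linear V -> R})).
Qed.

(* [V] is seen as a plane together with a parameter that the dynamics fixes. *)
Definition skew (F1 F2 : V -> R) (z : V) : V := (F1 z, F2 z, z.2).

Lemma iter_skew2 (F1 F2 : V -> R) n z : (iter n (skew F1 F2) z).2 = z.2.
Proof. by elim: n => //= n ->. Qed.

Lemma C2_iter (F1 F2 : V -> R) : C2 F1 -> C2 F2 -> forall n,
  C2 (fun z => (iter n (skew F1 F2) z).1.1) /\ C2 (fun z => (iter n (skew F1 F2) z).1.2).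
Proof.
move=> CF1 CF2; elim=> [|n [IH1 IH2]]; first by split; [exact: C2_c1|exact: C2_c2].
have E z : iter n (skew F1 F2) z =
    ((iter n (skew F1 F2) z).1.1, (iter n (skew F1 F2) z).1.2, z.2).
  by rewrite -[z.2](iter_skew2 F1 F2 n z); case: (iter _ _ _) => -[].
split.
  have -> : (fun z => (iter n.+1 (skew F1 F2) z).1.1) = fun z =>
    F1 ((iter n (skew F1 F2) z).1.1, (iter n (skew F1 F2) z).1.2, z.2).
    by apply/funext => z; rewrite iterS/= -E.
  exact: C2_chain.
have -> : (fun z => (iter n.+1 (skew F1 F2) z).1.2) = fun z =>
  F2 ((iter n (skew F1 F2) z).1.1, (iter n (skew F1 F2) z).1.2, z.2).
  by apply/funext => z; rewrite iterS/= -E.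
exact: C2_chain.
Qed.

End Smooth3.

(** * Expansions that may be differentiated *)

Section Hadamard.
Variables (R : realType) (U : normedModType R).
Implicit Types (g w : U -> R) (a b c p u : U).

(** As g is already known to be differentiable, a one-sided expansion identifies its derivative.
    This matters because the normal form will be used on a quadrant-like region with the relevant
    points on its boundary. *)
Lemma derive_onesided g p u (d L C : R) : differentiable g p -> d != 0 ->
  (forall t, 0 <= t <= 1 -> `|g (p + (t * d) *: u) - g p - t * d * L| <= C * t ^+ 2) ->
  'D_u g p = L.
Proof.
move=> dg d0 gC; apply/eqP; rewrite -subr_eq0; apply: contraT => D0.
pose D := 'D_u g p - L; have Dd : 0 < `|D * d| by rewrite normr_gt0 mulf_neq0.
pose e := `|D * d| / (3 * (`|d *: u| + 1)).
have du0 : 0 < `|d *: u| + 1 by rewrite ltr_wpDl.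
have e0 : 0 < e by rewrite divr_gt0// mulr_gt0.
have [r r0 rP] := differentiable_littleo dg e0.
pose t := Num.min (Num.min 1 (r / (2 * (`|d *: u| + 1)))) (`|D * d| / (3 * (`|C| + 1))).
have C1 : 0 < `|C| + 1 by rewrite ltr_wpDl.
have t0 : 0 < t by rewrite !lt_min ltr01 !divr_gt0// mulr_gt0.
have t1 : t <= 1 by rewrite !ge_min lexx.
have tr : t * (`|d *: u| + 1) < r.
  apply: (@le_lt_trans _ _ (r / 2)); last by clear -r0; lra.
  rewrite -ler_pdivlMr//; apply: (le_trans (_ : t <= r / (2 * (`|d *: u| + 1)))).
    by rewrite !ge_min lexx orbT.
  by rewrite invfM mulrA.
have tC : t * (`|C| + 1) <= `|D * d| / 3.
  rewrite -ler_pdivlMr//; apply: (le_trans (_ : t <= `|D * d| / (3 * (`|C| + 1)))).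
    by rewrite !ge_min lexx !orbT.
  by rewrite invfM mulrA.
have nt : `|(t * d) *: u| = t * `|d *: u| by rewrite -scalerA normrZ ger0_norm// ltW.
have := rP ((t * d) *: u); rewrite nt => /(_ _)/wrap[].
  by apply: le_lt_trans tr; rewrite ler_wpM2l ?lerDl// ltW.
rewrite linearZ/= -deriveE// /GRing.scale/= => h.
have := gC t; rewrite t1 (ltW t0) => /(_ isT) h'.
have : `|t * (D * d)| <= e * (t * `|d *: u|) + C * t ^+ 2.
  have -> : t * (D * d) = (g (p + (t * d) *: u) - g p - t * d * L) -
    (g (p + (t * d) *: u) - g p - t * d * 'D_u g p) by rewrite /D; ring.
  by apply: (le_trans (ler_normB _ _)); rewrite addrC; apply: lerD.
have h1 : e * (t * `|d *: u|) <= t * (`|D * d| / 3).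
  have -> : e * (t * `|d *: u|) = t * (e * `|d *: u|) by ring.
  rewrite ler_wpM2l ?(ltW t0)//.
  apply: (@le_trans _ _ (e * (`|d *: u| + 1))); first by rewrite ler_wpM2l ?lerDl// ltW.
  by rewrite /e invfM mulrA divfK// gt_eqF.
have h2 : C * t ^+ 2 <= t * (`|D * d| / 3).
  rewrite expr2 mulrCA ler_wpM2l ?(ltW t0)//; apply: le_trans tC.
  rewrite mulrC ler_wpM2l ?(ltW t0)//; apply: (le_trans (ler_norm _)); by rewrite lerDl.
rewrite normrM gtr0_norm// => h3.
have h4 : 0 < t * `|D * d| by rewrite mulr_gt0.
by move: h1 h2 h3 h4; clear; move: (`|D * d|) => X; lra.
Qed.

Lemma mvt_line_eq g p u (s : R) : (forall z, differentiable g z) ->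
  exists2 th, 0 <= th <= 1 & g (p + s *: u) - g p = s * 'D_u g (p + (th * s) *: u).
Proof.
move=> dg.
have dh (t : R) : is_derive t 1 (fun t => g (p + t *: (s *: u)))
    ('D_(s *: u) g (p + t *: (s *: u))).
  by apply: is_derive_line; apply: diff_derivable.
have [|t t01] := @MVT_segment R _ _ 0 1 ler01 (fun x _ => dh x).
  apply: continuous_subspaceT => x; apply: differentiable_continuous.
  by apply/derivable1_diffP; case: (dh x).
rewrite scale1r scale0r addr0 subr0 mulr1 => ->.
exists t; first by move: t01; rewrite in_itv.
by rewrite deriveE// linearZ/= -deriveE// scalerA.
Qed.

Lemma mvt_line g p u (s B : R) : (forall z, differentiable g z) ->
  (forall th, 0 <= th <= 1 -> `|'D_u g (p + (th * s) *: u)| <= B) ->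
  `|g (p + s *: u) - g p| <= `|s| * B.
Proof.
move=> dg gB; have [th th01 ->] := mvt_line_eq p u s dg.
by rewrite normrM ler_wpM2l// gB.
Qed.

Lemma derive_eqfun g1 (g2 : R) p u (d : R) : differentiable g1 p -> d != 0 ->
  (forall t, 0 <= t <= 1 -> g1 (p + (t * d) *: u) = g2) -> 'D_u g1 p = 0.
Proof.
move=> dg d0 gE; apply: (@derive_onesided _ _ _ d 0 0) => // t t01.
have := gE 0; rewrite lexx ler01 mul0r scale0r addr0 => ->//.
by rewrite gE// subrr mulr0 subr0 normr0 mul0r.
Qed.

Lemma smooth_iter_derive w s : smooth_on setT w -> smooth_on setT (iter_derive s w).
Proof.
move=> sw t p _; have -> : iter_derive t (iter_derive s w) = iter_derive (t ++ s) w.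
  by elim: t => //= u t ->.
exact: sw.
Qed.

Lemma smooth_derive w u : smooth_on setT w -> smooth_on setT ('D_u w).
Proof. by move=> sw; exact: (@smooth_iter_derive w [:: u] sw). Qed.

(* Both mixed derivatives are the limit of the same second difference. *)
Lemma derive_swap w a b p : smooth_on setT w -> 'D_a ('D_b w) p = 'D_b ('D_a w) p.
Proof.
move=> sw.
have half (u v : U) (e : R) : 0 < e -> exists2 r : R, 0 < r & forall s : R, 0 < s < r ->
    `|w (p + s *: u + s *: v) - w (p + s *: u) - w (p + s *: v) + w p - s * s * 'D_u ('D_v w) p|
      <= s * s * e.
  move=> e0.
  have d1 : forall z, differentiable ('D_v w) z by move=> z; exact: (sw [:: v] z I).
  pose nu := `|u| + `|v| + 1; have nu0 : 0 < nu by rewrite ltr_wpDl// addr_ge0.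
  have e'0 : 0 < e / (2 * nu) by rewrite divr_gt0// mulr_gt0.
  have [r r0 rP] := differentiable_littleo (d1 p) e'0.
  exists (r / nu); first by rewrite divr_gt0.
  move=> s /andP[s0 sr]; rewrite ltr_pdivlMr// in sr.
  (* The mean value theorem is applied to this difference in the direction v; afterwards D_v w is
     expanded at p, which requires only that it be differentiable there. *)
  pose h z := w (z + s *: u) - w z.
  have dw z : differentiable w z := sw [::] z I.
  have dsh z : differentiable (fun z : U => z + s *: u) z.
    by apply: differentiableD => //; exact: differentiable_cst.
  have dwu z : differentiable (fun z => w (z + s *: u)) z.
    by apply: (@differentiable_comp _ _ _ _ (fun z => z + s *: u) w).
  have dh z : differentiable h z by exact: differentiableB.
  have Dh z : 'D_v h z = 'D_v w (z + s *: u) - 'D_v w z.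
    rewrite [LHS](@deriveB _ _ _ (fun z => w (z + s *: u)) w); [|exact: diff_derivable..].
    suff fe : (fun k : R => k^-1 *: (((fun z => w (z + s *: u)) \o shift z) (k *: v) - w (z + s *: u)))
        = (fun k : R => k^-1 *: ((w \o shift (z + s *: u)) (k *: v) - w (z + s *: u))).
      by congr (_ - _); rewrite /derive fe.
    by apply/funext => k /=; rewrite addrA.
  pose L := 'D_u ('D_v w) p.
  have bnd th : 0 <= th <= 1 -> `|'D_v h (p + (th * s) *: v) - s * L| <= s * e.
    move=> /andP[th0 th1]; rewrite Dh.
    have n1 : `|(th * s) *: v + s *: u| <= s * nu.
      apply: (le_trans (ler_normD _ _)); rewrite !normrZ !ger0_norm ?mulr_ge0// ?ltW//.
      have : th * s * `|v| <= s * `|v| by rewrite ler_wpM2r// ler_piMl// ltW.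
      by rewrite /nu; clear -s0; lra.
    have n2 : `|(th * s) *: v| <= s * nu.
      rewrite !normrZ !ger0_norm ?mulr_ge0// ?ltW//.
      have : th * s * `|v| <= s * `|v| by rewrite ler_wpM2r// ler_piMl// ltW.
      have : 0 <= s * `|u| by rewrite mulr_ge0// ltW.
      by rewrite /nu; clear -s0; lra.
    have := rP _ (le_lt_trans n1 sr); rewrite linearD/= [_ + s *: u]addrC addrA.
    rewrite [p + s *: u + _]addrAC => h1.
    have h2 := rP _ (le_lt_trans n2 sr).
    have dsu : 'd ('D_v w) p (s *: u) = s * L by rewrite linearZ/= /L deriveE.
    rewrite dsu in h1.
    set X := 'd _ p _ in h1 h2.
    have -> : 'D_v w (p + (th * s) *: v + s *: u) - 'D_v w (p + (th * s) *: v) - s * L =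
      ('D_v w (p + (th * s) *: v + s *: u) - 'D_v w p - (X + s * L)) -
      ('D_v w (p + (th * s) *: v) - 'D_v w p - X) by ring.
    apply: (le_trans (ler_normB _ _)).
    have -> : s * e = (e / (2 * nu)) * (s * nu) + (e / (2 * nu)) * (s * nu).
      by field; rewrite gt_eqF.
    apply: lerD; [apply: (le_trans h1)|apply: (le_trans h2)]; rewrite ler_wpM2l ?(ltW e'0)//.
    by rewrite addrC.
  have [th th01 hE] := mvt_line_eq p v s dh.
  have -> : w (p + s *: u + s *: v) - w (p + s *: u) - w (p + s *: v) + w p - s * s * L =
      s * ('D_v h (p + (th * s) *: v) - s * L).
    rewrite mulrBr -hE /h [p + s *: v + _]addrAC mulrA; ring.
  by rewrite normrM gtr0_norm// -mulrA ler_wpM2l ?(ltW s0)// bnd.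
apply/eqP; rewrite -subr_eq0 -normr_le0; apply/ler_addgt0Pl => e e0; rewrite addr0.
have e20 : 0 < e / 2 by rewrite divr_gt0.
have [r1 r10 r1P] := half a b _ e20; have [r2 r20 r2P] := half b a _ e20.
pose s := Num.min r1 r2 / 2.
have m0 : 0 < Num.min r1 r2 by rewrite lt_min r10.
have s0 : 0 < s by rewrite divr_gt0.
have sm : s < Num.min r1 r2 by rewrite /s; clear -m0; lra.
move: (sm); rewrite lt_min => /andP[s1 s2].
have := r1P s; have := r2P s; rewrite s0 s1 s2 => /(_ isT) h2 /(_ isT) h1.
have h3 : s * s * `|'D_a ('D_b w) p - 'D_b ('D_a w) p| <= s * s * e.
  rewrite -[X in X * `|_| <= _]gtr0_norm ?mulr_gt0// -normrM.
  have -> : s * s * ('D_a ('D_b w) p - 'D_b ('D_a w) p) =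
    (w (p + s *: b + s *: a) - w (p + s *: b) - w (p + s *: a) + w p - s * s * 'D_b ('D_a w) p)
    - (w (p + s *: a + s *: b) - w (p + s *: a) - w (p + s *: b) + w p - s * s * 'D_a ('D_b w) p).
    rewrite [p + s *: b + _]addrAC; move: ('D_a ('D_b w) p) ('D_b ('D_a w) p).
    by move: (w (p + s *: a + s *: b)) (w (p + s *: a)) (w (p + s *: b)) (w p) => *; ring.
  apply: (le_trans (ler_normB _ _)).
  have -> : s * s * e = s * s * (e / 2) + s * s * (e / 2) by field.
  exact: (lerD h2 h1).
by rewrite ler_pM2l ?mulr_gt0 in h3.
Qed.

Lemma derive_line_eq g1 g2 p q c (k E e : R) :
  (forall z, differentiable g1 z) -> (forall z, differentiable g2 z) -> `|e| < E ->
  (forall e', `|e'| < E -> g1 (p + e' *: c) = k * g2 (q + e' *: c)) ->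
  'D_c g1 (p + e *: c) = k * 'D_c g2 (q + e *: c).
Proof.
move=> dg1 dg2 eE gE.
have h1 : is_derive e 1 (fun s : R => g1 (p + s *: c)) ('D_c g1 (p + e *: c)).
  by apply: is_derive_line; apply: diff_derivable.
have h2 : is_derive e 1 (fun s : R => k * g2 (q + s *: c)) (k * 'D_c g2 (q + e *: c)).
  by apply: is_deriveZ; apply: is_derive_line; apply: diff_derivable.
rewrite -(@derive_val _ _ _ _ _ _ _ h1) -(@derive_val _ _ _ _ _ _ _ h2).
apply: near_eq_derive.
have e0 : 0 < E - `|e| by rewrite subr_gt0.
apply/nbhs_normP; exists (E - `|e|) => //= x /=; rewrite distrC ltrBrDl => xe.
by apply: gE; apply: le_lt_trans xe; rewrite -{1}(subrKC e x) ler_normD.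
Qed.

(* [w = l s + O (s^2 t)] forces [D_a w], [D_b w] and [D_c w] to behave as if this
   expansion could be differentiated. *)
Lemma saddle_remainder w a b c (X Y e C B E : R) (l : R -> R) :
  let P s t e := s *: a + t *: b + e *: c in
  smooth_on setT w -> X != 0 -> Y != 0 -> `|e| < E ->
  (forall e' s t, `|e'| < E -> 0 <= s <= 1 -> 0 <= t <= 1 ->
    `|w (P (s * X) (t * Y) e') - l e' * (s * X)| <= C * ((s * X) ^+ 2 * `|t * Y|)) ->
  (forall s t, 0 <= s <= 1 -> 0 <= t <= 1 ->
    [/\ `|'D_a ('D_b ('D_a w)) (P (s * X) (t * Y) e)| <= B,
        `|'D_a ('D_a ('D_b w)) (P (s * X) (t * Y) e)| <= B
      & `|'D_a ('D_a ('D_b ('D_c w))) (P (s * X) (t * Y) e)| <= B]) ->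
  [/\ l e = 'D_a w (P 0 0 e),
      `|'D_a w (P X Y e) - 'D_a w (P 0 0 e)| <= `|Y| * (`|X| * B),
      `|'D_b w (P X Y e)| <= `|X| * (`|X| * B)
    & `|'D_c w (P X Y e) - X * 'D_c ('D_a w) (P 0 0 e)| <= `|Y| * (`|X| * (`|X| * B))].
Proof.
move=> P sw X0 Y0 eE H HB.
have dw z : differentiable w z := sw [::] z I.
have d1 u z : differentiable ('D_u w) z := sw [:: u] z I.
have d2 u v z : differentiable ('D_u ('D_v w)) z := sw [:: u; v] z I.
have d3 u v x z : differentiable ('D_u ('D_v ('D_x w))) z := sw [:: u; v; x] z I.
have Pa s t e' k : P s t e' + k *: a = P (s + k) t e'.
  by rewrite /P scalerDl -!addrA; congr (_ + _); rewrite addrA addrC.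
have Pb s t e' k : P s t e' + k *: b = P s (t + k) e'.
  by rewrite /P scalerDl -!addrA; congr (_ + (_ + _)); rewrite addrC.
have Pc s t e' : P s t e' = P s t 0 + e' *: c by rewrite /P scale0r addr0.
have i0 : 0 <= (0 : R) <= 1 by rewrite lexx ler01.
have i1 : 0 <= (1 : R) <= 1 by rewrite lexx ler01.
have w0 e' t : `|e'| < E -> 0 <= t <= 1 -> w (P 0 (t * Y) e') = 0.
  move=> e'E t01; have := H e' 0 t e'E i0 t01.
  by rewrite mul0r mulr0 subr0 expr0n/= mul0r mulr0 normr_le0 => /eqP.
have wx e' s : `|e'| < E -> 0 <= s <= 1 -> w (P (s * X) 0 e') = l e' * (s * X).
  move=> e'E s01; have := H e' s 0 e'E s01 i0.
  by rewrite mul0r normr0 mulr0 mulr0 normr_le0 subr_eq0 => /eqP.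
(* From any point of the side a whole segment stays in the rectangle: backwards to 0, or forwards to
   Z when the point is 0 itself. *)
have side (t : R) (Z : R) : Z != 0 -> 0 <= t <= 1 -> exists2 d : R, d != 0 &
    forall k, 0 <= k <= 1 -> exists2 r, 0 <= r <= 1 & t * Z + k * d = r * Z.
  move=> Z0 /andP[t0 t1]; have [->|tn0] := eqVneq t 0.
    by exists Z => // k k01; exists k => //; rewrite mul0r add0r.
  exists (- (t * Z)); first by rewrite oppr_eq0 mulf_neq0.
  move=> k /andP[k0 k1]; exists (t * (1 - k)); last by ring.
  rewrite mulr_ge0 ?subr_ge0//=; apply: mulr_ile1 => //; rewrite ?subr_ge0//.
  by rewrite lerBlDr lerDl.
have la e' t : `|e'| < E -> 0 <= t <= 1 -> 'D_a w (P 0 (t * Y) e') = l e'.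
  move=> e'E t01; apply: (@derive_onesided _ _ _ X (l e') (C * (X ^+ 2 * `|t * Y|))) => // s s01.
  rewrite Pa add0r w0// subr0 [s * X * _]mulrC.
  have -> : C * (X ^+ 2 * `|t * Y|) * s ^+ 2 = C * ((s * X) ^+ 2 * `|t * Y|) by ring.
  exact: H.
have la0 e' : `|e'| < E -> 'D_a w (P 0 0 e') = l e'.
  by move=> e'E; rewrite -(la e' 0)// mul0r.
have lax s : 0 <= s <= 1 -> 'D_a w (P (s * X) 0 e) = l e.
  move=> s01; have [d d0 dP] := side s X X0 s01.
  apply: (@derive_onesided _ _ _ d (l e) 0) => // k k01.
  rewrite Pa; have [r r01 rE] := dP k k01; rewrite rE !wx//.
  rewrite -mulrBr -rE addrAC subrr add0r mulrC subrr normr0 mul0r//.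
have along g k s : (forall z, differentiable g z) ->
    (forall t, 0 <= t <= 1 -> g (P s (t * Y) e) = k) ->
    forall t, 0 <= t <= 1 -> 'D_b g (P s (t * Y) e) = 0.
  move=> dg gk t t01; have [d d0 dP] := side t Y Y0 t01.
  apply: (@derive_eqfun _ k _ _ d) => // r r01.
  by rewrite Pb; have [q q01 ->] := dP r r01; apply: gk.
(* On the axis s = 0 the derivative D_a w equals l e, which does not depend on t. *)
have ba t : 0 <= t <= 1 -> 'D_b ('D_a w) (P 0 (t * Y) e) = 0.
  by apply: (along _ (l e)) => // {}t t01; apply: la.
have b0 t : 0 <= t <= 1 -> 'D_b w (P 0 (t * Y) e) = 0.
  by apply: (along _ 0) => // {}t t01; apply: w0.
have ab t : 0 <= t <= 1 -> 'D_a ('D_b w) (P 0 (t * Y) e) = 0.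
  by move=> t01; rewrite derive_swap// ba.
have c0 t : 0 <= t <= 1 -> 'D_c w (P 0 (t * Y) e) = 0.
  move=> t01; rewrite Pc.
  rewrite (@derive_line_eq w (cst 0) _ (P 0 (t * Y) 0) c 0 E)//; first by rewrite mul0r.
  by move=> e' e'E; rewrite -Pc mul0r w0.
have bc t : 0 <= t <= 1 -> 'D_b ('D_c w) (P 0 (t * Y) e) = 0.
  exact: (along _ 0).
have ca t : 0 <= t <= 1 -> 'D_c ('D_a w) (P 0 (t * Y) e) = 'D_c ('D_a w) (P 0 0 e).
  move=> t01; rewrite Pc [in RHS]Pc -[RHS]mul1r.
  by apply: (@derive_line_eq _ _ _ _ _ _ E) => // e' e'E; rewrite -!Pc mul1r la// la0.
have abc t : 0 <= t <= 1 -> 'D_a ('D_b ('D_c w)) (P 0 (t * Y) e) = 0.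
  move=> t01; rewrite derive_swap; last exact: smooth_derive.
  have -> : 'D_a ('D_c w) = 'D_c ('D_a w) by apply/funext => z; exact: derive_swap.
  by apply: (along _ ('D_c ('D_a w) (P 0 0 e))).
have cx : 'D_c w (P X 0 e) = X * 'D_c ('D_a w) (P 0 0 e).
  rewrite Pc [P 0 0 e]Pc; apply: (@derive_line_eq _ _ _ _ _ _ E) => // e' e'E.
  by rewrite -!Pc la0// -[X in P X](mul1r X) wx// mul1r mulrC.
(* A function that vanishes on the axis s = 0 gains a factor |X| from a bound on its derivative in
   the direction a; each factor X or Y in the conclusions comes from one such integration. *)
have stepX g s t : (forall z, differentiable g z) -> 0 <= t <= 1 -> 0 <= s <= 1 ->
    g (P 0 (t * Y) e) = 0 -> forall B', 0 <= B' ->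
    (forall s, 0 <= s <= 1 -> `|'D_a g (P (s * X) (t * Y) e)| <= B') ->
    `|g (P (s * X) (t * Y) e)| <= `|X| * B'.
  move=> dg t01 /andP[s0 s1] g0 B' B'0 gB.
  have := @mvt_line g (P 0 (t * Y) e) a (s * X) B' dg.
  rewrite Pa add0r g0 subr0 => h; apply: le_trans (h _) _.
    move=> th /andP[th0 th1]; rewrite Pa add0r mulrA; apply: gB.
    by rewrite mulr_ge0//= mulr_ile1.
  by rewrite ler_wpM2r// normrM ger0_norm// ler_piMl.
have B0 : 0 <= B by have [h _ _] := HB 0 0 i0 i0; exact: le_trans h.
have XB : 0 <= `|X| * B by rewrite mulr_ge0.
split; first by rewrite la0.
- have := @mvt_line ('D_a w) (P X 0 e) b Y (`|X| * B) (d1 a).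
  rewrite Pb add0r -[X in P X 0](mul1r X) lax// la0//; apply=> th th01.
  rewrite Pb add0r; apply: (stepX ('D_b ('D_a w)) 1 th) => //; first exact: ba.
  by move=> s s01; have [h _ _] := HB s th s01 th01; exact: h.
- rewrite -[X in P X](mul1r X) -[Y in P _ Y](mul1r Y).
  apply: (stepX ('D_b w) 1 1) => //; first exact: b0.
  move=> s s01; apply: (stepX ('D_a ('D_b w)) s 1) => //; first exact: ab.
  by move=> r r01; have [_ h _] := HB r 1 r01 i1; exact: h.
- have := @mvt_line ('D_c w) (P X 0 e) b Y (`|X| * (`|X| * B)) (d1 c).
  rewrite Pb add0r cx; apply => th th01.
  rewrite Pb add0r -[X in P X]mul1r; apply: (stepX ('D_b ('D_c w)) 1 th) => //; first exact: bc.
  move=> s s01; apply: (stepX ('D_a ('D_b ('D_c w))) s th) => //; first exact: abc.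
  by move=> r r01; have [_ _ h] := HB r th r01 th01; exact: h.
Qed.

End Hadamard.

(** * Passage near the saddle *)

Section SaddleBounds.
Variable R : realType.
Local Notation V := (R * R * R)%type.

Lemma continuous_box_bounded (g : V -> R) (B : R) : continuous g ->
  exists2 C : R, 0 < C & forall z, inbox B B z -> `|g z| <= C.
Proof.
move=> cg; pose I : set R := [set` `[- B, B]].
have cI : compact I by exact: segment_compact.
have cA : compact (I `*` I `*` I) by apply: compact_setX => //; exact: compact_setX.
have [|M [_ MP]] := @compact_bounded _ _ (g @` (I `*` I `*` I)).
  by apply: continuous_compact => //; apply: continuous_subspaceT.
exists (`|M| + 1); first by rewrite ltr_wpDl.
move=> z [z1 z2 z3]; apply: (MP (`|M| + 1)) => /=.
  by rewrite (le_lt_trans (ler_norm M))// ltrDl.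
exists z => //; rewrite /I; split; [split|] => /=; by rewrite in_itv/= -ler_norml.
Qed.

(** Makes [saddle_remainder] uniform: the iterated derivatives that occur there are bounded on a
    compact box. The region has to contain, with each point, the rectangle it spans with the axes,
    since the integration runs over that rectangle. *)
Lemma saddle_bounds (F : V -> R) (a b : V) (l : R -> R) (KK : R -> R -> Prop) (B C E : R) :
  let P s t e := s *: a + t *: b + e *: ((0, 0, 1) : V) in
  smooth_on setT F -> E <= 1 ->
  (forall s t e, `|s| <= B -> `|t| <= B -> `|e| <= 1 -> inbox (B + 1) (B + 1) (P s t e)) ->
  (forall x y, KK x y -> `|x| <= B /\ `|y| <= B) ->
  (forall x y s t, KK x y -> 0 <= s <= 1 -> 0 <= t <= 1 -> KK (s * x) (t * y)) ->
  (forall e x y, `|e| < E -> KK x y -> `|F (P x y e) - l e * x| <= C * (x ^+ 2 * `|y|)) ->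
  exists2 C' : R, 0 < C' & forall e x y, `|e| < E -> KK x y -> x != 0 -> y != 0 ->
    [/\ l e = 'D_a F (P 0 0 e),
        `|'D_a F (P x y e) - l e| <= C' * `|x * y|,
        `|'D_b F (P x y e)| <= C' * x ^+ 2
      & `|D3 F (P x y e) - x * D3 ('D_a F) (P 0 0 e)| <= C' * (x ^+ 2 * `|y|)].
Proof.
move=> P sF E1 PB KB Kr FK; set c : V := (0, 0, 1).
have cont s : continuous (iter_derive s F).
  by move=> z; apply: differentiable_continuous; apply: sF.
have [C1 C10 C1P] := continuous_box_bounded (B + 1) (cont [:: a; b; a]).
have [C2 C20 C2P] := continuous_box_bounded (B + 1) (cont [:: a; a; b]).
have [C3 C30 C3P] := continuous_box_bounded (B + 1) (cont [:: a; a; b; c]).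
exists (C1 + C2 + C3); first by rewrite !addr_gt0.
move=> e x y eE Kxy x0 y0.
have e1 : `|e| <= 1 by rewrite (le_trans (ltW eE)).
have inP s t : 0 <= s <= 1 -> 0 <= t <= 1 -> inbox (B + 1) (B + 1) (P (s * x) (t * y) e).
  by move=> s01 t01; have [h1 h2] := KB _ _ (Kr _ _ _ _ Kxy s01 t01); exact: PB.
have l1 : C1 <= C1 + C2 + C3 by rewrite -addrA lerDl addr_ge0// ltW.
have l2 : C2 <= C1 + C2 + C3 by rewrite addrAC lerDr addr_ge0// ltW.
have l3 : C3 <= C1 + C2 + C3 by rewrite lerDr addr_ge0// ltW.
have [||h1 h2 h3 h4] := @saddle_remainder R _ F a b c x y e C (C1 + C2 + C3) E l sF x0 y0 eE.
- by move=> e' s t e'E s01 t01; apply: FK => //; exact: Kr.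
- move=> s t s01 t01; have inb := inP s t s01 t01.
  by split; [exact: le_trans (C1P _ inb) l1|exact: le_trans (C2P _ inb) l2|
    exact: le_trans (C3P _ inb) l3].
rewrite D3.unlock; split => //.
- by rewrite h1; apply: (le_trans h2); rewrite normrM mulrA [`|y| * _]mulrC [leRHS]mulrC.
- by apply: (le_trans h3); rewrite mulrA -normrM -expr2 mulrC ger0_norm// sqr_ge0.
- apply: (le_trans h4); rewrite [X in `|y| * X]mulrA -normrM -expr2 [`|x ^+ 2|]ger0_norm ?sqr_ge0//.
  by rewrite mulrA [`|y| * _]mulrC [leRHS]mulrC.
Qed.

End SaddleBounds.

Section Passage.
Variable R : realType.
Local Notation V := (R * R * R)%type.

(** While 4 k c <= 1, the total deviation stays below S, so each step adds at most 4 c S and the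
    growth is linear in j instead of exponential. *)
Lemma gronwall (p q : nat -> R) (k : nat) (c l1 l2 e L : R) :
  0 <= c -> 4 * k%:R * c <= 1 -> `|l1| <= L -> `|l2| <= L ->
  (forall j, (j < k)%N -> `|p j.+1 - p j - e * l1| <= c * (`|p j| + `|q j| + `|e|)) ->
  (forall j, (j < k)%N -> `|q j.+1 - q j - e * l2| <= c * (`|p j| + `|q j| + `|e|)) ->
  let S := `|p 0%N| + `|q 0%N| + (1 + 2 * k%:R * L) * `|e| in
  `|p k - p 0%N - k%:R * (e * l1)| <= 4 * k%:R * c * S /\
  `|q k - q 0%N - k%:R * (e * l2)| <= 4 * k%:R * c * S.
Proof.
move=> c0 kc L1 L2 hp hq S.
have L0 : 0 <= L by exact: le_trans L1.
have S0 : 0 <= S by rewrite /S !addr_ge0// mulr_ge0// addr_ge0// mulr_ge0// mulr_ge0.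
pose A j := `|p j - p 0%N - j%:R * (e * l1)| + `|q j - q 0%N - j%:R * (e * l2)|.
suff H j : (j <= k)%N -> A j <= 4 * j%:R * c * S.
  have := H k (leqnn k); rewrite /A => h; split; apply: le_trans h.
    by rewrite lerDl.
  by rewrite lerDr.
elim: j => [_|j IH jk].
  by rewrite /A !subrr !mul0r !subrr normr0 addr0 mulr0 !mul0r.
have {}IH := IH (ltnW jk).
have jk' : (j%:R : R) <= k%:R by rewrite ler_nat ltnW.
have pj : `|p j| + `|q j| + `|e| <= A j + S.
  have h1 := ler_normD (p j - p 0%N - j%:R * (e * l1)) (p 0%N + j%:R * (e * l1)).
  have h2 := ler_normD (q j - q 0%N - j%:R * (e * l2)) (q 0%N + j%:R * (e * l2)).
  have e1 : p j - p 0%N - j%:R * (e * l1) + (p 0%N + j%:R * (e * l1)) = p j by ring.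
  have e2 : q j - q 0%N - j%:R * (e * l2) + (q 0%N + j%:R * (e * l2)) = q j by ring.
  rewrite e1 in h1; rewrite e2 in h2.
  have h3 := ler_normD (p 0%N) (j%:R * (e * l1)).
  have h4 := ler_normD (q 0%N) (j%:R * (e * l2)).
  have bnd l : `|l| <= L -> `|j%:R * (e * l)| <= k%:R * L * `|e|.
    move=> lL; rewrite !normrM normr_nat [`|e| * _]mulrC mulrA.
    by rewrite ler_wpM2r// ler_pM.
  have := bnd _ L1; have := bnd _ L2.
  move: h1 h2 h3 h4; rewrite /A/S.
  have -> : (1 + 2 * k%:R * L) * `|e| = `|e| + 2 * (k%:R * L * `|e|) by ring.
  move: (k%:R * L * `|e|) (`|j%:R * (e * l1)|) (`|j%:R * (e * l2)|).
  move: (`|p 0%N + _|) (`|q 0%N + _|) (`|p j - _ - _|) (`|q j - _ - _|).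
  move: (`|p j|) (`|q j|) (`|p 0%N|) (`|q 0%N|) (`|e|); clear; intros; lra.
have step : A j.+1 <= A j + 2 * c * (A j + S).
  have e1 : p j.+1 - p 0%N - j.+1%:R * (e * l1) =
    (p j - p 0%N - j%:R * (e * l1)) + (p j.+1 - p j - e * l1) by rewrite -natr1; ring.
  have e2 : q j.+1 - q 0%N - j.+1%:R * (e * l2) =
    (q j - q 0%N - j%:R * (e * l2)) + (q j.+1 - q j - e * l2) by rewrite -natr1; ring.
  rewrite {1}/A e1 e2.
  have h1 := ler_normD (p j - p 0%N - j%:R * (e * l1)) (p j.+1 - p j - e * l1).
  have h2 := ler_normD (q j - q 0%N - j%:R * (e * l2)) (q j.+1 - q j - e * l2).
  have h3 := ler_wpM2l c0 pj.
  have h4 := hp j jk; have h5 := hq j jk.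
  apply: (le_trans (lerD h1 h2)); rewrite addrACA lerD2l.
  apply: (le_trans (lerD (le_trans h4 h3) (le_trans h5 h3))).
  by rewrite -mulrA mulr2n mulrDl mul1r.
apply: (le_trans step).
have cj : 4 * j%:R * c <= 1.
  by apply: le_trans kc; rewrite ler_wpM2r// ler_wpM2l.
have AS : A j <= S by apply: (le_trans IH); rewrite ler_piMl.
have h1 : c * A j <= c * S by rewrite ler_wpM2l.
move: IH h1; move: (A j) => a IH h1.
have -> : 4 * j.+1%:R * c * S = 4 * j%:R * c * S + 4 * (c * S) by rewrite -[j.+1%:R]natr1; ring.
have -> : 2 * c * (a + S) = 2 * (c * a) + 2 * (c * S) by ring.
by clear -IH h1; lra.
Qed.

Lemma sqr_mul_norm (x y : R) : x ^+ 2 * `|y| = `|x * y| * `|x|.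
Proof. by rewrite normrM -{1}(real_normK (num_real x)); ring. Qed.

(** In terms of px / x and py / y every error in the numerator carries a factor x^2 |y|. Dividing by
    F, which is at least a multiple of |x|, leaves |x y|. *)
Lemma log_derivative_step (x y F d1 d2 d3 l l' px py e C al L : R) :
  x != 0 -> y != 0 -> 0 < al -> 0 < C ->
  `|F - l * x| <= C * (x ^+ 2 * `|y|) -> `|d1 - l| <= C * `|x * y| ->
  `|d2| <= C * x ^+ 2 -> `|d3 - x * l'| <= C * (x ^+ 2 * `|y|) ->
  al / 2 <= `|l| -> C * `|x * y| <= al / 4 -> `|l' / l| <= L ->
  F != 0 /\ `|(px * d1 + py * d2 + e * d3) / F - px / x - e * (l' / l)| <=
    4 * C / al * (2 + L) * `|x * y| * (`|px / x| + `|py / y| + `|e|).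
Proof.
move=> x0 y0 al0 C0 hF h1 h2 h3 hl hu hL.
have L0 : 0 <= L by exact: le_trans hL.
have nx : 0 < `|x| by rewrite normr_gt0.
have l0 : l != 0 by rewrite -normr_gt0; apply: lt_le_trans hl; rewrite divr_gt0.
pose T := x ^+ 2 * `|y|.
have TE : T = `|x| * `|x * y| by rewrite /T sqr_mul_norm mulrC.
have T0 : 0 <= T by rewrite TE mulr_ge0.
have CT : C * T <= al / 4 * `|x| by rewrite TE mulrCA [leRHS]mulrC ler_wpM2l.
have Fge : al / 4 * `|x| <= `|F|.
  have := ler_normB F (F - l * x); rewrite subKr normrM => h.
  have h' : al / 2 * `|x| <= `|l| * `|x| by rewrite ler_wpM2r.
  have e2 : al / 2 * `|x| = al / 4 * `|x| + al / 4 * `|x| by field.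
  rewrite -/T in hF.
  by clear -h h' e2 hF CT; move: (`|l| * _) (`|F|) (`|F - _|) h h' hF => ? ? ?; lra.
have alx : 0 < al / 4 * `|x| by rewrite mulr_gt0// divr_gt0.
have nF : 0 < `|F| by exact: lt_le_trans Fge.
have F0 : F != 0 by rewrite -normr_gt0.
split => //.
pose p := px / x; pose q := py / y.
have pE : px = p * x by rewrite /p divfK.
have qE : py = q * y by rewrite /q divfK.
rewrite -/p -/q; clearbody p q.
have -> : (px * d1 + py * d2 + e * d3) / F - p - e * (l' / l) =
  (p * (x * (d1 - l) - (F - l * x)) + q * (y * d2)
   + e * ((d3 - x * l') - (l' / l) * (F - l * x))) / F.
  by rewrite pE qE; field; rewrite F0 l0.
rewrite normrM normfV ler_pdivrMr//.
have S0 : 0 <= `|p| + `|q| + `|e| by rewrite !addr_ge0.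
have -> : 4 * C / al * (2 + L) * `|x * y| * (`|p| + `|q| + `|e|) * `|F| =
  (4 * C / al * (2 + L) * `|x * y| * (`|p| + `|q| + `|e|)) * `|F| by [].
apply: (@le_trans _ _ (C * (2 + L) * T * (`|p| + `|q| + `|e|))).
  have b1 : `|x * (d1 - l) - (F - l * x)| <= 2 * (C * T).
    apply: (le_trans (ler_normB _ _)); rewrite mulr2n mulrDl mul1r; apply: lerD => //.
    by rewrite normrM TE mulrCA; apply: ler_wpM2l.
  have b2 : `|y * d2| <= C * T by rewrite normrM mulrC /T mulrA; apply: ler_wpM2r.
  have b3 : `|(d3 - x * l') - (l' / l) * (F - l * x)| <= C * T + L * (C * T).
    by apply: (le_trans (ler_normB _ _)); apply: lerD => //; exact: normM_le.
  have CT0 : 0 <= C * T by rewrite mulr_ge0// ltW.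
  apply: (le_trans (ler_normD _ _)).
  have c1 := normM_le (lexx `|p|) b1; have c2 := normM_le (lexx `|q|) b2.
  have c3 := normM_le (lexx `|e|) b3.
  have c4 := ler_normD (p * (x * (d1 - l) - (F - l * x))) (q * (y * d2)).
  have -> : C * (2 + L) * T * (`|p| + `|q| + `|e|) =
    `|p| * (2 * (C * T)) + `|p| * (L * (C * T)) + `|q| * (C * T) + `|q| * (C * T)
    + `|q| * (L * (C * T)) + `|e| * (C * T + L * (C * T)) + `|e| * (C * T) by ring.
  have LCT : 0 <= L * (C * T) by exact: mulr_ge0.
  have m1 : 0 <= `|p| * (L * (C * T)) by exact: mulr_ge0.
  have m2 : 0 <= `|q| * (L * (C * T)) by exact: mulr_ge0.
  have m3 : 0 <= `|q| * (C * T) by exact: mulr_ge0.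
  have m4 : 0 <= `|e| * (C * T) by exact: mulr_ge0.
  move: c1 c2 c3 c4 m1 m2 m3 m4.
  move: (`|p * _ + _|) (`|p * (_ - _)|) (`|q * (y * _)|) (`|e * (_ - _)|) => A1 A2 A3 A4.
  rewrite [`|e| * (_ + _)]mulrDr.
  move: (`|p| * (L * _)) (`|q| * (C * T)) (`|q| * (L * _)) (`|e| * (C * T)) (`|e| * (L * _)) (`|p| * (2 * _)).
  by clear; intros; lra.
have -> : C * (2 + L) * T * (`|p| + `|q| + `|e|) =
  (4 * C / al * (2 + L) * `|x * y| * (`|p| + `|q| + `|e|)) * (al / 4 * `|x|).
  by rewrite TE; field; rewrite gt_eqF.
rewrite ler_wpM2l// !mulr_ge0// ?invr_ge0 ?ltW//.
by rewrite ltr_pwDl.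
Qed.

(* [la] and [si] are the eigenvalues along the parameter line; the estimates are what
   the resonant terms of the normal form leave on the region [KK]. *)
Record saddle (F1 F2 : V -> R) (al ch : R) (KK : R -> R -> Prop)
    (la si la' si' : R -> R) (E C : R) : Prop := Saddle {
  sd_al : 0 < al < 1;
  sd_ch : ch = 1 \/ ch = -1;
  sd_E : 0 < E;
  sd_C : 0 < C;
  sd_F1 : forall e x y, `|e| < E -> KK x y ->
    `|F1 (x, y, e) - la e * x| <= C * (x ^+ 2 * `|y|);
  sd_F2 : forall e x y, `|e| < E -> KK x y ->
    `|F2 (x, y, e) - si e * y| <= C * (y ^+ 2 * `|x|);
  sd_dF1 : forall e x y, `|e| < E -> KK x y -> x != 0 -> y != 0 ->
    [/\ `|D1 F1 (x, y, e) - la e| <= C * `|x * y|, `|D2 F1 (x, y, e)| <= C * x ^+ 2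
      & `|D3 F1 (x, y, e) - x * la' e| <= C * (x ^+ 2 * `|y|)];
  sd_dF2 : forall e x y, `|e| < E -> KK x y -> x != 0 -> y != 0 ->
    [/\ `|D2 F2 (x, y, e) - si e| <= C * `|x * y|, `|D1 F2 (x, y, e)| <= C * y ^+ 2
      & `|D3 F2 (x, y, e) - y * si' e| <= C * (y ^+ 2 * `|x|)];
  sd_la : forall e, `|e| < E -> `|la e - al| <= C * `|e|;
  sd_si : forall e, `|e| < E -> `|si e - ch / al| <= C * `|e|;
  sd_la' : forall e, `|e| < E -> `|la' e| <= C;
  sd_si' : forall e, `|e| < E -> `|si' e| <= C
}.

Section Orbit.
Variables (F1 F2 : V -> R) (al ch : R) (KK : R -> R -> Prop).
Variables (la si la' si' : R -> R) (E C : R).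
Hypothesis sd : saddle F1 F2 al ch KK la si la' si' E C.
Let s0 := ch / al.

Lemma s0_norm : `|s0| = al^-1.
Proof.
have /andP[al0 _] := sd_al sd.
by rewrite /s0 normrM normfV (gtr0_norm al0); case: (sd_ch sd) => ->;
  rewrite ?normrN normr1 mul1r.
Qed.

Lemma s0_neq0 : s0 != 0.
Proof. by have /andP[al0 _] := sd_al sd; rewrite -normr_gt0 s0_norm invr_gt0. Qed.

(** In the normalised coordinates xi and ze the linear map at the saddle is the identity. One step
    changes them by at most tau, since the relative errors are O(|x y| + |e|) and |x y| <= 4 al^k
    while xi and ze are at most 2. Starting within rho / 2 of 1, they therefore remain within rho,
    where the region hypothesis applies. *)
Lemma passage_orbit (k : nat) (z : V) (rho : R) :
  (forall j xi ze, (j < k)%N -> `|xi - 1| <= rho -> `|ze - 1| <= rho ->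
     KK (al ^+ j * xi) (s0 ^+ j / s0 ^+ k * ze)) ->
  0 < rho <= 1 -> `|z.2| < E -> `|z.1.1 - 1| <= rho / 2 ->
  `|s0 ^+ k * z.1.2 - 1| <= rho / 2 ->
  let tau := 2 * C / al * (4 * al ^+ k + `|z.2|) in
  k%:R * tau <= rho / 2 ->
  forall j, (j <= k)%N -> exists xi ze : R,
    [/\ iter j (skew F1 F2) z = (al ^+ j * xi, s0 ^+ j / s0 ^+ k * ze, z.2),
        `|xi - z.1.1| <= j%:R * tau & `|ze - s0 ^+ k * z.1.2| <= j%:R * tau].
Proof.
move=> HK /andP[rho0 rho1] eE x01 y01 tau ktau.
have /andP[al0 al1] := sd_al sd; have C0 := sd_C sd; have s00 := s0_neq0.
have tau0 : 0 <= tau.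
  rewrite /tau mulr_ge0// ?divr_ge0 ?mulr_ge0 ?(ltW C0) ?(ltW al0)//.
  by rewrite addr_ge0// mulr_ge0// exprn_ge0// ltW.
elim=> [_|j IH jk].
  exists z.1.1, (s0 ^+ k * z.1.2); rewrite !subrr normr0 !mul0r; split => //=.
  by rewrite !expr0 !mul1r mulKf ?expf_neq0//; case: (z) => -[].
have [xi [ze [zE hxi hze]]] := IH (ltnW jk).
have jtau : j%:R * tau <= rho / 2.
  by apply: le_trans ktau; rewrite ler_wpM2r// ler_nat ltnW.
have xi1 : `|xi - 1| <= rho.
  have -> : xi - 1 = (xi - z.1.1) + (z.1.1 - 1) by ring.
  apply: (le_trans (ler_normD _ _)); move: (`|xi - _|) (`|z.1.1 - 1|) hxi x01.
  by move=> ? ?; lra.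
have ze1 : `|ze - 1| <= rho.
  have -> : ze - 1 = (ze - s0 ^+ k * z.1.2) + (s0 ^+ k * z.1.2 - 1) by ring.
  apply: (le_trans (ler_normD _ _)); move: (`|ze - _|) (`|_ - 1|) hze y01.
  by move=> ? ?; lra.
have xi2 : `|xi| <= 2.
  have := ler_normD (xi - 1) 1; rewrite subrK normr1; move: (`|xi - 1|) xi1 => ?; lra.
have ze2 : `|ze| <= 2.
  have := ler_normD (ze - 1) 1; rewrite subrK normr1; move: (`|ze - 1|) ze1 => ?; lra.
have K := HK j xi ze jk xi1 ze1.
set x := al ^+ j * xi in K zE; set y := s0 ^+ j / s0 ^+ k * ze in K zE.
have nx : `|x| = al ^+ j * `|xi| by rewrite /x normrM ger0_norm// exprn_ge0// ltW.
have ny : `|y| = al ^+ k / al ^+ j * `|ze|.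
  rewrite /y !normrM normfV !normrX s0_norm !exprVn invrK; congr (_ * _).
  by rewrite mulrC.
have alj : al ^+ j != 0 by rewrite expf_neq0// gt_eqF.
have nu : `|x * y| <= 4 * al ^+ k.
  rewrite normrM nx ny.
  have -> : al ^+ j * `|xi| * (al ^+ k / al ^+ j * `|ze|) = al ^+ k * (`|xi| * `|ze|) by field.
  have h : `|xi| * `|ze| <= 2 * 2 by rewrite ler_pM.
  rewrite mulrC; apply: ler_wpM2r; first by rewrite exprn_ge0// ltW.
  by apply: (le_trans h); lra.
have sum u : u <= 4 * al ^+ k -> C * u + C * `|z.2| <= C * (4 * al ^+ k + `|z.2|).
  by move=> h; rewrite -mulrDr ler_wpM2l ?(ltW C0)// lerD2r.
have tauE : C / al * (4 * al ^+ k + `|z.2|) * 2 = tau by rewrite /tau; ring.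
have b1 : `|F1 (x, y, z.2) - al * x| <= C * (4 * al ^+ k + `|z.2|) * `|x|.
  have -> : F1 (x, y, z.2) - al * x = (F1 (x, y, z.2) - la z.2 * x) + (la z.2 - al) * x by ring.
  apply: (le_trans (ler_normD _ _)); rewrite [X in _ + X]normrM.
  apply: (@le_trans _ _ ((C * `|x * y| + C * `|z.2|) * `|x|)).
    rewrite mulrDl; apply: lerD; last by rewrite ler_wpM2r// (sd_la sd).
    by apply: (le_trans (sd_F1 sd eE K)); rewrite sqr_mul_norm mulrA.
  by rewrite ler_wpM2r// sum.
have b2 : `|F2 (x, y, z.2) - s0 * y| <= C * (4 * al ^+ k + `|z.2|) * `|y|.
  have -> : F2 (x, y, z.2) - s0 * y = (F2 (x, y, z.2) - si z.2 * y) + (si z.2 - s0) * y by ring.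
  apply: (le_trans (ler_normD _ _)); rewrite [X in _ + X]normrM.
  apply: (@le_trans _ _ ((C * `|x * y| + C * `|z.2|) * `|y|)).
    rewrite mulrDl; apply: lerD; last by rewrite ler_wpM2r// (sd_si sd).
    by apply: (le_trans (sd_F2 sd eE K)); rewrite sqr_mul_norm mulrA [y * x]mulrC.
  by rewrite ler_wpM2r// sum.
have B0 : 0 <= C * (4 * al ^+ k + `|z.2|).
  by rewrite mulr_ge0 ?(ltW C0)// addr_ge0// mulr_ge0// exprn_ge0// ltW.
exists (F1 (x, y, z.2) / al ^+ j.+1), (F2 (x, y, z.2) * s0 ^+ k / s0 ^+ j.+1).
have alj1 : al ^+ j.+1 != 0 by rewrite expf_neq0// gt_eqF.
have sj1 : s0 ^+ j.+1 != 0 by rewrite expf_neq0.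
have sj : s0 ^+ j != 0 by rewrite expf_neq0.
have sk : s0 ^+ k != 0 by rewrite expf_neq0.
have jS : j.+1%:R * tau = j%:R * tau + tau by rewrite -natr1 mulrDl mul1r.
split.
- rewrite iterS zE /skew/=; congr (_, _, _); first by rewrite mulrC divfK.
  by field; rewrite sj1 sk.
- have -> : F1 (x, y, z.2) / al ^+ j.+1 - z.1.1 =
    (xi - z.1.1) + (F1 (x, y, z.2) - al * x) / al ^+ j.+1.
    by rewrite /x exprS; field; rewrite alj gt_eqF.
  apply: (le_trans (ler_normD _ _)); rewrite jS; apply: lerD => //.
  rewrite normrM normfV [`|al ^+ _|]ger0_norm ?exprn_ge0 ?(ltW al0)//.
  rewrite ler_pdivrMr ?exprn_gt0//; apply: (le_trans b1); rewrite nx -tauE.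
  have -> : C / al * (4 * al ^+ k + `|z.2|) * 2 * al ^+ j.+1 =
    C * (4 * al ^+ k + `|z.2|) * (al ^+ j * 2) by rewrite exprS; field; rewrite gt_eqF.
  by rewrite ler_wpM2l// ler_wpM2l// exprn_ge0// ltW.
- have -> : F2 (x, y, z.2) * s0 ^+ k / s0 ^+ j.+1 - s0 ^+ k * z.1.2 =
    (ze - s0 ^+ k * z.1.2) + (F2 (x, y, z.2) - s0 * y) * (s0 ^+ k / s0 ^+ j.+1).
    by rewrite /y exprS; field; rewrite sj sk s00.
  apply: (le_trans (ler_normD _ _)); rewrite jS; apply: lerD => //.
  rewrite normrM.
  have -> : `|s0 ^+ k / s0 ^+ j.+1| = al ^+ j.+1 / al ^+ k.
    by rewrite normrM normfV !normrX s0_norm !exprVn invrK mulrC.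
  have alk : 0 < al ^+ k by rewrite exprn_gt0.
  have alj' : 0 < al ^+ j.+1 by rewrite exprn_gt0.
  apply: (@le_trans _ _ (C * (4 * al ^+ k + `|z.2|) * `|y| * (al ^+ j.+1 / al ^+ k))).
    by rewrite ler_wpM2r// divr_ge0// ltW.
  rewrite ny -tauE.
  have -> : C * (4 * al ^+ k + `|z.2|) * (al ^+ k / al ^+ j * `|ze|) * (al ^+ j.+1 / al ^+ k) =
    C * (4 * al ^+ k + `|z.2|) * (al * `|ze|) by rewrite exprS; field; rewrite alj gt_eqF.
  have -> : C / al * (4 * al ^+ k + `|z.2|) * 2 = C * (4 * al ^+ k + `|z.2|) * (al^-1 * 2) by ring.
  rewrite ler_wpM2l//; apply: ler_pM => //; first exact: ltW.
  by rewrite (le_trans (ltW al1))// invf_ge1// ltW.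
Qed.

(** With rho <= 1/2 both normalised coordinates lie between 1/2 and 2; in particular x and y do not
    vanish, so that logarithmic derivatives make sense. *)
Lemma passage_region (k : nat) (z : V) (rho : R) :
  (forall j xi ze, (j < k)%N -> `|xi - 1| <= rho -> `|ze - 1| <= rho ->
     KK (al ^+ j * xi) (s0 ^+ j / s0 ^+ k * ze)) ->
  0 < rho <= 1 / 2 -> `|z.2| < E -> `|z.1.1 - 1| <= rho / 2 ->
  `|s0 ^+ k * z.1.2 - 1| <= rho / 2 ->
  k%:R * (2 * C / al * (4 * al ^+ k + `|z.2|)) <= rho / 2 ->
  forall j, (j <= k)%N -> let w := iter j (skew F1 F2) z in
    [/\ (j < k)%N -> KK w.1.1 w.1.2, al ^+ j / 2 <= w.1.1, w.1.1 != 0, w.1.2 != 0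
      & `|w.1.1 * w.1.2| <= 4 * al ^+ k].
Proof.
move=> HK /andP[rho0 rho2] eE x01 y01 ktau j jk; cbv zeta.
have /andP[al0 al1] := sd_al sd; have s00 := s0_neq0.
have C0 := sd_C sd.
have rho1 : 0 < rho <= 1 by apply/andP; split; lra.
have [xi [ze [zE hxi hze]]] := passage_orbit HK rho1 eE x01 y01 ktau jk.
have tau0 : 0 <= 2 * C / al * (4 * al ^+ k + `|z.2|).
  rewrite mulr_ge0// ?divr_ge0 ?mulr_ge0 ?(ltW C0) ?(ltW al0)//.
  by rewrite addr_ge0// mulr_ge0// exprn_ge0// ltW.
have jtau : j%:R * (2 * C / al * (4 * al ^+ k + `|z.2|)) <= rho / 2.
  by apply: le_trans ktau; rewrite ler_wpM2r// ler_nat.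
have xi1 : `|xi - 1| <= rho.
  have -> : xi - 1 = (xi - z.1.1) + (z.1.1 - 1) by ring.
  by apply: (le_trans (ler_normD _ _)); move: (le_trans hxi jtau); lra.
have ze1 : `|ze - 1| <= rho.
  have -> : ze - 1 = (ze - s0 ^+ k * z.1.2) + (s0 ^+ k * z.1.2 - 1) by ring.
  by apply: (le_trans (ler_normD _ _)); move: (le_trans hze jtau); lra.
have xip : 1 / 2 <= xi <= 2.
  by move: xi1; rewrite ler_norml => /andP[? ?]; apply/andP; split; lra.
have zep : 1 / 2 <= ze <= 2.
  by move: ze1; rewrite ler_norml => /andP[? ?]; apply/andP; split; lra.
have alj : 0 < al ^+ j by rewrite exprn_gt0.
case/andP: xip zep => xi2 xi3 /andP[ze2 ze3].
have xi0 : 0 < xi by lra.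
have ze0 : 0 < ze by lra.
rewrite zE /=; split.
- by move=> jk'; apply: HK.
- by rewrite ler_wpM2l ?(ltW alj)//; lra.
- by rewrite mulf_neq0 ?gt_eqF.
- by rewrite !mulf_neq0 ?invr_eq0 ?expf_neq0// gt_eqF.
- have -> : al ^+ j * xi * (s0 ^+ j / s0 ^+ k * ze) = (al ^+ j * s0 ^+ j) / s0 ^+ k * (xi * ze) by ring.
  rewrite !normrM normfV !normrX s0_norm (gtr0_norm al0) !exprVn invrK divff ?gt_eqF// mul1r.
  rewrite mulrC (gtr0_norm xi0) (gtr0_norm ze0) ler_wpM2r ?exprn_ge0 ?(ltW al0)//.
  have h : xi * ze <= 2 * 2 by rewrite ler_pM// ltW.
  by apply: (le_trans h); lra.
Qed.

(* In each step [px / x] and [py / y] change by [e' * (la' / la)] and [e' * (si' / si)]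
   up to O(|x y|), and [x y] stays of order [al ^+ k]. *)
Lemma passage_derive (k : nat) (z : V) (rho : R) (px py : nat -> R) (e' : R) :
  (forall j xi ze, (j < k)%N -> `|xi - 1| <= rho -> `|ze - 1| <= rho ->
     KK (al ^+ j * xi) (s0 ^+ j / s0 ^+ k * ze)) ->
  0 < rho <= 1 / 2 -> `|z.2| < E -> `|z.1.1 - 1| <= rho / 2 ->
  `|s0 ^+ k * z.1.2 - 1| <= rho / 2 ->
  k%:R * (2 * C / al * (4 * al ^+ k + `|z.2|)) <= rho / 2 ->
  C * (4 * al ^+ k) <= al / 4 -> C * `|z.2| <= al / 2 ->
  (forall j, (j < k)%N -> let w := iter j (skew F1 F2) z in
    px j.+1 = px j * D1 F1 w + py j * D2 F1 w + e' * D3 F1 w /\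
    py j.+1 = px j * D1 F2 w + py j * D2 F2 w + e' * D3 F2 w) ->
  let L := 2 * C / al in let c := 4 * C / al * (2 + L) * (4 * al ^+ k) in
  4 * k%:R * c <= 1 ->
  let w := iter k (skew F1 F2) z in
  let S := `|px 0%N / z.1.1| + `|py 0%N / z.1.2| + (1 + 2 * k%:R * L) * `|e'| in
  `|px k / w.1.1 - px 0%N / z.1.1 - k%:R * (e' * (la' z.2 / la z.2))| <= 4 * k%:R * c * S /\
  `|py k / w.1.2 - py 0%N / z.1.2 - k%:R * (e' * (si' z.2 / si z.2))| <= 4 * k%:R * c * S.
Proof.
move=> HK rho01 eE x01 y01 ktau Cal Ce rec L c kc w S.
have /andP[al0 al1] := sd_al sd; have C0 := sd_C sd.
have reg := passage_region HK rho01 eE x01 y01 ktau.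
have L0 : 0 <= L by rewrite /L divr_ge0 ?mulr_ge0 ?ltW.
have alk : 0 < al ^+ k by rewrite exprn_gt0.
have c0 : 0 <= c.
  rewrite /c; apply: mulr_ge0; last by rewrite mulr_ge0// ltW.
  by apply: mulr_ge0; [rewrite divr_ge0 ?mulr_ge0 ?ltW|rewrite addr_ge0].
have hla : al / 2 <= `|la z.2|.
  have := sd_la sd eE; have := ler_normB al (al - la z.2); rewrite subKr distrC (gtr0_norm al0).
  have := ler_normD (la z.2) (al - la z.2); rewrite subrKC (gtr0_norm al0) distrC; lra.
have ali : al <= al^-1 by rewrite (le_trans (ltW al1))// invf_ge1// ltW.
have hsi : al / 2 <= `|si z.2|.
  have := sd_si sd eE; have := ler_normD (si z.2) (ch / al - si z.2).
  by rewrite subrKC -/s0 s0_norm distrC; lra.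
have ratio l l' : al / 2 <= `|l| -> `|l'| <= C -> `|l' / l| <= L.
  move=> hl hl'; have nl : 0 < `|l| by apply: lt_le_trans hl; rewrite divr_gt0.
  rewrite normrM normfV ler_pdivrMr//; apply: (le_trans hl').
  have -> : C = L * (al / 2) by rewrite /L; field; rewrite gt_eqF.
  by rewrite ler_wpM2l.
have Lla := ratio _ _ hla (sd_la' sd eE); have Lsi := ratio _ _ hsi (sd_si' sd eE).
pose p j := px j / (iter j (skew F1 F2) z).1.1.
pose q j := py j / (iter j (skew F1 F2) z).1.2.
have := @gronwall p q k c (la' z.2 / la z.2) (si' z.2 / si z.2) e' L c0 kc Lla Lsi.
apply => j jk.
- have [K _ x0 y0 u4] := reg j (ltnW jk).
  have [e1 e2] := rec j jk.
  have z2 := iter_skew2 F1 F2 j z.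
  rewrite /p/q iterS e1.
  move: x0 y0 u4 (K jk) z2 => /=; move: (iter j _ z) => [[x y] e] /= x0 y0 u4 Kxy eE'.
  rewrite eE'; have [h1 h2 h3] := sd_dF1 sd eE Kxy x0 y0.
  have hF := sd_F1 sd eE Kxy.
  have hu : C * `|x * y| <= al / 4 by apply: le_trans Cal; rewrite ler_wpM2l// ltW.
  have [_ h] := @log_derivative_step x y _ _ _ _ _ _ (px j) (py j) e' C al L x0 y0 al0 C0 hF h1 h2 h3 hla hu Lla.
  apply: (le_trans h); apply: ler_wpM2r; first by rewrite !addr_ge0.
  rewrite /c; apply: ler_wpM2l => //; apply: mulr_ge0; last by rewrite addr_ge0.
  by rewrite divr_ge0 ?mulr_ge0 ?ltW.
- have [K _ x0 y0 u4] := reg j (ltnW jk).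
  have [e1 e2] := rec j jk.
  have z2 := iter_skew2 F1 F2 j z.
  rewrite /p/q iterS e2.
  move: x0 y0 u4 (K jk) z2 => /=; move: (iter j _ z) => [[x y] e] /= x0 y0 u4 Kxy eE'.
  rewrite eE'; have [h1 h2 h3] := sd_dF2 sd eE Kxy x0 y0.
  have hF := sd_F2 sd eE Kxy.
  rewrite mulrC in u4.
  have hu : C * `|y * x| <= al / 4 by apply: le_trans Cal; rewrite ler_wpM2l// ltW.
  rewrite [x * y]mulrC in h1.
  have [_ h] := @log_derivative_step y x _ _ _ _ _ _ (py j) (px j) e' C al L y0 x0 al0 C0 hF h1 h2 h3 hsi hu Lsi.
  rewrite [px j * _ + _]addrC; apply: (le_trans h).
  rewrite [`|py j / y| + _]addrC; apply: ler_wpM2r; first by rewrite !addr_ge0.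
  rewrite /c; apply: ler_wpM2l => //; apply: mulr_ge0; last by rewrite addr_ge0.
  by rewrite divr_ge0 ?mulr_ge0 ?ltW.
Qed.

(* When a1 + b1 = 0 the product [x y] is multiplied by [ch] up to O(|x y|^3). *)
Lemma passage_product (k : nat) (z : V) (rho : R) :
  (forall j xi ze, (j < k)%N -> `|xi - 1| <= rho -> `|ze - 1| <= rho ->
     KK (al ^+ j * xi) (s0 ^+ j / s0 ^+ k * ze)) ->
  0 < rho <= 1 / 2 -> z.2 = 0 -> `|z.1.1 - 1| <= rho / 2 ->
  `|s0 ^+ k * z.1.2 - 1| <= rho / 2 ->
  k%:R * (2 * C / al * (4 * al ^+ k)) <= rho / 2 ->
  (forall x y, KK x y ->
    `|F1 (x, y, 0) * F2 (x, y, 0) - ch * (x * y)| <= C * `|x * y| ^+ 3) ->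
  let w := iter k (skew F1 F2) z in
  `|w.1.1 * w.1.2 - ch ^+ k * (z.1.1 * z.1.2)| <= k%:R * (C * (4 * al ^+ k) ^+ 3).
Proof.
move=> HK rho01 e0 x01 y01 ktau prod; cbv zeta.
have C0 := sd_C sd; have /andP[al0 _] := sd_al sd.
have eE : `|z.2| < E by rewrite e0 normr0 (sd_E sd).
have ktau' : k%:R * (2 * C / al * (4 * al ^+ k + `|z.2|)) <= rho / 2.
  by rewrite e0 normr0 addr0.
have reg := passage_region HK rho01 eE x01 y01 ktau'.
have ch1 : `|ch| = 1 by case: (sd_ch sd) => ->; rewrite ?normrN normr1.
suff H j : (j <= k)%N -> `|(iter j (skew F1 F2) z).1.1 * (iter j (skew F1 F2) z).1.2
    - ch ^+ j * (z.1.1 * z.1.2)| <= j%:R * (C * (4 * al ^+ k) ^+ 3) by exact: H.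
elim: j => [_|j IH jk]; first by rewrite expr0 mul1r subrr normr0 mul0r.
have {}IH := IH (ltnW jk); have [K _ x0 y0 u4] := reg j (ltnW jk).
have z2 := iter_skew2 F1 F2 j z.
rewrite iterS; move: IH x0 y0 u4 (K jk) z2; move: (iter j _ z) => [[x y] e] /= IH x0 y0 u4 Kxy eE'.
rewrite eE' e0.
have -> : F1 (x, y, 0) * F2 (x, y, 0) - ch ^+ j.+1 * (z.1.1 * z.1.2) =
  (F1 (x, y, 0) * F2 (x, y, 0) - ch * (x * y)) + ch * (x * y - ch ^+ j * (z.1.1 * z.1.2)).
  by rewrite exprS; ring.
apply: (le_trans (ler_normD _ _)); rewrite normrM ch1 mul1r -natr1 mulrDl mul1r addrC.
apply: lerD => //; apply: (le_trans (prod _ _ Kxy)); rewrite ler_wpM2l ?(ltW C0)//.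
by rewrite lerXn2r ?nnegrE// mulr_ge0// exprn_ge0// ltW.
Qed.

End Orbit.

End Passage.

(** * Asymptotics of the return map *)

Section Geometric.
Variable R : realType.

(** With b the square root of a, Bernoulli's inequality for 1 / b = 1 + h bounds k b^k by 1 / h, and
    the second factor b^k tends to 0. *)
Lemma cvg_natr_geometric (a : R) : 0 < a < 1 -> (fun k : nat => k%:R * a ^+ k) @ \oo --> (0 : R).
Proof.
move=> /andP[a0 a1]; pose b := Num.sqrt a.
have b0 : 0 < b by rewrite sqrtr_gt0.
have bE : a = b ^+ 2 by rewrite sqr_sqrtr// ltW.
have b1 : b < 1.
  rewrite ltNge; apply/negP => b1; move: a1; rewrite bE ltNge => /negP; apply.
  by rewrite expr_ge1// ltW.
pose h := b^-1 - 1; have h0 : 0 < h by rewrite subr_gt0 invf_gt1.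
have bern k : k%:R * b ^+ k <= h^-1.
  have bk : 0 < b ^+ k by rewrite exprn_gt0.
  rewrite -ler_pdivlMr// -[X in h^-1 / X]invrK -exprVn invrK.
  have -> : b^-1 = 1 + h by rewrite /h; ring.
  rewrite mulrC ler_pdivlMr//.
  elim: k {bk} => [|k IH]; first by rewrite mul0r expr0 ler01.
  rewrite exprS mulrDl mul1r -natr1 mulrDl mul1r; apply: lerD => //.
  rewrite ler_peMr ?(ltW h0)//; apply: exprn_ege1; lra.
apply: (@squeeze_cvgr _ _ _ _ (fun=> 0) (fun k => h^-1 * b ^+ k)).
- apply: nearW => k; rewrite mulr_ge0 ?exprn_ge0 ?(ltW a0)//=.
  have -> : a ^+ k = b ^+ k * b ^+ k by rewrite bE -exprM mulnC exprM expr2.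
  by rewrite mulrA ler_wpM2r// exprn_ge0// ltW.
- exact: cvg_cst.
- rewrite -(mulr0 h^-1); apply: cvgMr; apply: cvg_expr; by rewrite ger0_norm// ltW.
Qed.

Lemma cvg_natr2_geometric (a : R) : 0 < a < 1 ->
  (fun k : nat => k%:R ^+ 2 * a ^+ k) @ \oo --> (0 : R).
Proof.
move=> /andP[a0 a1]; pose b := Num.sqrt a.
have b0 : 0 < b by rewrite sqrtr_gt0.
have bE : a = b ^+ 2 by rewrite sqr_sqrtr// ltW.
have b1 : b < 1.
  rewrite ltNge; apply/negP => b1; move: a1; rewrite bE ltNge => /negP; apply.
  by rewrite expr_ge1// ltW.
have cb := @cvg_natr_geometric b ltac:(by rewrite b0).
have -> : (fun k : nat => k%:R ^+ 2 * a ^+ k) = (fun k => k%:R * b ^+ k) \* (fun k => k%:R * b ^+ k).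
  apply/funext => k /=; have -> : a ^+ k = b ^+ k * b ^+ k by rewrite bE -exprM mulnC exprM expr2.
  by rewrite expr2 mulrACA.
by rewrite -(mulr0 0); exact: cvgM.
Qed.

End Geometric.

Section Asymptotics.
Variable R : realType.
Local Notation V := (R * R * R)%type.
Variables (F1 F2 : V -> R) (al ch chi : R) (KK : R -> R -> Prop).
Variables (la si la' si' : R -> R) (E C : R).
Hypothesis sd : saddle F1 F2 al ch KK la si la' si' E C.
Hypotheses (CF1 : C2 F1) (CF2 : C2 F2).
Variables (m : nat) (rho L W : R) (k0 : nat) (om : nat -> R).
Hypothesis rho01 : 0 < rho <= 1 / 2.
Hypothesis L1 : 1 <= L.
Hypothesis W0 : 0 <= W.
Hypothesis omW : forall k, k%:R * `|om k| <= W * al ^+ k.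
Hypothesis HKK : forall k j xi ze, (k0 <= k)%N -> (j < k)%N ->
  `|xi - 1| <= rho -> `|ze - 1| <= rho ->
  KK (al ^+ j * xi) ((ch / al) ^+ j / (ch / al) ^+ k * ze).

(** The return map sends the first coordinate to alpha^k (1 + O(k alpha^k)); the radius k^2 alpha^k
    is eventually larger than this error, so the box is preserved in that direction, and it still
    tends to 0. *)
Definition pbox (k : nat) (z : V) : Prop :=
  [/\ `|z.1.1 / al ^+ k - 1| <= k%:R ^+ 2 * al ^+ k,
      `|z.1.2 - 1| <= L * al ^+ k & `|z.2| <= L * `|om k|].

(* Convergence along [pfilter] is convergence as k tends to infinity in the class
   [ch ^+ k = chi], uniformly over the boxes [pbox k]. *)
Definition pfilter : set_system (nat * V) := [set A | exists N, forall k z,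
  (N <= k)%N -> ch ^+ k = chi -> pbox k z -> A (k, z)].

(** The filter is not claimed to be proper: if ch = 1 and chi = -1, no k qualifies and all limits
    hold vacuously. *)
Global Instance pfilter_filter : Filter pfilter.
Proof.
split.
- by exists 0%N.
- move=> A B [N1 h1] [N2 h2]; exists (maxn N1 N2) => k z.
  by rewrite geq_max => /andP[n1 n2] chk bz; split; [exact: h1|exact: h2].
- by move=> A B AB [N h]; exists N => k z Nk chk bz; apply: AB; exact: h.
Qed.

Let a (w : nat * V) : R := al ^+ w.1.
Let n (w : nat * V) : R := w.1%:R.
Let b0 : V := (0, 1, 0).

Lemma pf_seq (u : nat -> R) (l : R) : u @ \oo --> l -> (fun w => u w.1) @ pfilter --> l.
Proof. by move=> ul A /ul [N _ NP]; exists N => k z Nk _ _; exact: NP. Qed.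

Lemma pf_squeeze (f g : nat * V -> R) :
  (\forall w \near pfilter, `|f w| <= g w) -> g @ pfilter --> (0 : R) ->
  f @ pfilter --> (0 : R).
Proof.
move=> fg g0; apply/cvgrPdist_lt => e e0.
have /cvgrPdist_lt/(_ e e0) := g0; apply: filterS2 fg => w h1.
rewrite !sub0r !normrN => h2; exact: le_lt_trans h1 (le_lt_trans (ler_norm _) h2).
Qed.

Lemma pf_eq (f g : nat * V -> R) (l l' : R) : l' = l ->
  (\forall w \near pfilter, f w = g w) -> g @ pfilter --> l' -> f @ pfilter --> l.
Proof. by move=> -> fg; apply: cvg_trans; apply: near_eq_cvg; apply: filterS fg. Qed.

Lemma pf_cvgD (f g : nat * V -> R) (l l' : R) : f @ pfilter --> l -> g @ pfilter --> l' ->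
  (fun w => f w + g w) @ pfilter --> l + l'.
Proof. exact: cvgD. Qed.

Lemma pf_cvgM (f g : nat * V -> R) (l l' : R) : f @ pfilter --> l -> g @ pfilter --> l' ->
  (fun w => f w * g w) @ pfilter --> l * l'.
Proof. exact: cvgM. Qed.

Lemma pf_cst (c : R) : (fun=> c : R) @ pfilter --> c.
Proof. exact: cvg_cst. Qed.

Lemma pf_bounded (f g : nat * V -> R) (B : R) : (\forall w \near pfilter, `|f w| <= B) ->
  g @ pfilter --> (0 : R) -> (fun w => f w * g w) @ pfilter --> (0 : R).
Proof.
move=> fB g0; apply: (@pf_squeeze _ (fun w => B * `|g w|)).
  by apply: filterS fB => w h; rewrite normrM ler_wpM2r.
rewrite -(mulr0 B); apply: cvgMr; rewrite -(normr0 R); exact: cvg_norm g0.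
Qed.

Lemma pf_cvg_bounded (f : nat * V -> R) (l : R) : f @ pfilter --> l ->
  \forall w \near pfilter, `|f w| <= `|l| + 1.
Proof.
move=> /cvgrPdist_lt/(_ 1 ltr01); apply: filterS => w h.
have := ler_normB l (l - f w); rewrite subKr => h'; apply: (le_trans h').
by rewrite lerD2l ltW.
Qed.

Lemma pf_a : a @ pfilter --> (0 : R).
Proof.
apply: (@pf_seq (fun k => al ^+ k)); apply: cvg_expr.
by have /andP[al0 al1] := sd_al sd; rewrite ger0_norm// ltW.
Qed.

Lemma pf_na : (fun w => n w * a w) @ pfilter --> (0 : R).
Proof. exact: (@pf_seq (fun k => k%:R * al ^+ k)) (cvg_natr_geometric (sd_al sd)). Qed.

Lemma pf_n2a : (fun w => n w ^+ 2 * a w) @ pfilter --> (0 : R).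
Proof. exact: (@pf_seq (fun k => k%:R ^+ 2 * al ^+ k)) (cvg_natr2_geometric (sd_al sd)). Qed.

Lemma pf_ninv : (fun w => (n w)^-1) @ pfilter --> (0 : R).
Proof.
apply: (@pf_seq (fun k => k%:R^-1)); rewrite -cvg_shiftS; exact: cvg_harmonic.
Qed.

Lemma a_gt0 w : 0 < a w.
Proof. by have /andP[al0 _] := sd_al sd; rewrite exprn_gt0. Qed.

Lemma pf_pos : \forall w \near pfilter, (0 < w.1)%N.
Proof. by exists 1%N. Qed.

Lemma pf_k0 : \forall w \near pfilter, (k0 <= w.1)%N.
Proof. by exists k0. Qed.

Lemma pf_box : \forall w \near pfilter, pbox w.1 w.2.
Proof. by exists 0%N. Qed.

Lemma pf_chi : \forall w \near pfilter, ch ^+ w.1 = chi.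
Proof. by exists 0%N. Qed.

Lemma pf_om : \forall w \near pfilter, `|om w.1| <= W * a w / n w.
Proof.
apply: filterS pf_pos => w w0.
by rewrite ler_pdivlMr ?ltr0n// mulrC; exact: omW.
Qed.

Lemma pf_omW : \forall w \near pfilter, `|om w.1| <= W * a w.
Proof.
apply: filterS2 pf_pos pf_om => w w0 h; apply: (le_trans h).
rewrite ler_pdivrMr ?ltr0n// ler_peMr ?ler1n//.
by rewrite mulr_ge0// ltW// a_gt0.
Qed.

Lemma pf_X : (fun w => w.2.1.1 / a w) @ pfilter --> (1 : R).
Proof.
apply/subr_cvg0; apply: pf_squeeze pf_n2a.
by apply: filterS pf_box => w [].
Qed.

Lemma pf_e : (fun w => w.2.2 / a w) @ pfilter --> (0 : R).
Proof.
have h : (fun w => L * W * (n w)^-1) @ pfilter --> (0 : R).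
  by rewrite -(mulr0 (L * W)); apply: cvgMr; exact: pf_ninv.
apply: pf_squeeze h; apply: filterS2 pf_box pf_om => w [_ _ h1] h2.
have a0 := a_gt0 w; rewrite normrM normfV (gtr0_norm a0) ler_pdivrMr//.
apply: (le_trans h1); have -> : L * W / n w * a w = L * (W * a w / n w) by ring.
by rewrite ler_wpM2l// (le_trans ler01).
Qed.

Lemma pf_ne : (fun w => n w * w.2.2) @ pfilter --> (0 : R).
Proof.
have h : (fun w => L * W * a w) @ pfilter --> (0 : R).
  by rewrite -(mulr0 (L * W)); apply: cvgMr; exact: pf_a.
apply: pf_squeeze h; apply: filterS pf_box => w [_ _ h1].
rewrite normrM normr_nat; have L0 : 0 <= L by exact: le_trans L1.
apply: (@le_trans _ _ (n w * (L * `|om w.1|))); first by rewrite ler_wpM2l.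
rewrite mulrCA -[L * W * _]mulrA; apply: ler_wpM2l => //; exact: omW.
Qed.

Let B := 2 + L + L * W.

Lemma pf_dist : \forall w \near pfilter, `|w.2 - b0| <= B * a w.
Proof.
have X1 : \forall w \near pfilter, `|w.2.1.1 / a w| <= 2.
  by apply: filterS (pf_cvg_bounded pf_X) => w; rewrite normr1.
apply: filterS3 X1 pf_box pf_omW => w X1 [_ h2 h3] h4.
have a0 := a_gt0 w; have L0 : 0 <= L by exact: le_trans L1.
have LW : 0 <= L * W by exact: mulr_ge0.
rewrite normrM normfV (gtr0_norm a0) ler_pdivrMr// in X1.
have h3' : `|w.2.2| <= L * W * a w.
  by apply: (le_trans h3); rewrite -mulrA ler_wpM2l.
have leB c : c <= B -> c * a w <= B * a w by move=> h; rewrite ler_wpM2r// ltW.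
rewrite !prod_normE/= !ge_max /= !subr0; apply/andP; split; [apply/andP; split|].
- by apply: (le_trans X1); apply: leB; rewrite /B -addrA lerDl addr_ge0.
- by apply: (le_trans h2); apply: leB; rewrite /B addrAC lerDr addr_ge0.
- by apply: (le_trans h3'); apply: leB; rewrite /B lerDr addr_ge0.
Qed.

Lemma B_gt0 : 0 < B.
Proof.
have L0 : 0 <= L by exact: le_trans L1.
by rewrite /B -addrA ltr_pwDl// addr_ge0// mulr_ge0.
Qed.

Lemma pf_z : snd @ pfilter --> b0.
Proof.
apply/cvgrPdist_lt => e e0.
have e1 : 0 < e / (B + 1) by rewrite divr_gt0// ltr_wpDl// ltW// B_gt0.
have /cvgrPdist_lt/(_ _ e1) := pf_a.
apply: filterS2 pf_dist => w h1; rewrite sub0r normrN (gtr0_norm (a_gt0 w)) => h2.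
rewrite distrC; apply: (le_lt_trans h1).
have B1 : 0 < B + 1 by rewrite ltr_wpDl// ltW// B_gt0.
move: h2; rewrite ltr_pdivlMr// mulrC; apply: le_lt_trans.
by rewrite ler_wpM2r ?(ltW (a_gt0 w))// lerDl.
Qed.

Lemma pf_cont (h : V -> R) : {for b0, continuous h} -> (fun w => h w.2) @ pfilter --> h b0.
Proof. by move=> ch0; apply: (@cvg_comp _ _ _ snd h pfilter (nbhs b0)) ch0; exact: pf_z. Qed.

(** The box has size O(alpha^k) around (0, 1, 0), so the remainder of a first-order expansion is
    o(alpha^k). The quotient (Y - 1) / alpha^k is bounded but need not converge, hence a vanishing
    difference in place of a limit. *)
Lemma pf_expand (h : V -> R) : differentiable h b0 ->
  (fun w => (h w.2 - h b0) / a w - (w.2.1.1 / a w * D1 h b0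
     + (w.2.1.2 - 1) / a w * D2 h b0 + w.2.2 / a w * D3 h b0)) @ pfilter --> (0 : R).
Proof.
move=> dh; apply/cvgrPdist_le => e e0.
have e1 : 0 < e / B by rewrite divr_gt0// B_gt0.
have [d d0 dP] := differentiable_littleo dh e1.
have /cvgrPdist_lt/(_ _ d0) : (fun w => w.2 - b0) @ pfilter --> (0 : V).
  by apply/subr_cvg0; exact: pf_z.
apply: filterS2 pf_dist => w hB; rewrite sub0r normrN => hd.
have a0 := a_gt0 w.
have := dP _ hd; rewrite subrKC -deriveE// deriveV3E//= !subr0 => h1.
rewrite sub0r normrN.
have -> : (h w.2 - h b0) / a w - (w.2.1.1 / a w * D1 h b0 + (w.2.1.2 - 1) / a w * D2 h b0 +
    w.2.2 / a w * D3 h b0) = (h w.2 - h b0 - (w.2.1.1 * D1 h b0 + (w.2.1.2 - 1) * D2 h b0 +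
    w.2.2 * D3 h b0)) / a w by field; rewrite gt_eqF.
rewrite normrM normfV (gtr0_norm a0) ler_pdivrMr//; apply: (le_trans h1).
apply: (@le_trans _ _ (e / B * (B * a w))); first by rewrite ler_wpM2l// ltW.
by rewrite mulrA divfK// gt_eqF// B_gt0.
Qed.

Let T := skew F1 F2.
Let gx (z : V) := (iter m T z).1.1.
Let gy (z : V) := (iter m T z).1.2.
Let xk (w : nat * V) := (iter w.1 T (iter m T w.2)).1.1.
Let yk (w : nat * V) := (iter w.1 T (iter m T w.2)).1.2.
Variables c1 c2 d3 d4 d5 : R.
Hypotheses (gx0 : gx b0 = 1) (gy0 : gy b0 = 0).
Hypotheses (gy1 : D1 gy b0 = chi) (gy2 : D2 gy b0 = 0).
Hypotheses (gx1 : D1 gx b0 = c1) (gx2 : D2 gx b0 = c2).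
Hypotheses (gy21 : D1 (D2 gy) b0 = d4) (gy22 : D2 (D2 gy) b0 = 2 * d5).
Hypothesis chiE : chi = 1 \/ chi = -1.

Lemma C2_gx : C2 gx. Proof. by have [] := C2_iter CF1 CF2 m. Qed.
Lemma C2_gy : C2 gy. Proof. by have [] := C2_iter CF1 CF2 m. Qed.

Lemma C1_cont (h : V -> R) : C2 h -> [/\ {for b0, continuous h}, {for b0, continuous (D1 h)},
  {for b0, continuous (D2 h)} & {for b0, continuous (D3 h)}].
Proof.
move=> h2; have h1 := C2_C1 h2; split.
- by apply: differentiable_continuous; have [] := h1.
- exact: C1_D1.
- exact: C1_D2.
- exact: C1_D3.
Qed.

Lemma pf_gx : (gx \o snd) @ pfilter --> (1 : R).
Proof. by have [h _ _ _] := C1_cont C2_gx; have := pf_cont h; rewrite gx0. Qed.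

Lemma chi_sqr : chi * chi = 1.
Proof. by case: chiE => ->; ring. Qed.

Lemma pf_gya : (fun w => gy w.2 / a w) @ pfilter --> chi.
Proof.
have dg : differentiable gy b0 by have [] := C2_C1 C2_gy.
have := pf_expand dg; rewrite gy0 gy1 gy2 => h.
have h' : (fun w => w.2.1.1 / a w * chi + w.2.2 / a w * D3 gy b0)
   @ pfilter --> (1 * chi + 0 * D3 gy b0 : R).
  apply: cvgD; first by apply: cvgMl; exact: pf_X.
  by apply: cvgMl; exact: pf_e.
apply: pf_eq (pf_cvgD h h'); first by ring.
by apply: nearW => w; rewrite subr0 mulr0 addr0 subrK.
Qed.

(** [tau] is the drift per step in [passage_orbit], [cc] the constant to which [passage_derive]
    applies [gronwall]. *)
Let tau (w : nat * V) := 2 * C / al * (4 * a w + `|w.2.2|).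
Let cc (w : nat * V) := 4 * C / al * (2 + 2 * C / al) * (4 * a w).

Lemma pf_tau : (fun w => n w * tau w) @ pfilter --> (0 : R).
Proof.
have h : (fun w => 2 * C / al * (4 * (n w * a w) + `|n w * w.2.2|)) @ pfilter -->
   (2 * C / al * (4 * 0 + `|0 : R|)).
  apply: cvgMr; apply: cvgD; first by apply: cvgMr; exact: pf_na.
  by apply: cvg_norm; exact: pf_ne.
apply: pf_eq h; first by rewrite normr0; ring.
by apply: nearW => w; rewrite normrM normr_nat /tau; ring.
Qed.

Lemma pf_cc : (fun w => n w * cc w) @ pfilter --> (0 : R).
Proof.
apply: (@pf_eq _ (fun w => (4 * C / al * (2 + 2 * C / al) * 4) * (n w * a w)) _ 
  (4 * C / al * (2 + 2 * C / al) * 4 * 0)); first by ring.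
  by apply: nearW => w; rewrite /cc; ring.
by apply: cvgMr; exact: pf_na.
Qed.

Lemma pf_le (f : nat * V -> R) (c : R) : 0 < c -> f @ pfilter --> (0 : R) ->
  \forall w \near pfilter, `|f w| <= c.
Proof.
by move=> c0 /cvgrPdist_le/(_ _ c0); apply: filterS => w; rewrite sub0r normrN.
Qed.

Lemma pf_e0 : (fun w : nat * V => w.2.2) @ pfilter --> (0 : R).
Proof.
apply: (@pf_eq _ (fun w => w.2.2 / a w * a w) _ (0 * 0)); first by rewrite mulr0.
  by apply: nearW => w; rewrite divfK// gt_eqF// a_gt0.
apply: cvgM; [exact: pf_e | exact: pf_a].
Qed.

(** Here the class ch^k = chi enters: T_1 sends the box to heights close to chi alpha^k, which must
    agree in sign with (ch / al)^(-k) for the passage to end near (0, 1). *)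
Lemma pf_s0gy : (fun w => (ch / al) ^+ w.1 * gy w.2) @ pfilter --> (1 : R).
Proof.
apply: (@pf_eq _ (fun w => chi * (gy w.2 / a w)) _ (chi * chi)); first exact: chi_sqr.
  by apply: filterS pf_chi => w; rewrite expr_div_n => ->; rewrite /a; ring.
by apply: cvgMr; exact: pf_gya.
Qed.

Definition passes (w : nat * V) := let z := iter m T w.2 in
  [/\ [/\ (k0 <= w.1)%N, `|z.2| < E, `|z.1.1 - 1| <= rho / 2 & `|(ch / al) ^+ w.1 * z.1.2 - 1| <= rho / 2],
   n w * tau w <= rho / 2, C * (4 * a w) <= al / 4, C * `|z.2| <= al / 2 & 4 * n w * cc w <= 1].

Lemma pf_passes : \forall w \near pfilter, passes w.
Proof.
have r0 : 0 < rho / 2 by case/andP: rho01 => r0 _; rewrite divr_gt0.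
have al0 : 0 < al by have /andP[] := sd_al sd.
have C0 := sd_C sd; have E0 : 0 < E / 2 by rewrite divr_gt0// (sd_E sd).
have A1 := pf_le E0 pf_e0.
have A2 : \forall w \near pfilter, `|gx w.2 - 1| <= rho / 2.
  by apply: pf_le => //; apply/subr_cvg0; exact: pf_gx.
have A3 : \forall w \near pfilter, `|(ch / al) ^+ w.1 * gy w.2 - 1| <= rho / 2.
  by apply: pf_le => //; apply/subr_cvg0; exact: pf_s0gy.
have A4 := pf_le r0 pf_tau.
have A5 := @pf_le _ (al / (16 * C)) ltac:(by rewrite divr_gt0// mulr_gt0) pf_a.
have A6 := @pf_le _ (al / (2 * C)) ltac:(by rewrite divr_gt0// mulr_gt0) pf_e0.
have A7 := @pf_le _ (4^-1) ltac:(by rewrite invr_gt0) pf_cc.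
have E1 : E / 2 < E by have := sd_E sd; move=> ?; lra.
near=> w; rewrite /passes; cbv zeta; rewrite iter_skew2; split.
- split; [by near: w; exact: pf_k0| | by near: w | by near: w].
  by apply: le_lt_trans E1; near: w.
- by apply: le_trans (ler_norm _) _; near: w.
- have : `|a w| <= al / (16 * C) by near: w.
  by rewrite (gtr0_norm (a_gt0 w)) ler_pdivlMr ?mulr_gt0// => h; lra.
- have : `|w.2.2| <= al / (2 * C) by near: w.
  by rewrite ler_pdivlMr ?mulr_gt0// => h; lra.
- have : `|n w * cc w| <= 4^-1 by near: w.
  move=> h; have := le_trans (ler_norm _) h; rewrite -mulrA; move: (n w * cc w) => X h'; lra.
Unshelve. all: by end_near.
Qed.

Lemma pf_orbit : \forall w \near pfilter, exists xi : R,
  [/\ xk w = a w * xi, `|xi - gx w.2| <= n w * tau w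
    & `|yk w - (ch / al) ^+ w.1 * gy w.2| <= n w * tau w].
Proof.
apply: filterS pf_passes => w [[kk hE h1 h2] h3 _ _ _].
have r01 : 0 < rho <= 1 by case/andP: rho01 => r0 r1; lra.
have hk := HKK kk.
rewrite /tau -(iter_skew2 F1 F2 m) in h3 *.
have [xi [ze [e1 e2 e3]]] := passage_orbit sd (fun j xi ze => @hk j xi ze) r01 hE h1 h2 h3 (leqnn _).
exists xi; rewrite /xk /yk -/T e1 /=; split => //.
by rewrite divff ?mul1r// expf_neq0// (s0_neq0 sd).
Qed.

Lemma pf_xka : (fun w => xk w / a w) @ pfilter --> (1 : R).
Proof.
apply/subr_cvg0.
have h : (fun w => `|n w * tau w| + `|gx w.2 - 1|) @ pfilter --> (`|0 : R| + `|0 : R|).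
  apply: cvgD; first by apply: cvg_norm; exact: pf_tau.
  by apply: cvg_norm; apply/subr_cvg0; exact: pf_gx.
rewrite !normr0 addr0 in h; apply: pf_squeeze h.
apply: filterS pf_orbit => w [xi [-> h1 _]].
have -> : a w * xi / a w - 1 = (xi - gx w.2) + (gx w.2 - 1).
  by field; rewrite gt_eqF// a_gt0.
apply: (le_trans (ler_normD _ _)); rewrite lerD2r.
exact: le_trans h1 (ler_norm _).
Qed.

Lemma pf_yk : yk @ pfilter --> (1 : R).
Proof.
apply/subr_cvg0.
have h : (fun w => `|n w * tau w| + `|(ch / al) ^+ w.1 * gy w.2 - 1|) @ pfilter
    --> (`|0 : R| + `|0 : R|).
  apply: cvgD; first by apply: cvg_norm; exact: pf_tau.
  by apply: cvg_norm; apply/subr_cvg0; exact: pf_s0gy.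
rewrite !normr0 addr0 in h; apply: pf_squeeze h.
apply: filterS pf_orbit => w [xi [_ _ h1]].
have -> : yk w - 1 = (yk w - (ch / al) ^+ w.1 * gy w.2) + ((ch / al) ^+ w.1 * gy w.2 - 1).
  by ring.
apply: (le_trans (ler_normD _ _)); rewrite lerD2r.
exact: le_trans h1 (ler_norm _).
Qed.

(** Both the drift along the passage and the variation of T_1 over the box are at most a constant
    times k alpha^k, and k eventually exceeds that constant. *)
Lemma pf_self : \forall w \near pfilter, `|xk w / a w - 1| < n w ^+ 2 * a w.
Proof.
have dg : differentiable gx b0 by have [] := C2_C1 C2_gx.
have [d d0 dP] := differentiable_littleo dg ltr01.
have /cvgrPdist_lt/(_ _ d0) : (fun w => w.2 - b0) @ pfilter --> (0 : V).
  by apply/subr_cvg0; exact: pf_z.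
pose M := `|D1 gx b0| + `|D2 gx b0| + `|D3 gx b0| + 1.
have M0 : 0 <= M by rewrite !addr_ge0.
pose D := M * B + 2 * C / al * (4 + L * W).
have nD : \forall w \near pfilter, D < n w.
  exists (Num.trunc D).+1 => k z kk _ _; rewrite /n/=.
  apply: lt_le_trans (truncnS_gt _) _; by rewrite ler_nat.
have al0 : 0 < al by have /andP[] := sd_al sd.
have C0 := sd_C sd.
have L0 : 0 <= L by exact: le_trans L1.
move=> nd; near=> w.
have [xi [-> h1 _]] : exists xi : R, [/\ xk w = a w * xi, `|xi - gx w.2| <= n w * tau w
    & `|yk w - (ch / al) ^+ w.1 * gy w.2| <= n w * tau w].
  by near: w; exact: pf_orbit.
have n1 : 1 <= n w by rewrite /n ler1n; near: w; exact: pf_pos.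
have a0 := a_gt0 w.
have hb : `|w.2 - b0| <= B * a w by near: w; exact: pf_dist.
have hg : `|gx w.2 - 1| <= M * B * a w.
  have hd : `|0 - (w.2 - b0)| < d by near: w.
  rewrite sub0r normrN in hd.
  have := dP _ hd; rewrite subrKC -deriveE// deriveV3E// gx0 mul1r.
  have : `|w.2.1.1| <= `|w.2 - b0| /\ `|w.2.1.2 - 1| <= `|w.2 - b0| /\ `|w.2.2| <= `|w.2 - b0|.
    by rewrite !prod_normE/= !subr0 !le_max !lexx ?orbT.
  rewrite /= !subr0 => -[b1 [b2 b3]] hh.
  have -> : gx w.2 - 1 = gx w.2 - 1 - (w.2.1.1 * D1 gx b0 + (w.2.1.2 - 1) * D2 gx b0 + w.2.2 * D3 gx b0) +
    (w.2.1.1 * D1 gx b0 + (w.2.1.2 - 1) * D2 gx b0 + w.2.2 * D3 gx b0) by ring.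
  apply: (@le_trans _ _ (M * `|w.2 - b0|)); last by rewrite -mulrA ler_wpM2l.
  apply: (le_trans (ler_normD _ _)).
  have -> : M * `|w.2 - b0| = `|w.2 - b0| + (`|w.2 - b0| * `|D1 gx b0| + `|w.2 - b0| * `|D2 gx b0| +
      `|w.2 - b0| * `|D3 gx b0|).
    by rewrite /M; move: `|w.2 - b0| => N; ring.
  apply: lerD => //; apply: (le_trans (ler_normD _ _)); apply: lerD; last first.
    by rewrite normrM ler_wpM2r.
  by apply: (le_trans (ler_normD _ _)); apply: lerD; rewrite normrM ler_wpM2r.
have he : n w * `|w.2.2| <= L * W * (n w * a w).
  have [_ _ h] : pbox w.1 w.2 by near: w; exact: pf_box.
  apply: (@le_trans _ _ (n w * (L * `|om w.1|))); first by rewrite ler_wpM2l.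
  rewrite mulrCA -[L * W * _]mulrA ler_wpM2l//; apply: (le_trans (omW _)).
  by rewrite ler_wpM2l// ler_peMl// ltW.
have -> : a w * xi / a w - 1 = (xi - gx w.2) + (gx w.2 - 1) by field; rewrite gt_eqF.
apply: (le_lt_trans (ler_normD _ _)).
apply: (@le_lt_trans _ _ (D * (n w * a w))).
  rewrite /D mulrDl addrC; apply: lerD.
    apply: (le_trans hg); rewrite ler_wpM2l// ?mulr_ge0// ?(ltW B_gt0)//.
    by rewrite ler_peMl// ltW.
  apply: (le_trans h1); rewrite /tau mulrCA -[leRHS]mulrA.
  apply: ler_wpM2l; first by rewrite divr_ge0 ?mulr_ge0// ltW.
  by rewrite mulrDr [leRHS]mulrDl lerD// mulrCA.
have n0 : 0 < n w by apply: lt_le_trans n1.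
rewrite expr2 -mulrA ltr_pM2r; last by rewrite mulr_gt0.
by near: w; exact: nD.
Unshelve. all: by end_near.
Qed.

(** After j >= 1 steps the first coordinate is al^j xi with xi close to its initial value, hence
    roughly al times that value at most. This excludes smaller periods. *)
Lemma pf_noreturn : \forall w \near pfilter, forall j, (0 < j <= w.1)%N ->
  (iter j T (iter m T w.2)).1.1 < gx w.2.
Proof.
have /andP[al0 al1] := sd_al sd.
have r1 : 0 < (1 - al) / 4 by rewrite divr_gt0// subr_gt0.
have A1 := pf_le r1 pf_tau.
have A2 : \forall w \near pfilter, `|gx w.2 - 1| <= 2^-1.
  by apply: pf_le; [rewrite invr_gt0|apply/subr_cvg0; exact: pf_gx].
near=> w.
have [[kk hE h1 h2] h3 _ _ _] : passes w by near: w; exact: pf_passes.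
have h4 : `|n w * tau w| <= (1 - al) / 4 by near: w.
have h5 : `|gx w.2 - 1| <= 2^-1 by near: w.
have r01 : 0 < rho <= 1 by case/andP: rho01 => r0 r1'; lra.
have hk := HKK kk.
have t0 : 0 <= tau w.
  apply: mulr_ge0; last by rewrite addr_ge0// mulr_ge0// ltW// a_gt0.
  by rewrite divr_ge0 ?mulr_ge0 ?ltW// (sd_C sd).
rewrite -/T in h1 h2; move=> j /andP[j0 jk]; move: h3; rewrite /tau -(iter_skew2 F1 F2 m) => h3.
have [xi [ze [e1 e2 _]]] := passage_orbit sd (fun j xi ze => @hk j xi ze) r01 hE h1 h2 h3 jk.
rewrite e1 /=; rewrite iter_skew2 -/(tau w) in e2.
have e3 : `|xi - gx w.2| <= (1 - al) / 4.
  apply: (le_trans e2); apply: le_trans (_ : n w * tau w <= _).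
    by rewrite ler_wpM2r// ler_nat.
  exact: le_trans (ler_norm _) h4.
have alj : al ^+ j <= al by case: j j0 {jk e1 e2} => // j _; rewrite exprS ler_piMr ?exprn_ile1// ltW.
have alj0 : 0 < al ^+ j by rewrite exprn_gt0.
move: e3 h5; rewrite !ler_norml => /andP[p1 p2] /andP[p3 p4].
have xi0 : 0 < xi by lra.
apply: (@le_lt_trans _ _ (al * xi)); first by rewrite ler_wpM2r// ltW.
have : al * xi <= al * (gx w.2 + (1 - al) / 4) by rewrite ler_wpM2l ?(ltW al0)//; lra.
move=> h6; apply: (le_lt_trans h6).
move: (gx w.2) p3 p4 => G p3 p4; nra.
Unshelve. all: by end_near.
Qed.

Let dx (u : V) (k : nat) (z : V) := 'D_u (fun z => (iter (k + m) T z).1.1) z.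
Let dy (u : V) (k : nat) (z : V) := 'D_u (fun z => (iter (k + m) T z).1.2) z.

Lemma dx_rec u j z : let w := iter j T (iter m T z) in
  dx u j.+1 z = dx u j z * D1 F1 w + dy u j z * D2 F1 w + u.2 * D3 F1 w /\
  dy u j.+1 z = dx u j z * D1 F2 w + dy u j z * D2 F2 w + u.2 * D3 F2 w.
Proof.
move=> w; have [[x1 _] [y1 _]] := C2_iter CF1 CF2 (j + m).
have wE : iter (j + m) T = fun z => ((iter (j + m) T z).1.1, (iter (j + m) T z).1.2, z.2).
  apply/funext => y; rewrite -[in RHS](iter_skew2 F1 F2 (j + m) y) -/T.
  by case: (iter _ _ _) => [[]].
have ww : w = ((iter (j + m) T z).1.1, (iter (j + m) T z).1.2, z.2).
  by rewrite /w -iterD wE.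
split; rewrite /dx /dy ww.
- rewrite -(derive_chain3 _ x1 y1); last by have [] := CF1.
  by congr ('D_u _ z); apply/funext => y; rewrite addSn /= {1}wE.
- rewrite -(derive_chain3 _ x1 y1); last by have [] := CF2.
  by congr ('D_u _ z); apply/funext => y; rewrite addSn /= {1}wE.
Qed.

(** The weight [s] keeps the initial logarithmic derivatives bounded, so the [gronwall] error
    becomes a bounded factor times k cc, which tends to 0. What is left is the effect of the
    parameter on the eigenvalues, k times, whose weighted limit is [Th]; it is 0 when u has no
    parameter component. *)
Lemma pf_derive u (s : nat * V -> R) (Th S : R) :
  {for 0, continuous la'} -> {for 0, continuous si'} ->
  (\forall w \near pfilter, `|s w * (dx u 0 w.2 / gx w.2)| <= S) ->
  (\forall w \near pfilter, `|s w * (dy u 0 w.2 / gy w.2)| <= S) ->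
  (fun w => s w * n w * u.2) @ pfilter --> Th ->
  (fun w => s w * (dx u w.1 w.2 / xk w) - s w * (dx u 0 w.2 / gx w.2)) @ pfilter
     --> (Th * (la' 0 / al)) /\
  (fun w => s w * (dy u w.1 w.2 / yk w) - s w * (dy u 0 w.2 / gy w.2)) @ pfilter
     --> (Th * (si' 0 / (ch / al))).
Proof.
move=> cla csi hS1 hS2 hTh.
have al0 : 0 < al by have /andP[] := sd_al sd.
have lac : (fun w : nat * V => la w.2.2) @ pfilter --> al.
  apply/subr_cvg0; apply: (@pf_squeeze _ (fun w => C * `|w.2.2|)).
    apply: filterS pf_passes => w [[_ h _ _] _ _ _ _].
    by rewrite iter_skew2 in h; exact: (sd_la sd).
  rewrite -(mulr0 C); apply: cvgMr; rewrite -(normr0 R); exact: cvg_norm pf_e0.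
have sic : (fun w : nat * V => si w.2.2) @ pfilter --> (ch / al).
  apply/subr_cvg0; apply: (@pf_squeeze _ (fun w => C * `|w.2.2|)).
    apply: filterS pf_passes => w [[_ h _ _] _ _ _ _].
    by rewrite iter_skew2 in h; exact: (sd_si sd).
  rewrite -(mulr0 C); apply: cvgMr; rewrite -(normr0 R); exact: cvg_norm pf_e0.
have la'c : (fun w : nat * V => la' w.2.2) @ pfilter --> la' 0.
  exact: (@cvg_comp _ _ _ (fun w : nat * V => w.2.2) la' pfilter (nbhs 0)) pf_e0 cla.
have si'c : (fun w : nat * V => si' w.2.2) @ pfilter --> si' 0.
  exact: (@cvg_comp _ _ _ (fun w : nat * V => w.2.2) si' pfilter (nbhs 0)) pf_e0 csi.
have l1 : (fun w => s w * n w * u.2 * (la' w.2.2 / la w.2.2)) @ pfilter --> Th * (la' 0 / al).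
  by apply: cvgM => //; apply: cvgM => //; apply: cvgV => //; rewrite gt_eqF.
have l2 : (fun w => s w * n w * u.2 * (si' w.2.2 / si w.2.2)) @ pfilter --> Th * (si' 0 / (ch / al)).
  by apply: cvgM => //; apply: cvgM => //; apply: cvgV => //; exact: (s0_neq0 sd).
pose M := 2 * S + (1 + 2 * (2 * C / al)) * (`|Th| + 1).
(* The factor [1 + 2 * n * (2 C / al)] grows with k, but it multiplies s u.2, and s k u.2
   converges. *)
have hb : \forall w \near pfilter, `|s w| * (4 * n w * cc w * (`|dx u 0 w.2 / gx w.2| +
    `|dy u 0 w.2 / gy w.2| + (1 + 2 * n w * (2 * C / al)) * `|u.2|)) <= 4 * M * (n w * cc w).
  near=> w.
  have C0 := sd_C sd; have Ca : 0 <= 2 * C / al by rewrite divr_ge0 ?mulr_ge0 ?ltW.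
  have n1 : 1 <= n w by rewrite /n ler1n; near: w; exact: pf_pos.
  have cc0 : 0 <= 4 * (n w * cc w).
    have c0 : 0 <= cc w.
      have Ca2 : 0 <= 4 * C / al by rewrite divr_ge0 ?mulr_ge0 ?ltW.
      apply: mulr_ge0; first by apply: mulr_ge0 => //; exact: addr_ge0.
      by apply: mulr_ge0 => //; exact: ltW (a_gt0 w).
    by apply: mulr_ge0 => //; apply: mulr_ge0.
  have t1 : `|s w * (dx u 0 w.2 / gx w.2)| <= S by near: w.
  have t2 : `|s w * (dy u 0 w.2 / gy w.2)| <= S by near: w.
  have t3 : `|s w * n w * u.2| <= `|Th| + 1 by near: w; exact: pf_cvg_bounded.
  rewrite normrM in t1; rewrite normrM in t2; rewrite !normrM normr_nat in t3.
  move: t1 t2 t3; move: `|dx u 0 w.2 / gx w.2| `|dy u 0 w.2 / gy w.2| => p q t1 t2 t3.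
  have -> : `|s w| * (4 * n w * cc w * (p + q + (1 + 2 * n w * (2 * C / al)) * `|u.2|)) =
    4 * (n w * cc w) * (`|s w| * p + `|s w| * q + (`|s w| * `|u.2| + 2 * (2 * C / al) * (`|s w| * n w * `|u.2|))).
    by ring.
  have -> : 4 * M * (n w * cc w) = 4 * (n w * cc w) * M by ring.
  apply: ler_wpM2l => //.
  have -> : M = S + S + ((`|Th| + 1) + 2 * (2 * C / al) * (`|Th| + 1)) by rewrite /M; ring.
  apply: lerD; first exact: lerD.
  apply: lerD; last by apply: ler_wpM2l => //; rewrite mulr_ge0.
  apply: le_trans t3; rewrite ler_wpM2r// ler_peMr//.
have hb0 : (fun w => 4 * M * (n w * cc w)) @ pfilter --> (0 : R).
  by rewrite -(mulr0 (4 * M)); apply: cvgMr; exact: pf_cc.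
have key : \forall w \near pfilter,
  `|s w * (dx u w.1 w.2 / xk w) - s w * (dx u 0 w.2 / gx w.2) - s w * n w * u.2 * (la' w.2.2 / la w.2.2)| <= 4 * M * (n w * cc w) /\
  `|s w * (dy u w.1 w.2 / yk w) - s w * (dy u 0 w.2 / gy w.2) - s w * n w * u.2 * (si' w.2.2 / si w.2.2)| <= 4 * M * (n w * cc w).
  apply: filterS2 pf_passes hb => w [[kk hE h1 h2] h3 h4 h5 h6] hb.
  have hk := HKK kk.
  rewrite /tau -(iter_skew2 F1 F2 m) in h3.
  have := @passage_derive _ _ _ _ _ _ _ _ _ _ _ _ sd w.1 (iter m T w.2) rho (fun j => dx u j w.2)
    (fun j => dy u j w.2) u.2 (fun j xi ze => @hk j xi ze) rho01 hE h1 h2 h3 h4 h5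
    (fun j _ => dx_rec u j w.2) h6.
  rewrite /= -/(xk w) -/(yk w) iter_skew2 => -[e1 e2]; split.
  - have -> : s w * (dx u w.1 w.2 / xk w) - s w * (dx u 0 w.2 / gx w.2) - s w * n w * u.2 * (la' w.2.2 / la w.2.2)
      = s w * (dx u w.1 w.2 / xk w - dx u 0 w.2 / gx w.2 - n w * (u.2 * (la' w.2.2 / la w.2.2))) by ring.
    by rewrite normrM; apply: le_trans hb; apply: ler_wpM2l.
  - have -> : s w * (dy u w.1 w.2 / yk w) - s w * (dy u 0 w.2 / gy w.2) - s w * n w * u.2 * (si' w.2.2 / si w.2.2)
      = s w * (dy u w.1 w.2 / yk w - dy u 0 w.2 / gy w.2 - n w * (u.2 * (si' w.2.2 / si w.2.2))) by ring.
    by rewrite normrM; apply: le_trans hb; apply: ler_wpM2l.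
split.
- have h : (fun w => s w * (dx u w.1 w.2 / xk w) - s w * (dx u 0 w.2 / gx w.2) - s w * n w * u.2 * (la' w.2.2 / la w.2.2))
    @ pfilter --> (0 : R) by apply: pf_squeeze hb0; apply: filterS key => w [].
  apply: pf_eq (pf_cvgD h l1); first by rewrite add0r.
  by apply: nearW => w; rewrite subrK.
- have h : (fun w => s w * (dy u w.1 w.2 / yk w) - s w * (dy u 0 w.2 / gy w.2) - s w * n w * u.2 * (si' w.2.2 / si w.2.2))
    @ pfilter --> (0 : R) by apply: pf_squeeze hb0; apply: filterS key => w [].
  apply: pf_eq (pf_cvgD h l2); first by rewrite add0r.
  by apply: nearW => w; rewrite subrK.
Unshelve. all: by end_near.
Qed.

Hypotheses (cla : {for 0, continuous la'}) (csi : {for 0, continuous si'}).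
Let Xk (k : nat) (z : V) := (iter (k + m) T z).1.1.
Let Yk (k : nat) (z : V) := (iter (k + m) T z).1.2.

Lemma pf_gy_neq0 : \forall w \near pfilter, gy w.2 != 0.
Proof.
have /cvgrPdist_lt/(_ 1 ltr01) := pf_gya; apply: filterS => w /= h.
apply/eqP => g0; move: h; rewrite g0 mul0r subr0.
by case: chiE => ->; rewrite ?normrN normr1 ltxx.
Qed.

Lemma pf_near1 (f : nat * V -> R) : f @ pfilter --> (1 : R) -> \forall w \near pfilter, f w != 0.
Proof.
move=> /cvgrPdist_lt/(_ 1 ltr01); apply: filterS => w /= h.
by apply/eqP => g0; move: h; rewrite g0 subr0 normr1 ltxx.
Qed.

Lemma chi_neq0 : chi != 0.
Proof. by case: chiE => ->; rewrite ?oppr_eq0 oner_eq0. Qed.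

Lemma pf_dgx u : (fun w => dx u 0 w.2 / gx w.2) @ pfilter --> 'D_u gx b0.
Proof.
have [_ dd] := C2_gx.
have h : (fun w => dx u 0 w.2) @ pfilter --> 'D_u gx b0.
  by apply: (@pf_cont ('D_u gx)); exact: differentiable_continuous (dd u b0).
have := pf_cvgM h (cvgV (oner_neq0 R) pf_gx); rewrite invr1 mulr1; exact.
Qed.

Lemma pf_agy u : (fun w => a w * (dy u 0 w.2 / gy w.2)) @ pfilter --> 'D_u gy b0 * chi.
Proof.
have [_ dd] := C2_gy.
have h : (fun w => dy u 0 w.2) @ pfilter --> 'D_u gy b0.
  by apply: (@pf_cont ('D_u gy)); exact: differentiable_continuous (dd u b0).
have hh : (fun w => dy u 0 w.2 * (gy w.2 / a w)^-1) @ pfilter --> 'D_u gy b0 / chi.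
  by apply: cvgM => //; apply: cvgV => //; [exact: chi_neq0|exact: pf_gya].
apply: pf_eq hh; first by case: chiE => ->; rewrite ?invrN invr1.
by apply: nearW => w; rewrite invf_div mulrCA mulrA.
Qed.

Lemma pf_scaled_bound (f : nat * V -> R) (l S : R) : f @ pfilter --> l -> `|l| + 1 <= S ->
  \forall w \near pfilter, `|f w| <= S.
Proof. by move=> /pf_cvg_bounded h lS; apply: filterS h => w h; exact: le_trans lS. Qed.

Lemma pf_D1 : (fun w => D1 (Xk w.1) w.2) @ pfilter --> (0 : R) /\
  (fun w => a w * D1 (Yk w.1) w.2) @ pfilter --> (1 : R).
Proof.
rewrite D1.unlock; set u : V := (1, 0, 0).
have h1 : (fun w => a w * (dx u 0 w.2 / gx w.2)) @ pfilter --> (0 : R).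
  by rewrite -(mul0r ('D_u gx b0)); apply: cvgM; [exact: pf_a|exact: pf_dgx].
have h2 := @pf_agy u; have D1E : 'D_u gy b0 = chi by rewrite -gy1 D1.unlock.
rewrite D1E chi_sqr in h2.
have h3 : (fun w => a w * n w * u.2) @ pfilter --> (0 : R).
  by apply: (@pf_eq _ (fun=> 0)) (cvg_cst _) => //; apply: nearW => w; rewrite /u /= mulr0.
have S1 := @pf_scaled_bound _ _ (0 + 2) h1 ltac:(rewrite normr0; lra).
have S2 := @pf_scaled_bound _ _ (0 + 2) h2 ltac:(rewrite normr1; lra).
have [e1 e2] := pf_derive cla csi S1 S2 h3; rewrite !mul0r in e1 e2.
have {}e1 := pf_cvgD e1 h1; have {}e2 := pf_cvgD e2 h2; rewrite ?add0r ?addr0 in e1 e2.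
split.
- have := pf_cvgM pf_xka e1; rewrite mul1r; apply: pf_eq => //.
  apply: filterS (pf_near1 pf_xka) => w xa; rewrite subrK.
  have a0 := a_gt0 w; have x0 : xk w != 0 by apply: contraNneq xa => ->; rewrite mul0r.
  by rewrite [RHS](_ : _ = dx u w.1 w.2)//; field; rewrite x0 gt_eqF.
- have := pf_cvgM pf_yk e2; rewrite mul1r; apply: pf_eq => //.
  apply: filterS (pf_near1 pf_yk) => w xa; rewrite subrK.
  by rewrite mulrCA; congr (_ * _); rewrite mulrC divfK.
Qed.

(** Numerator and denominator are both of order alpha^k because [D2 gy] vanishes at the base point;
    its expansion brings in d_4 and d_5, the latter with the bounded quotient (Y - 1) / alpha^k. *)
Lemma pf_D2gy : (fun w => D2 gy w.2 / gy w.2 - chi * (d4 + 2 * d5 * ((w.2.1.2 - 1) / a w))) @ pfilter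
  --> (0 : R).
Proof.
have [_ dd] := C2_gy.
have d2 : differentiable (D2 gy) b0 by rewrite D2.unlock; exact: dd.
have h1 := pf_expand d2; rewrite gy2 gy21 gy22 in h1.
have hE : (fun w => w.2.2 / a w * D3 (D2 gy) b0 + (w.2.1.1 / a w - 1) * d4) @ pfilter --> (0 : R).
  rewrite (_ : 0 = 0 * D3 (D2 gy) b0 + (1 - 1) * d4); last by ring.
  apply: cvgD; apply: cvgMl; first exact: pf_e.
  by apply: cvgB; [exact: pf_X|exact: cvg_cst].
have h2 := pf_cvgD h1 hE; rewrite addr0 in h2.
have h3 : (fun w => (gy w.2 / a w)^-1 - chi) @ pfilter --> (0 : R).
  rewrite (_ : 0 = chi^-1 - chi); last by case: chiE => ->; rewrite ?invrN invr1 subrr.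
  by apply: cvgB; [apply: cvgV; [exact: chi_neq0|exact: pf_gya]|exact: cvg_cst].
have hb : \forall w \near pfilter, `|d4 + 2 * d5 * ((w.2.1.2 - 1) / a w)| <= `|d4| + `|2 * d5| * L.
  apply: filterS pf_box => w [_ hY _]; apply: (le_trans (ler_normD _ _)).
  rewrite lerD2l normrM ler_wpM2l// normrM normfV (gtr0_norm (a_gt0 w)).
  by rewrite ler_pdivrMr// a_gt0.
have h4 : (fun w => (gy w.2 / a w)^-1) @ pfilter --> chi.
  by apply: pf_eq (pf_cvgD h3 (cvg_cst chi)); [rewrite add0r|apply: nearW => w; rewrite subrK].
have h5 := pf_cvgM h2 h4; rewrite mul0r in h5.
have := pf_cvgD h5 (pf_bounded hb h3); rewrite addr0; apply: pf_eq => //.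
apply: filterS pf_gy_neq0 => w g0;   have := a_gt0 w; move/lt0r_neq0 => a0.
move: (D2 gy w.2) (D3 (D2 gy) b0) (gy w.2) g0 (a w) a0 => p q g g0 aw a0.
by field; rewrite g0 a0.
Qed.

Lemma pf_D2gy_bounded : exists S, \forall w \near pfilter, `|D2 gy w.2 / gy w.2| <= S.
Proof.
exists (`|0 : R| + 1 + `|chi| * (`|d4| + `|2 * d5| * L)).
apply: filterS2 (pf_cvg_bounded pf_D2gy) pf_box => w h [_ hY _].
have -> : D2 gy w.2 / gy w.2 = D2 gy w.2 / gy w.2 - chi * (d4 + 2 * d5 * ((w.2.1.2 - 1) / a w))
  + chi * (d4 + 2 * d5 * ((w.2.1.2 - 1) / a w)) by rewrite subrK.
apply: (le_trans (ler_normD _ _)); apply: lerD => //.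
rewrite normrM ler_wpM2l//; apply: (le_trans (ler_normD _ _)).
rewrite lerD2l normrM ler_wpM2l// normrM normfV (gtr0_norm (a_gt0 w)).
by rewrite ler_pdivrMr// a_gt0.
Qed.

Lemma pf_D2 : (fun w => D2 (Xk w.1) w.2 / a w) @ pfilter --> c2 /\
  (fun w => D2 (Yk w.1) w.2 - chi * (d4 + 2 * d5 * ((w.2.1.2 - 1) / a w))) @ pfilter --> (0 : R).
Proof.
have [S hS] := pf_D2gy_bounded; have hg := pf_D2gy; rewrite -gx2.
rewrite D2.unlock in hS hg *; set u : V := (0, 1, 0).
have h1 : (fun w => 1 * (dx u 0 w.2 / gx w.2)) @ pfilter --> 'D_u gx b0.
  by apply: pf_eq (@pf_dgx u) => //; apply: nearW => w; rewrite mul1r.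
have S1 : \forall w \near pfilter, `|1 * (dx u 0 w.2 / gx w.2)| <= Num.max S (`|'D_u gx b0| + 1).
  by apply: pf_scaled_bound h1 _; rewrite le_max lexx orbT.
have S2 : \forall w \near pfilter, `|1 * (dy u 0 w.2 / gy w.2)| <= Num.max S (`|'D_u gx b0| + 1).
  by apply: filterS hS => w h; rewrite mul1r le_max h.
have h3 : (fun w => 1 * n w * u.2) @ pfilter --> (0 : R).
  by apply: (@pf_eq _ (fun=> 0)) (cvg_cst _) => //; apply: nearW => w; rewrite /u /= mulr0.
have [e1 e2] := pf_derive cla csi S1 S2 h3; rewrite !mul0r in e1 e2.
have {}e1 := pf_cvgD e1 h1; rewrite add0r in e1.
split.
- have := pf_cvgM pf_xka e1; rewrite mul1r; apply: pf_eq => //.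
  apply: filterS (pf_near1 pf_xka) => w xa; rewrite subrK mul1r.
  have a0 := a_gt0 w; have x0 : xk w != 0 by apply: contraNneq xa => ->; rewrite mul0r.
  rewrite -[X in X / a w]/(dx u w.1 w.2); move: (dx _ _ _) => p.
  by field; rewrite x0 gt_eqF.
- have hb : \forall w \near pfilter, `|1 * (dy u w.1 w.2 / yk w)| <= (`|0 : R| + 1) + Num.max S (`|'D_u gx b0| + 1).
    apply: filterS2 (pf_cvg_bounded e2) S2 => w t1 t2.
    rewrite -[X in `|X|](subrK (1 * (dy u 0 w.2 / gy w.2))).
    by apply: (le_trans (ler_normD _ _)); apply: lerD.
  have y1 : (fun w => yk w - 1) @ pfilter --> (0 : R) by apply/subr_cvg0; exact: pf_yk.
  have := pf_cvgD (pf_cvgD (pf_bounded hb y1) e2) hg; rewrite !addr0; apply: pf_eq => //.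
  apply: filterS (pf_near1 pf_yk) => w y0.
  rewrite -/(dy u 0 w.2) -[X in X - _ = _]/(dy u w.1 w.2).
  move: (dy u w.1 w.2) (dy u 0 w.2 / gy w.2) (chi * _) => p q t.
  by rewrite !mul1r mulrBr mulr1 divfK// !addrA !subrK.
Qed.

Lemma pf_q_square (o : R) : (forall k, om k = o * al ^+ (2 * k)) ->
  (fun w => om w.1 / a w * (D3 gy w.2 / gy w.2)) @ pfilter --> o * D3 gy b0 * chi.
Proof.
move=> ho; have := pf_cvgM (@pf_cst o) (@pf_agy (0, 0, 1)).
rewrite mulrA D3.unlock; apply: pf_eq => //.
apply: nearW => w; rewrite ho mulnC exprM expr2 -/(a w).
rewrite -[dy _ 0%N w.2]/('D_(0, 0, 1) gy w.2).
have /lt0r_neq0 a0 := a_gt0 w; move: ('D_(0, 0, 1) gy w.2 / gy w.2) => p.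
by rewrite mulrA mulfK// -mulrA.
Qed.

(** When d_0 is stationary along v, [D3 gy] is itself of order alpha^k and so is comparable to gy,
    while om / alpha^k tends to 0. *)
Lemma pf_q_tangent : D3 gy b0 = 0 ->
  (fun w => om w.1 / a w * (D3 gy w.2 / gy w.2)) @ pfilter --> (0 : R).
Proof.
move=> g3; have [_ dd] := C2_gy.
have d3' : differentiable (D3 gy) b0 by rewrite D3.unlock; exact: dd.
have h1 := pf_expand d3'; rewrite g3 in h1.
have h0 : (fun w => om w.1 / a w) @ pfilter --> (0 : R).
  apply: (@pf_squeeze _ (fun w => W * (n w)^-1)).
    apply: filterS pf_om => w h; rewrite normrM normfV (gtr0_norm (a_gt0 w)).
    by rewrite ler_pdivrMr ?a_gt0// mulrAC.
  by rewrite -(mulr0 W); apply: cvgMr; exact: pf_ninv.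
pose S := `|0 : R| + 1 + ((`|1 : R| + 1) * `|D1 (D3 gy) b0| + L * `|D2 (D3 gy) b0| + (`|0 : R| + 1) * `|D3 (D3 gy) b0|).
have hb : \forall w \near pfilter, `|D3 gy w.2 / a w| <= S.
  near=> w.
  have t1 : `|w.2.1.1 / a w| <= `|1 : R| + 1 by near: w; exact: pf_cvg_bounded pf_X.
  have t2 : `|w.2.2 / a w| <= `|0 : R| + 1 by near: w; exact: pf_cvg_bounded pf_e.
  have t3 : `|(w.2.1.2 - 1) / a w| <= L.
    have [_ hY _] : pbox w.1 w.2 by near: w; exact: pf_box.
    by rewrite normrM normfV (gtr0_norm (a_gt0 w)) ler_pdivrMr// a_gt0.
  have t4 : `|(D3 gy w.2 - 0) / a w - (w.2.1.1 / a w * D1 (D3 gy) b0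
     + (w.2.1.2 - 1) / a w * D2 (D3 gy) b0 + w.2.2 / a w * D3 (D3 gy) b0)| <= `|0 : R| + 1.
    by near: w; exact: pf_cvg_bounded h1.
  rewrite subr0 in t4.
  rewrite -[X in `|X|](subrK (w.2.1.1 / a w * D1 (D3 gy) b0
     + (w.2.1.2 - 1) / a w * D2 (D3 gy) b0 + w.2.2 / a w * D3 (D3 gy) b0)).
  apply: (le_trans (ler_normD _ _)); apply: lerD => //.
  apply: (le_trans (ler_normD _ _)); apply: lerD; last by rewrite normrM ler_wpM2r.
  by apply: (le_trans (ler_normD _ _)); apply: lerD; rewrite normrM ler_wpM2r.
have ig : (fun w => (gy w.2 / a w)^-1) @ pfilter --> chi^-1.
  by apply: cvgV; [exact: chi_neq0|exact: pf_gya].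
have := pf_cvgM (pf_bounded hb h0) ig; rewrite mul0r; apply: pf_eq => //.
apply: nearW => w; rewrite invf_div; move: (D3 gy w.2) => p.
by have /lt0r_neq0 a0 := a_gt0 w; move: (a w) a0 (gy w.2)^-1 => av a0 ig'; field.
Unshelve. all: by end_near.
Qed.

Variables Th q : R.
Hypothesis hTh : (fun k => om k * k%:R / al ^+ k) @ \oo --> Th.
Hypothesis hq : (fun w => om w.1 / a w * (D3 gy w.2 / gy w.2)) @ pfilter --> q.

(** The parameter acts in two ways: [q] comes from the motion of d_0 in T_1 and [Th] from the
    eigenvalues along the passage. In case (i) Th = 0, in case (ii) q = 0. The weights are those of
    the later rescaling. *)
Lemma pf_D3 : (fun w => om w.1 / a w ^+ 2 * D3 (Xk w.1) w.2) @ pfilter --> Th * (la' 0 / al) /\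
  (fun w => om w.1 / a w * D3 (Yk w.1) w.2) @ pfilter --> q + Th * (si' 0 / (ch / al)).
Proof.
have hq' := hq; rewrite D3.unlock in hq' *; set u : V := (0, 0, 1).
have h3 : (fun w => om w.1 / a w * n w * u.2) @ pfilter --> Th.
  by apply: pf_eq (pf_seq hTh) => //; apply: nearW => w; rewrite /u /= mulr1 mulrAC.
have h0 : (fun w => om w.1 / a w) @ pfilter --> (0 : R).
  have := pf_cvgM h3 pf_ninv; rewrite mulr0; apply: pf_eq => //.
  apply: filterS pf_pos => w w0; rewrite /u /= mulr1 mulfK//.
  by rewrite /n pnatr_eq0 -lt0n.
have h1 : (fun w => om w.1 / a w * (dx u 0 w.2 / gx w.2)) @ pfilter --> (0 : R).
  by rewrite -(mul0r ('D_u gx b0)); apply: cvgM => //; exact: pf_dgx.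
have S1 : \forall w \near pfilter, `|om w.1 / a w * (dx u 0 w.2 / gx w.2)| <= (`|0 : R| + 1) + (`|q| + 1).
  by apply: pf_scaled_bound h1 _; rewrite lerDl addr_ge0.
have S2 : \forall w \near pfilter, `|om w.1 / a w * (dy u 0 w.2 / gy w.2)| <= (`|0 : R| + 1) + (`|q| + 1).
  by apply: pf_scaled_bound hq' _; rewrite lerDr addr_ge0.
have [e1 e2] := pf_derive cla csi S1 S2 h3.
have {}e1 := pf_cvgD e1 h1; have {}e2 := pf_cvgD e2 hq'.
split.
- have := pf_cvgM pf_xka e1; rewrite mul1r addr0; apply: pf_eq => //.
  apply: filterS (pf_near1 pf_xka) => w xa; rewrite subrK.
  have a0 := a_gt0 w; have x0 : xk w != 0 by apply: contraNneq xa => ->; rewrite mul0r.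
  rewrite -[X in _ * X = _]/(dx u w.1 w.2); move: (dx _ _ _) => p.
  by field; rewrite x0 gt_eqF.
- have := pf_cvgM pf_yk e2; rewrite mul1r addrC; apply: pf_eq => //.
  apply: filterS (pf_near1 pf_yk) => w xa; rewrite subrK.
  by rewrite mulrCA; congr (_ * _); rewrite mulrC divfK.
Qed.

Hypothesis hd3 : (fun x : R => (gy (x, 1, 0) - chi * x) / x ^+ 2) @ 0^' --> d3.
Hypothesis HP : forall x y, KK x y ->
  `|F1 (x, y, 0) * F2 (x, y, 0) - ch * (x * y)| <= C * `|x * y| ^+ 3.
Let r (w : nat * V) : nat * V := (w.1, (w.2.1.1, 1, 0)).

(** Moving a point of a box to Y = 1 and e = 0 keeps it in the box, so every limit along the filter
    may be restricted to that line. *)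
Lemma pf_rr : r @ pfilter --> pfilter.
Proof.
move=> A [N hN]; exists N => k z Nk ck [h1 h2 h3]; apply: hN => //; split => //=.
  by rewrite subrr normr0; apply: mulr_ge0; [exact: le_trans L1|exact: ltW (a_gt0 (k, z))].
by rewrite normr0 mulr_ge0// (le_trans ler01).
Qed.

Lemma pf_r (f : nat * V -> R) (l : R) : f @ pfilter --> l -> (f \o r) @ pfilter --> l.
Proof. by move=> fl; apply: (@cvg_comp _ _ _ r f pfilter pfilter) fl; exact: pf_rr. Qed.

(** On the line Y = 1, e = 0 the product at the end of the passage is chi gx gy, up to O(k alpha^(3
    k)). With gx = 1 + c1 X + o(X) and gy = chi X + d3 X^2 + o(X^2), division by X leaves 1 + (c1 +
    chi d3) X. Where the first coordinate returns to X, the quotient is the second coordinate. *)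
Lemma pf_base : (fun w => (xk (r w) * yk (r w) / w.2.1.1 - 1) / a w) @ pfilter --> c1 + chi * d3.
Proof.
have Xne := pf_near1 pf_X.
have X0 : (fun w => w.2.1.1) @ pfilter --> 0^'.
  have h : (fun w => w.2.1.1) @ pfilter --> (0 : R).
    have := pf_cvgM pf_X pf_a; rewrite mulr0; apply: pf_eq => //.
    by apply: nearW => w; rewrite divfK// gt_eqF// a_gt0.
  move=> A hA; have := h _ hA; apply: filterS2 Xne => w /= X0; apply.
  by apply: contraNneq X0 => ->; rewrite mul0r.
have iX : (fun w => (w.2.1.1 / a w)^-1) @ pfilter --> (1 : R).
  by rewrite -(invr1 R); apply: cvgV; [exact: oner_neq0|exact: pf_X].
have e1 := @cvg_comp _ _ _ (fun w : nat * V => w.2.1.1) _ pfilter _ _ X0 hd3.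
have e2 := pf_r pf_gya.
have dg : differentiable gx b0 by have [] := C2_C1 C2_gx.
have e3 := pf_r (pf_expand dg); rewrite gx0 gx1 in e3.
have e4 := pf_cvgD e3 (pf_cvgM pf_X (@pf_cst c1)); rewrite add0r mul1r in e4.
have na := pf_cvgM pf_na iX; rewrite mul0r in na.
have e5 := pf_cvgD (pf_cvgM (pf_cvgM (@pf_cst chi) e4) (pf_cvgM e2 iX)) 
  (pf_cvgM (pf_cvgM (@pf_cst chi) e1) pf_X).
(* The error k C (4 alpha^k)^3 of the product, divided by X alpha^k, is about 64 C k alpha^k. *)
have e6 : (fun w => (xk (r w) * yk (r w) - chi * (gx (r w).2 * gy (r w).2)) / (w.2.1.1 * a w))
    @ pfilter --> (0 : R).
  apply: (@pf_squeeze _ (fun w => C * 64 * `|n w * a w * (w.2.1.1 / a w)^-1|)); last first.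
    rewrite -(mulr0 (C * 64)); apply: cvgMr; rewrite -(normr0 R); exact: cvg_norm na.
  have rp : \forall w \near pfilter, passes (r w) by exact: (pf_rr pf_passes).
  near=> w.
  have [[kk hE h1 h2] h3 _ _ _] : passes (r w) by near: w.
  have ck : ch ^+ w.1 = chi by near: w; exact: pf_chi.
  have hk := HKK kk.
  have z0 : (iter m T (r w).2).2 = 0 by rewrite iter_skew2.
  rewrite /tau normr0 addr0 in h3.
  have := @passage_product _ _ _ _ _ _ _ _ _ _ _ _ sd w.1 (iter m T (r w).2) rho
    (fun j xi ze => @hk j xi ze) rho01 z0 h1 h2 h3 HP.
  rewrite ck -/T -[iter w.1 T (iter m T (r w).2)]/(iter (r w).1 T (iter m T (r w).2)).
  rewrite -/(xk (r w)) -/(yk (r w)) -/(gx (r w).2) -/(gy (r w).2) => hh.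
  have a0 := a_gt0 w.
  have X1 : w.2.1.1 != 0.
    have : w.2.1.1 / a w != 0 by near: w; exact: Xne.
    by apply: contraNneq => ->; rewrite mul0r.
  rewrite normrM normfV ler_pdivrMr; last by rewrite normr_gt0 mulf_neq0// gt_eqF.
  apply: (le_trans hh).
  rewrite !(normrM, normfV) normr_nat (gtr0_norm a0) -/(a w) -/(n w).
  have : 0 < `|w.2.1.1| by rewrite normr_gt0.
  move: `|w.2.1.1| (a w) a0 (n w) => X av a0 nv X0'.
  rewrite le_eqVlt; apply/orP; left; apply/eqP.
  by field; rewrite !gt_eqF.
apply: pf_eq (pf_cvgD e6 e5).
  by case: chiE => ->; ring.
near=> w.
have a0 := a_gt0 w.
have X1 : w.2.1.1 != 0.
  have : w.2.1.1 / a w != 0 by near: w; exact: Xne.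
  by apply: contraNneq => ->; rewrite mul0r.
rewrite [RHS](_ : _ = (xk (r w) * yk (r w) - chi * (gx (r w).2 * gy (r w).2)) / (w.2.1.1 * a w) +
  (chi * ((gx (r w).2 - 1) / a w - (w.2.1.1 / a w * c1 + (1 - 1) / a w * D2 gx b0 +
    0 / a w * D3 gx b0) + w.2.1.1 / a w * c1) * (gy (r w).2 / a w / (w.2.1.1 / a w)) +
  chi * ((gy (r w).2 - chi * w.2.1.1) / w.2.1.1 ^+ 2) * (w.2.1.1 / a w)))//.
rewrite subrr !mul0r !addr0 subrK.
move: (xk _) (yk _) (gx _) (gy _) a0; move: (a w) => av p p' s t a0.
have chiK : chi^+2 = 1 by rewrite expr2 chi_sqr.
have -> : (p * p' / w.2.1.1 - 1) / av = (p * p' - chi ^+2 * w.2.1.1) / (w.2.1.1 * av).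
  by rewrite chiK; field; rewrite X1 gt_eqF.
by field; rewrite X1 gt_eqF.
Unshelve. all: by end_near.
Qed.

End Asymptotics.

(** * The rescaled return map *)

Section AffineRescaling.
Variable R : realType.
Local Notation V := (R * R * R)%type.
Variables (g : V -> R) (x0 x1 y0 y1 e1 s t : R).
Hypothesis Cg : C1 g.
Let phi (z : V) : V := (x0 + x1 * z.1.1, y0 + y1 * z.1.2, e1 * z.2).
Let h (z : V) := s * g (phi z) + t.

Lemma differentiable_phi z : differentiable phi z.
Proof.
apply: differentiable_pair; last first.
  by apply: differentiableM; [exact: differentiable_cst|exact: differentiable_c3].
apply: differentiable_pair; apply: differentiableD; try exact: differentiable_cst.
  by apply: differentiableM; [exact: differentiable_cst|exact: differentiable_c1].
by apply: differentiableM; [exact: differentiable_cst|exact: differentiable_c2].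
Qed.

Lemma differentiable_rescale z : differentiable h z.
Proof.
apply: differentiableD; last exact: differentiable_cst.
apply: differentiableM; first exact: differentiable_cst.
by apply: (@differentiable_comp _ _ _ _ phi g); [exact: differentiable_phi|have [] := Cg].
Qed.

Lemma derive_rescale (u z : V) :
  'D_u h z = s * 'D_((x1 * u.1.1, y1 * u.1.2, e1 * u.2) : V) g (phi z).
Proof.
have [dg _] := Cg.
have dgp y : differentiable (g \o phi) y.
  by apply: differentiable_comp; [exact: differentiable_phi|].
have -> : 'D_u h z = s * 'D_u (g \o phi) z.
  rewrite /h deriveD; last 2 first.
  - apply: diff_derivable; apply: differentiableM; [exact: differentiable_cst|exact: dgp].
  - by apply: diff_derivable; exact: differentiable_cst.
  rewrite derive_cst addr0 (_ : (fun _ => _) = s \*: (g \o phi))//.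
  by rewrite deriveZ//; apply: diff_derivable.
congr (s * _); rewrite /derive.
set f1 : R -> R := fun _ => _; set f2 : R -> R := fun _ => _.
suff -> : f1 = f2 by [].
apply/funext => l; rewrite /f1 /f2 /= /phi /=; congr (l^-1 *: (g _ - _)).
rewrite [RHS](_ : _ = (l * (x1 * u.1.1) + (x0 + x1 * z.1.1), l * (y1 * u.1.2) + (y0 + y1 * z.1.2),
  l * (e1 * u.2) + e1 * z.2))//.
by congr (_, _, _); rewrite -[_ *: _]/(_ * _); ring.
Qed.

Lemma C1_rescale : C1 h.
Proof.
split=> [z|u]; first exact: differentiable_rescale.
have -> : 'D_u h = fun z => s * 'D_((x1 * u.1.1, y1 * u.1.2, e1 * u.2) : V) g (phi z).
  by apply/funext => z; rewrite derive_rescale.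
have [_ cg] := Cg; move=> z; apply: cvgM; first exact: cvg_cst.
apply: (@continuous_comp _ _ _ phi ('D_((x1 * u.1.1, y1 * u.1.2, e1 * u.2) : V) g) z); last exact: cg.
exact: differentiable_continuous (differentiable_phi z).
Qed.

Lemma D1_rescale z : D1 h z = s * x1 * D1 g (phi z).
Proof.
have [dg _] := Cg; rewrite [D1 h z](_ : _ = 'D_((1, 0, 0) : V) h z); last by rewrite D1.unlock.
by rewrite derive_rescale deriveV3E//= !mulr0 !mul0r !addr0 mulr1 mulrA.
Qed.

Lemma D2_rescale z : D2 h z = s * y1 * D2 g (phi z).
Proof.
have [dg _] := Cg; rewrite [D2 h z](_ : _ = 'D_((0, 1, 0) : V) h z); last by rewrite D2.unlock.
by rewrite derive_rescale deriveV3E//= !mulr0 !mul0r !addr0 add0r mulr1 mulrA.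
Qed.

Lemma D3_rescale z : D3 h z = s * e1 * D3 g (phi z).
Proof.
have [dg _] := Cg; rewrite [D3 h z](_ : _ = 'D_((0, 0, 1) : V) h z); last by rewrite D3.unlock.
by rewrite derive_rescale deriveV3E//= !mulr0 !mul0r !add0r mulr1 mulrA.
Qed.

End AffineRescaling.

Lemma cont_on_affine (R : realType) (em ep c d : R) (f : R -> R) :
  cont_on em ep f -> cont_on em ep (fun e => c + d * f e).
Proof.
move=> cf x hx e e0; have d0 : 0 < `|d| + 1 by rewrite ltr_wpDl.
have [dl dl0 h] := cf x hx (e / (`|d| + 1)) (divr_gt0 e0 d0); exists dl => // y hy yx.
have := h y hy yx; rewrite ltr_pdivlMr// => h'.
rewrite opprD addrACA subrr add0r -mulrBr normrM; apply: le_lt_trans h'.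
by rewrite mulrC ler_wpM2l// lerDl.
Qed.

Section ReturnBranch.
Variable R : realType.
Local Notation V := (R * R * R)%type.
Variables (F1 F2 : V -> R) (al ch chi : R) (KK : R -> R -> Prop).
Variables (la si la' si' : R -> R) (E C : R).
Hypothesis sd : saddle F1 F2 al ch KK la si la' si' E C.
Hypotheses (CF1 : C2 F1) (CF2 : C2 F2).
Variables (m : nat) (rho W : R) (k0 : nat) (om : nat -> R).
Hypothesis rho01 : 0 < rho <= 1 / 2.
Hypothesis W0 : 0 <= W.
Hypothesis omW : forall k, k%:R * `|om k| <= W * al ^+ k.
Hypothesis HKK : forall k j xi ze, (k0 <= k)%N -> (j < k)%N ->
  `|xi - 1| <= rho -> `|ze - 1| <= rho ->
  KK (al ^+ j * xi) ((ch / al) ^+ j / (ch / al) ^+ k * ze).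
Let T := skew F1 F2.
Let b0 : V := (0, 1, 0).
Let gx (z : V) := (iter m T z).1.1.
Let gy (z : V) := (iter m T z).1.2.
Let Xk (k : nat) (z : V) := (iter (k + m) T z).1.1.
Let Yk (k : nat) (z : V) := (iter (k + m) T z).1.2.
Variables c1 c2 d3 d4 d5 : R.
Hypotheses (gx0 : gx b0 = 1) (gy0 : gy b0 = 0).
Hypotheses (gy1 : D1 gy b0 = chi) (gy2 : D2 gy b0 = 0).
Hypotheses (gx1 : D1 gx b0 = c1) (gx2 : D2 gx b0 = c2).
Hypotheses (gy21 : D1 (D2 gy) b0 = d4) (gy22 : D2 (D2 gy) b0 = 2 * d5).
Hypothesis chiE : chi = 1 \/ chi = -1.
Hypotheses (cla : {for 0, continuous la'}) (csi : {for 0, continuous si'}).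
Variables Th q : R.
Hypothesis hTh : (fun k => om k * k%:R / al ^+ k) @ \oo --> Th.
Hypothesis hq : forall L, 1 <= L ->
  (fun w : nat * V => om w.1 / al ^+ w.1 * (D3 gy w.2 / gy w.2)) @ pfilter al ch chi L om --> q.
Hypothesis hd3 : (fun x : R => (gy (x, 1, 0) - chi * x) / x ^+ 2) @ 0^' --> d3.
Hypothesis HP : forall x y, KK x y ->
  `|F1 (x, y, 0) * F2 (x, y, 0) - ch * (x * y)| <= C * `|x * y| ^+ 3.
Variable Delta : R.
Hypotheses (d50 : d5 != 0) (Delta0 : 0 < Delta).
Hypothesis DeltaE : Delta = (1 - c2 - chi * d4) ^+ 2 - 4 * d5 * (d3 + chi * c1).
Hypothesis hc2 : -1 < c2 < 1 - Num.sqrt Delta / 2.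
Hypothesis hbeta : q + Th * (la' 0 / al + si' 0 / (ch / al)) = - (2 * chi * d5)^-1.

Lemma C1_Xk k : C1 (Xk k). Proof. by apply: C2_C1; have [] := C2_iter CF1 CF2 (k + m). Qed.
Lemma C1_Yk k : C1 (Yk k). Proof. by apply: C2_C1; have [] := C2_iter CF1 CF2 (k + m). Qed.

(** Rescaling turns the limits along [pfilter] into the hypotheses of [fold_flip_branch]: finitely
    many limits with a fixed tolerance hold from one common N on. Hypothesis [hbeta] says that the
    rescaled parameter derivatives of the two coordinates add up to 1 in the limit. *)
Lemma return_branch : exists (N : nat) (L : R), 0 < L /\ forall k, (N <= k)%N -> ch ^+ k = chi ->
  exists (em ep : R) (X Y : R -> R), let z e := (X e, Y e, om k * e) in
  [/\ [/\ - L <= em, em < 0, 0 < ep & ep <= L],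
      cont_on em ep X /\ cont_on em ep Y,
      forall e : R, em <= e <= ep -> [/\ `|X e / al ^+ k - 1| <= k%:R ^+ 2 * al ^+ k,
        `|Y e - 1| <= L * al ^+ k, Xk k (z e) = X e, Yk k (z e) = Y e
        & forall j, (0 < j <= k)%N -> (iter j T (iter m T (z e))).1.1 < (iter m T (z e)).1.1],
      forall e : R, em < e < ep -> [/\ 0 < 1 - jtr (Xk k) (Yk k) (z e) + jdet (Xk k) (Yk k) (z e),
        0 < 1 + jtr (Xk k) (Yk k) (z e) + jdet (Xk k) (Yk k) (z e)
        & jdet (Xk k) (Yk k) (z e) < 1]
    & 1 - jtr (Xk k) (Yk k) (z em) + jdet (Xk k) (Yk k) (z em) = 0 /\
      1 + jtr (Xk k) (Yk k) (z ep) + jdet (Xk k) (Yk k) (z ep) = 0].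
Proof.
have chi0 : chi != 0 by case: chiE => ->; rewrite ?oppr_eq0 oner_eq0.
have chi2 : chi ^+ 2 = 1 by case: chiE => ->; ring.
(* In [X = a (1 + a be psi)], [Y = 1 + a (be p + ga)] with [a = al ^+ k], the choice of
   [be] and [ga] makes [D2 Q] tend to [1 - c2 - p], which puts the fold at [p = 0]. *)
pose p0 := 1 - c2 - chi * d4; pose be := - (2 * chi * d5)^-1; pose ga := - be * p0.
have b0' : be != 0 by rewrite oppr_eq0 invr_eq0 !mulf_neq0// pnatr_eq0.
pose kap := Th * (la' 0 / al) / be.
have [t [L0 [t0 L00 branch]]] := @fold_flip_branch R c2 kap p0 Delta Delta0 hc2.
(* Large enough for [phi] to map the box of the rescaled variables into [pbox], and for [L >= 1]. *)
pose L := 1 + L0 + `|be| * L0 + `|ga|.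
have L1 : 1 <= L by rewrite /L -!addrA lerDl !addr_ge0 ?mulr_ge0 ?(ltW L00).
have [e1 e2] := pf_D1 sd CF1 CF2 rho01 L1 W0 omW HKK gx0 gy0 gy1 gy2 chiE cla csi.
have [e3 e4] := pf_D2 sd CF1 CF2 rho01 L1 W0 omW HKK gx0 gy0 gy1 gy2 gx2 gy21 gy22 chiE cla csi.
have [e5 e6] := pf_D3 sd CF1 CF2 rho01 L1 W0 omW HKK gx0 gy0 gy1 gy2 chiE cla csi hTh (hq L1).
have e7 := pf_self sd CF1 CF2 rho01 L1 W0 omW HKK gx0 gy0 gy1 gy2 chiE.
have e8 := pf_base sd CF1 CF2 rho01 L1 W0 omW HKK gx0 gy0 gy1 gy2 gx1 chiE hd3 HP.
have e10 := pf_noreturn sd CF1 CF2 rho01 L1 W0 omW HKK gx0 gy0 gy1 gy2 chiE.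
(* Limits that will be divided by [be] are taken with tolerance t |be|. *)
have tb : 0 < t * `|be| by rewrite mulr_gt0// normr_gt0.
move/cvgrPdist_le/(_ _ t0): e1 => e1; move/cvgrPdist_le/(_ _ t0): e2 => e2.
move/cvgrPdist_le/(_ _ t0): e3 => e3; move/cvgrPdist_le/(_ _ t0): e4 => e4.
move/cvgrPdist_le/(_ _ tb): e5 => e5; move/cvgrPdist_le/(_ _ tb): e6 => e6.
move/cvgrPdist_le/(_ _ tb): e8 => e8.
have [N HN] := filterI (filterI (filterI (filterI e1 e2) (filterI e3 e4)) (filterI (filterI e5 e6) (filterI e7 e8))) 
  (filterI (pf_near1 (@pf_X R F1 F2 al ch chi KK la si la' si' E C sd L om)) e10).
clear e1 e2 e3 e4 e5 e6 e7 e8 e10.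
exists (maxn N 1), L; split; first exact: lt_le_trans L1.
move=> k; rewrite geq_max => /andP[Nk k1] chk; set a := al ^+ k in HN *.
have a0 : 0 < a by rewrite exprn_gt0//; have /andP[] := sd_al sd.
have an0 := lt0r_neq0 a0.
have kR : 0 < k%:R :> R by rewrite ltr0n.
pose phi (z : V) : V := (a + a ^+ 2 * be * z.1.1, 1 + a * ga + a * be * z.1.2, om k * z.2).
pose P z := (a ^+ 2 * be)^-1 * Xk k (phi z) + - (a * be)^-1.
pose Q z := (a * be)^-1 * Yk k (phi z) + - ((a * be)^-1 + ga / be).
(* The radius k^2 alpha^k of [pbox], expressed in the variable psi. *)
pose M := k%:R ^+ 2 / `|be|.
have bn : 0 < `|be| by rewrite normr_gt0.
have M0 : 0 < M by rewrite divr_gt0// exprn_gt0.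
have box z : inbox M L0 z -> pbox al L om k (phi z).
  move=> [h1 h2 h3]; split; rewrite /phi /=.
  - rewrite -/a (_ : _ - 1 = a * be * z.1.1); last by field.
    rewrite !normrM (gtr0_norm a0) [leRHS]mulrC -mulrA [`|be| * _]mulrC; apply: ler_wpM2l; first exact: ltW.
    by move: h1; rewrite /M ler_pdivlMr.
  - rewrite -/a (_ : _ - 1 = a * (ga + be * z.1.2)); last by ring.
    rewrite normrM (gtr0_norm a0) mulrC ler_wpM2r// ?(ltW a0)//.
    apply: (le_trans (ler_normD _ _)); apply: (@le_trans _ _ (`|ga| + `|be| * L0)).
      by rewrite lerD2l normrM ler_wpM2l.
    by rewrite /L -[leRHS]addrA [leRHS]addrC [`|be| * _ + _]addrC lerDl addr_ge0// ltW.
  - rewrite normrM mulrC ler_wpM2r//; apply: (le_trans h3).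
    by rewrite /L -addrA addrAC lerDr !addr_ge0// mulr_ge0// ltW.
have DX1 z : D1 P z = D1 (Xk k) (phi z).
  by rewrite (D1_rescale _ _ _ _ _ _ _ (C1_Xk k)) mulVf ?mul1r// mulf_neq0// expf_neq0.
have DX2 z : D2 P z = D2 (Xk k) (phi z) / a.
  by rewrite (D2_rescale _ _ _ _ _ _ _ (C1_Xk k)) -/(phi z) mulrC; congr (_ * _); field; rewrite ?an0 ?b0'.
have DX3 z : D3 P z = om k / a ^+ 2 * D3 (Xk k) (phi z) / be.
  by rewrite (D3_rescale _ _ _ _ _ _ _ (C1_Xk k)) -/(phi z); move: (D3 _ _) => d; field; rewrite ?an0 ?b0'.
have DY1 z : D1 Q z = a * D1 (Yk k) (phi z).
  by rewrite (D1_rescale _ _ _ _ _ _ _ (C1_Yk k)) -/(phi z); congr (_ * _); field; rewrite ?an0 ?b0'.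
have DY2 z : D2 Q z = D2 (Yk k) (phi z).
  by rewrite (D2_rescale _ _ _ _ _ _ _ (C1_Yk k)) mulVf ?mul1r// mulf_neq0// expf_neq0.
have DY3 z : D3 Q z = om k / a * D3 (Yk k) (phi z) / be.
  by rewrite (D3_rescale _ _ _ _ _ _ _ (C1_Yk k)) -/(phi z); move: (D3 _ _) => d; field; rewrite ?an0 ?b0'.
have trE z : jtr P Q z = jtr (Xk k) (Yk k) (phi z) by rewrite /jtr DX1 DY2.
have detE z : jdet P Q z = jdet (Xk k) (Yk k) (phi z).
  rewrite /jdet DX1 DY2 DX2 DY1; congr (_ - _).
  move: (D2 _ _) (D1 _ _) => u1 u2; by field.
have hP z : inbox M L0 z -> [/\ `|P z| < M, `|D1 P z| <= t, `|D2 P z - c2| <= t & `|D3 P z - kap| <= t].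
  move=> zb; have /= [[[[f1 _] [f3 _]] [[f5 _] [f7 _]]] _] := HN k (phi z) Nk chk (box z zb).
  rewrite -iterD -/(Xk k (phi z)) in f7.
  split.
  - rewrite /P (_ : _ + _ = (Xk k (phi z) / a - 1) / (a * be)); last by field; rewrite ?an0 ?b0'.
    rewrite normrM normfV normrM (gtr0_norm a0) ltr_pdivrMr ?mulr_gt0//.
    by move: f7; rewrite /M [a * `|be|]mulrC mulrA divfK// gt_eqF.
  - by rewrite DX1 -normrN -sub0r.
  - by rewrite DX2 distrC.
  - rewrite DX3 /kap -mulrBl normrM normfV ler_pdivrMr// distrC; exact: f5.
have hQ z : inbox M L0 z -> [/\ `|D1 Q z - 1| <= t, `|D2 Q z - (1 - c2 - z.1.2)| <= t & `|D3 Q z - (1 - kap)| <= t].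
  move=> zb; have /= [[[[_ f2] [_ f4]] [[_ f6] _]] _] := HN k (phi z) Nk chk (box z zb).
  split.
  - by rewrite DY1 distrC.
  - rewrite DY2 distrC; move: f4; rewrite sub0r normrN distrC.
    rewrite (_ : chi * _ = 1 - c2 - z.1.2)//.
    rewrite -/a /phi /= (_ : (_ - 1) / a = ga + be * z.1.2); last by field.
    have hb : 2 * chi * d5 * be = -1 by rewrite /be mulrN divff// !mulf_neq0// pnatr_eq0.
    transitivity (chi * d4 + 2 * chi * d5 * be * (z.1.2 - p0)); first by rewrite /ga; ring.
    by rewrite hb /p0; ring.
  - rewrite DY3.
    have -> : 1 - kap = (q + Th * (si' 0 / (ch / al))) / be.
      rewrite /kap -[X in X - _](divff b0') -mulrBl; congr (_ / _).
      by rewrite /be -hbeta; ring.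
    by rewrite -mulrBl normrM normfV ler_pdivrMr// distrC; exact: f6.
have hB ph : `|ph| <= M -> P (ph, p0, 0) = ph -> `|Q (ph, p0, 0) - p0 - (Delta - p0 ^+ 2) / 2| <= t.
  (* The limit [pf_base] is restricted to Y = 1 and e = 0, so membership in the box may be checked
     at second coordinate 0, without comparing p0 with L0. By the choice of [ga], p = p0 corresponds
     to Y = 1. *)
  move=> hph hX; have zb : inbox M L0 (ph, 0, 0) by split=> //=; rewrite normr0 ltW.
  have /= [[_ [_ [_ f8]]] [X0 _]] := HN k (phi (ph, 0, 0)) Nk chk (box _ zb).
  move: X0; rewrite -/a mulf_eq0 invr_eq0 (negPf an0) orbF => X0.
  clear HN; pose z1 : V := (a + a ^+ 2 * be * ph, 1, 0).
  move: f8; rewrite -!iterD /= -/z1.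
  rewrite -/(Xk k z1) -/(Yk k z1) -/a.
  have z1E : phi (ph, p0, 0) = z1.
    have ge : 1 + a * ga + a * be * p0 = 1 by rewrite /ga mulNr mulrN -addrA [a * (_ * _)]mulrA addNr addr0.
    by rewrite /phi /z1 /= mulr0 ge.
  have XE : Xk k z1 = a + a ^+ 2 * be * ph.
    move: hX; rewrite /P z1E => <-; field; rewrite ?an0 ?b0'//.
  rewrite XE [_ * Yk k z1]mulrC mulfK// /Q z1E => f8.
  have -> : (a * be)^-1 * Yk k z1 + - ((a * be)^-1 + ga / be) - p0 - (Delta - p0 ^+ 2) / 2 =
     ((Yk k z1 - 1) / a - (c1 + chi * d3)) / be + ((c1 + chi * d3) / be - (Delta - p0 ^+ 2) / 2).
    by rewrite /ga; move: (Yk k z1) ((Delta - _) / 2) => u1 u2; field; rewrite ?an0 ?b0'.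
  have -> : (c1 + chi * d3) / be = (Delta - p0 ^+ 2) / 2.
    rewrite DeltaE -/p0 /be invrN invrK.
    transitivity (- (2 * d5 * (chi * c1 + chi ^+ 2 * d3))); first by ring.
    by rewrite chi2; field.
  by rewrite subrr addr0 normrM normfV ler_pdivrMr// distrC.
have [em [ep [ps [p [h1 [h2 h2'] h3 h4 [h5 h6]]]]]] := branch P Q M
  (C1_rescale _ _ _ _ _ _ _ (C1_Xk k)) (C1_rescale _ _ _ _ _ _ _ (C1_Yk k)) M0 hP hQ hB.
have L0L : L0 <= L by rewrite /L -!addrA addrCA lerDl !addr_ge0// mulr_ge0// ltW.
exists em, ep, (fun e => a + a ^+ 2 * be * ps e), (fun e => 1 + a * ga + a * be * p e) => z.
have zE e : z e = phi (ps e, p e, e) by [].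
split.
- by have [t1 t2 t3 t4] := h1; split => //; [apply: le_trans t1; rewrite lerN2|exact: le_trans L0L].
- by split; apply: cont_on_affine.
- move=> e /h3 [bx PE QE]; have [bx1 bx2 _] := box _ bx; split => //.
  + rewrite zE; transitivity (a + a ^+ 2 * be * P (ps e, p e, e)); last by rewrite PE.
    by rewrite /P; move: (Xk _ _) => u1; field; rewrite ?an0 ?b0'.
  + rewrite zE; transitivity (1 + a * ga + a * be * Q (ps e, p e, e)); last by rewrite QE.
    by rewrite /Q; move: (Yk _ _) => u1; field; rewrite ?an0 ?b0'.
  + by have /= [_ [_ nr]] := HN k (phi (ps e, p e, e)) Nk chk (box _ bx); rewrite zE; exact: nr.
- by move=> e /h4; rewrite trE detE -zE.
- by split; [have := h5|have := h6]; rewrite trE detE -zE.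
Qed.
End ReturnBranch.

(** * From the family of maps to the skew map *)

Section TaylorCoefficients.
Variables (R : realType) (U : normedModType R).

Lemma derive1_line (g : U -> R) (p u : U) (c0 c1 K d : R) : differentiable g p -> 0 < d ->
  (forall t, 0 <= t <= d -> `|g (p + t *: u) - (c0 + c1 * t)| <= K * t ^+ 2) -> 'D_u g p = c1.
Proof.
move=> dg d0 gK.
have g0 : g p = c0.
  have := gK 0; rewrite lexx ltW// => /(_ isT); rewrite scale0r addr0 expr0n/= !mulr0 addr0.
  by rewrite normr_le0 subr_eq0 => /eqP.
apply: (@derive_onesided _ _ _ _ _ d _ (K * d ^+ 2)) => //; first exact: lt0r_neq0.
move=> t /andP[t0 t1]; have := gK (t * d).
rewrite mulr_ge0 ?(ltW d0)//= ler_piMl ?(ltW d0)// => /(_ isT).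
by rewrite g0 opprD addrA [c1 * _]mulrC exprMn [t ^+ 2 * _]mulrC mulrA.
Qed.

(** Only the existence of the second derivative is used. If it differed from 2 c2 by G, then (g - c1
    t - c2 t^2) / G - t^2 / 4 would have a nonnegative derivative near 0, and the remainder would be
    at least of order t^2 instead of t^3. *)
Lemma derive2_line (g : U -> R) (p u : U) (c0 c1 c2 K d : R) :
  (forall z, differentiable g z) -> (forall z, differentiable ('D_u g) z) -> 0 < d ->
  (forall t, 0 <= t <= d -> `|g (p + t *: u) - (c0 + c1 * t + c2 * t ^+ 2)| <= K * t ^+ 3) ->
  'D_u g p = c1 /\ 'D_u ('D_u g) p = 2 * c2.
Proof.
move=> dg ddg d0 gK.
have K0 : 0 <= K.
  have := gK d; rewrite (ltW d0) lexx => /(_ isT); move/(le_trans (normr_ge0 _)).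
  by rewrite pmulr_lge0// exprn_gt0.
have g0 : g p = c0.
  have := gK 0; rewrite lexx ltW// => /(_ isT); rewrite scale0r addr0 !expr0n/= !mulr0 !addr0.
  by rewrite normr_le0 subr_eq0 => /eqP.
have g1 : 'D_u g p = c1.
  apply: (@derive1_line _ _ _ c0 c1 (`|c2| + K * d) d) => // t td; have /andP[t0 t1] := td.
  rewrite -[X in `|X|](subrK (c2 * t ^+ 2)) mulrDl addrC.
  apply: (le_trans (ler_normD _ _)); apply: lerD; first by rewrite normrM normrX (ger0_norm t0).
  rewrite -addrA -opprD; apply: (le_trans (gK _ td)).
  by rewrite exprS mulrA ler_wpM2r ?exprn_ge0// ler_wpM2l.
split=> //.
set ga := 'D_u ('D_u g) p.
apply/eqP; rewrite -subr_eq0; apply: contraT; set G := ga - _ => G0.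
have nG : 0 < `|G| by rewrite normr_gt0.
have u1 : 0 < `|u| + 1 by rewrite ltr_wpDl.
have e0 : 0 < `|G| / (4 * (`|u| + 1)) by rewrite divr_gt0// mulr_gt0.
have [dl dl0 dlP] := differentiable_littleo (ddg p) e0.
pose s := Num.min d (Num.min (dl / (2 * (`|u| + 1))) (`|G| / (8 * (K + 1)))).
have K1 : 0 < K + 1 by rewrite ltr_wpDl.
have s0 : 0 < s by rewrite !lt_min d0 !divr_gt0 ?mulr_gt0.
have sd : s <= d by rewrite ge_min lexx.
have s1 : s * (`|u| + 1) < dl.
  have : s <= dl / (2 * (`|u| + 1)) by rewrite !ge_min lexx ?orbT.
  rewrite ler_pdivlMr ?mulr_gt0// mulrCA => h.
  have : 0 < s * (`|u| + 1) by rewrite mulr_gt0.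
  move: (s * _) h => x h x0; lra.
have s2 : s * (8 * (K + 1)) <= `|G|.
  by rewrite -ler_pdivlMr ?mulr_gt0// !ge_min lexx ?orbT.
pose ph (t : R) := g (p + t *: u).
pose k : R -> R := G^-1 \*: (ph - c1 \*: id - c2 \*: (id * id)) - 4^-1 \*: (id * id).
pose k' (t : R) : R := ('D_u g (p + t *: u) - c1 - c2 * (2 * t)) / G - (2 * t) / 4.
have dk (t : R) : is_derive t 1 k (k' t).
  have h1 : is_derive t 1 ph ('D_u g (p + t *: u)).
    by apply: is_derive_line; apply: diff_derivable.
  rewrite /k /k'; move: ('D_u g _) h1 => D h1.
  by apply: is_derive_eq; rewrite /GRing.scale/=; ring.
have [|c c01 kE] := @MVT_segment R k k' 0 s (ltW s0) (fun x _ => dk x).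
  apply: continuous_subspaceT => x; apply: differentiable_continuous.
  by apply/derivable1_diffP; case: (dk x).
move: c01; rewrite in_itv/= => /andP[c00 cs].
have k'0 : 0 <= k' c.
  have cu : `|c *: u| < dl.
    rewrite normrZ (ger0_norm c00); apply: le_lt_trans s1.
    by apply: ler_pM => //; rewrite lerDl.
  have := dlP _ cu; rewrite linearZ/= -deriveE// -/ga g1 normrZ (ger0_norm c00) /k'.
  move: ('D_u g _) => D hD.
  have h : `|D - c1 - c * ga| <= c * (`|G| / 4).
    apply: (le_trans hD); rewrite mulrCA ler_wpM2l// invfM mulrA -[_ / _ * _]mulrA.
    by rewrite ler_piMr ?divr_ge0// mulrC ler_pdivrMr// mul1r lerDl.
  have -> : (D - c1 - c2 * (2 * c)) / G - 2 * c / 4 = (D - c1 - c * ga) / G + c / 2.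
    by have -> : ga = G + 2 * c2 by [rewrite /G; ring]; field.
  have : `|(D - c1 - c * ga) / G| <= c / 4.
    by rewrite normrM normfV ler_pdivrMr// -mulrA [4^-1 * _]mulrC.
  rewrite ler_norml => /andP[h' _]; move: h'; move: (_ / G) => x; lra.
have kt t : k t = G^-1 * (g (p + t *: u) - c1 * t - c2 * (t * t)) - 4^-1 * (t * t) by [].
have k0 : k 0 = G^-1 * c0 by rewrite kt scale0r addr0 g0 !(mulr0, subr0).
have ks : k s = (g (p + s *: u) - c1 * s - c2 * (s * s)) / G - s ^+ 2 / 4.
  by rewrite kt; move: (g _) => x; ring.
have kk : 0 <= k s - k 0 by rewrite kE mulr_ge0// subr0 ltW.
have hh : s ^+ 2 / 4 <= (g (p + s *: u) - (c0 + c1 * s + c2 * s ^+ 2)) / G.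
  move: kk; rewrite k0 ks -subr_ge0; congr (_ <= _); move: (g _) => x; ring.
have := gK s; rewrite (ltW s0) sd => /(_ isT) hs.
have h3 : s ^+ 2 / 4 * `|G| <= K * s ^+ 3.
  apply: le_trans hs; rewrite -ler_pdivlMr// -normfV -normrM; apply: (le_trans hh); exact: ler_norm.
have h4 : `|G| / 4 <= K * s.
  have ss : 0 < s ^+ 2 by rewrite exprn_gt0.
  rewrite -(ler_pM2l ss); move: h3; congr (_ <= _); [move: `|G| => x|]; ring.
have : K * s <= s * (K + 1) by rewrite mulrC ler_wpM2l ?(ltW s0)// lerDl.
move: s2 h4 nG; rewrite mulrCA; move: (s * (K + 1)) (K * s) `|G| => x y z; lra.
Qed.

(** The increment of g from p + s a to p + s a + s b is s times D_b g at an intermediate point,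
    where the first-order expansion of D_b g contains s times the mixed derivative. The cubic
    remainder then forces this to be c12. *)
Lemma derive_mixed_line (g : U -> R) (p a b : U) (c0 c1 c2 c11 c12 c22 K d : R) :
  (forall z, differentiable g z) -> (forall z, differentiable ('D_b g) z) -> 0 < d ->
  (forall s t r, 0 <= s <= r -> 0 <= t <= r -> r <= d ->
    `|g (p + s *: a + t *: b) - (c0 + c1 * s + c2 * t + c11 * s ^+ 2 + c12 * (s * t) + c22 * t ^+ 2)|
      <= K * r ^+ 3) ->
  'D_b g p = c2 -> 'D_a ('D_b g) p = c12.
Proof.
move=> dg ddg d0 gK g2.
have K0 : 0 <= K.
  have := gK 0 0 d; rewrite !lexx (ltW d0) => /(_ isT isT isT); move/(le_trans (normr_ge0 _)).
  by rewrite pmulr_lge0// exprn_gt0.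
have g22 : 'D_b ('D_b g) p = 2 * c22.
  apply: (proj2 (@derive2_line g p b c0 c2 c22 K d _ _ _ _)) => // t td; have /andP[t0 t1] := td.
  have := gK 0 t t; rewrite !lexx t0 t1 => /(_ isT isT isT).
  by rewrite scale0r addr0 mulr0 mul0r !expr0n/= !mulr0 !addr0.
set A := 'D_a ('D_b g) p; apply/eqP; rewrite -subr_eq0; apply: contraT; set G := A - _ => G0.
have nG : 0 < `|G| by rewrite normr_gt0.
have u1 : 0 < `|a| + `|b| + 1 by rewrite ltr_wpDl// addr_ge0.
have e0 : 0 < `|G| / (4 * (`|a| + `|b| + 1)) by rewrite divr_gt0// mulr_gt0.
have [dl dl0 dlP] := differentiable_littleo (ddg p) e0.
pose s := Num.min d (Num.min (dl / (2 * (`|a| + `|b| + 1))) (`|G| / (8 * (K + 1)))).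
have K1 : 0 < K + 1 by rewrite ltr_wpDl.
have s0 : 0 < s by rewrite !lt_min d0 !divr_gt0 ?mulr_gt0.
have sd : s <= d by rewrite ge_min lexx.
have s1 : s * (`|a| + `|b| + 1) < dl.
  have : s <= dl / (2 * (`|a| + `|b| + 1)) by rewrite !ge_min lexx ?orbT.
  rewrite ler_pdivlMr ?mulr_gt0// mulrCA => h.
  have : 0 < s * (`|a| + `|b| + 1) by rewrite mulr_gt0.
  move: (s * _) h => x h x0; lra.
have s2 : s * (8 * (K + 1)) <= `|G|.
  by rewrite -ler_pdivlMr ?mulr_gt0// !ge_min lexx ?orbT.
pose ph (t : R) := g (p + s *: a + t *: b).
pose k : R -> R := ph - (c2 + c12 * s) \*: id - c22 \*: (id * id).
pose k' (t : R) : R := 'D_b g (p + s *: a + t *: b) - (c2 + c12 * s) - c22 * (2 * t).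
have dk (t : R) : is_derive t 1 k (k' t).
  have h1 : is_derive t 1 ph ('D_b g (p + s *: a + t *: b)).
    by apply: is_derive_line; apply: diff_derivable.
  rewrite /k /k'; move: ('D_b g _) h1 => D h1.
  by apply: is_derive_eq; rewrite /GRing.scale/=; ring.
have [|c c01 kE] := @MVT_segment R k k' 0 s (ltW s0) (fun x _ => dk x).
  apply: continuous_subspaceT => x; apply: differentiable_continuous.
  by apply/derivable1_diffP; case: (dk x).
move: c01; rewrite in_itv/= => /andP[c00 cs].
have kt t : k t = g (p + s *: a + t *: b) - (c2 + c12 * s) * t - c22 * (t * t) by [].
have h0 := gK s 0 s; rewrite !lexx (ltW s0) sd in h0; have {h0} := h0 isT isT isT.
have hs := gK s s s; rewrite !lexx (ltW s0) sd in hs; have {hs} := hs isT isT isT.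
move=> hs h0.
have hk : `|k s - k 0| <= 2 * K * s ^+ 3.
  have -> : k s - k 0 = (g (p + s *: a + s *: b) - (c0 + c1 * s + c2 * s + c11 * s ^+ 2 + c12 * (s * s) + c22 * s ^+ 2))
     - (g (p + s *: a + 0 *: b) - (c0 + c1 * s + c2 * 0 + c11 * s ^+ 2 + c12 * (s * 0) + c22 * 0 ^+ 2)).
    by rewrite !kt; move: (g _) (g _) => x y; ring.
  apply: (le_trans (ler_normB _ _)); have -> : 2 * K * s ^+ 3 = K * s ^+ 3 + K * s ^+ 3 by ring.
  exact: lerD.
have hG : s * (`|G| * s) <= 2 * K * s ^+ 3 + s * (s * (`|G| / 4)).
  have ab : `|s *: a + c *: b| <= s * (`|a| + `|b| + 1).
    apply: (le_trans (ler_normD _ _)); rewrite !normrZ (gtr0_norm s0) (ger0_norm c00).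
    rewrite !mulrDr -addrA lerD2l; apply: (@le_trans _ _ (s * `|b|)); first by rewrite ler_wpM2r.
    by rewrite lerDl mulr1 ltW.
  have kc : k' c = 'D_b g (p + s *: a + c *: b) - (c2 + c12 * s) - c22 * (2 * c) by [].
  have := dlP _ (le_lt_trans ab s1); rewrite addrA linearD !linearZ/= -!deriveE// -/A g22 g2.
  move: kc; move: ('D_b g _) => D kc hD.
  have -> : s * (`|G| * s) = `|s * (s * G)| by rewrite !normrM (gtr0_norm s0) [`|G| * s]mulrC.
  have -> : s * (s * G) = (k s - k 0) - s * (k' c - s * G) by rewrite kE subr0; ring.
  apply: (le_trans (ler_normB _ _)); apply: lerD => //.
  rewrite normrM (gtr0_norm s0) ler_wpM2l ?(ltW s0)//.
  have -> : k' c - s * G = D - c2 - (s *: A + c *: (2 * c22)).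
    have aux (D' G' : R) : D' - (c2 + c12 * s) - c22 * (2 * c) - s * G' = D' - c2 - (s * (G' + c12) + c * (2 * c22)).
      by ring.
    by rewrite kc (_ : A = G + c12); [exact: aux|rewrite /G subrK].
  apply: (le_trans hD); apply: (@le_trans _ _ (`|G| / (4 * (`|a| + `|b| + 1)) * (s * (`|a| + `|b| + 1)))).
    by rewrite ler_wpM2l// ltW.
  have aux (x y : R) : 0 < y -> x / (4 * y) * (s * y) = s * (x / 4) by move=> y0; field; rewrite gt_eqF.
  by rewrite aux.
have h4 : `|G| <= 2 * K * s + `|G| / 4.
  have ss : 0 < s ^+ 2 by rewrite exprn_gt0.
  rewrite -(ler_pM2l ss); have aux (x : R) : (s * (x * s) = s ^+ 2 * x) * (2 * K * s ^+ 3 + s * (s * (x / 4)) = s ^+ 2 * (2 * K * s + x / 4)).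
    by split; ring.
  by rewrite -(aux `|G|).1 -(aux `|G|).2.
have : K * s <= s * (K + 1) by rewrite mulrC ler_wpM2l ?(ltW s0)// lerDl.
move: s2 h4 nG; rewrite mulrCA -mulrA; move: (s * (K + 1)) (K * s) `|G| => x y z; lra.
Qed.

End TaylorCoefficients.

Section Pullback.
Variables (R : realType) (U W : normedModType R) (n : nat) (Lin : W -> U).
Hypothesis linL : forall (h : R) (u z : W), Lin (h *: u + z) = h *: Lin u + Lin z.
Hypothesis dL : forall z, differentiable Lin z.

Lemma derive_pullback (G : U -> 'rV[R]_n.+1) i (u z : W) : differentiable G (Lin z) ->
  'D_u (fun z => G (Lin z) 0 i) z = ('D_(Lin u) G (Lin z)) 0 i.
Proof.
move=> dG; have dv : derivable G (Lin z) (Lin u) by exact: diff_derivable.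
apply: (@cvg_lim _ (@norm_hausdorff _ _)).
pose q (h : R) : 'rV[R]_n.+1 := h^-1 *: ((G \o shift (Lin z)) (h *: Lin u) - G (Lin z)).
have qE : (fun h : R => h^-1 *: (((fun z => G (Lin z) 0 i) \o shift z) (h *: u) - G (Lin z) 0 i))
    = (fun h => q h 0 i).
  by apply/funext => h; rewrite /q /= linL !mxE.
rewrite qE.
apply: (@cvg_comp _ _ _ q (fun M : 'rV[R]_n.+1 => M 0 i) _ (nbhs ('D_(Lin u) G (Lin z)))).
  exact: dv.
exact: coord_continuous.
Qed.

Lemma differentiable_pullback (G : U -> 'rV[R]_n.+1) i (z : W) : differentiable G (Lin z) ->
  differentiable (fun z => G (Lin z) 0 i) z.
Proof.
move=> dG; apply: (@differentiable_comp _ _ _ _ (fun z => G (Lin z)) (fun M : 'rV[R]_n.+1 => M 0 i)).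
  exact: differentiable_comp.
exact: differentiable_coord.
Qed.

(** Differentiating along u after a linear substitution amounts to differentiating along [Lin u]
    before it, so smoothness passes to the composite. *)
Lemma iter_derive_pullback (g : U -> 'rV[R]_n.+1) i s : smooth_on setT g ->
  iter_derive s (fun z => g (Lin z) 0 i) = fun z => iter_derive (map Lin s) g (Lin z) 0 i.
Proof.
move=> sg; elim: s => //= u s IH; apply/funext => z; rewrite IH.
by rewrite derive_pullback//; exact: sg.
Qed.

Lemma smooth_pullback (g : U -> 'rV[R]_n.+1) i : smooth_on setT g ->
  smooth_on setT (fun z => g (Lin z) 0 i).
Proof.
by move=> sg s z _; rewrite iter_derive_pullback//; apply: differentiable_pullback; exact: sg.
Qed.

End Pullback.

Section FamilySkew.
Variables (R : realType) (n : nat).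
Local Notation V := (R * R * R)%type.
Variables (f : 'rV[R]_n -> 'rV[R]_2 -> 'rV[R]_2) (v : 'rV[R]_n).
Hypothesis hf : smooth_family f.

Definition line_lift (z : V) : 'rV[R]_n * 'rV[R]_2 :=
  (z.2 *: v, z.1.1 *: pt 1 0 + z.1.2 *: pt 0 1).

Lemma ptE (x y : R) : pt x y = x *: pt 1 0 + y *: pt 0 1.
Proof.
apply/rowP => i; rewrite !mxE; case: ifP => _; rewrite ?(mulr1, mulr0, addr0, add0r)//.
Qed.

Definition family_x (z : V) : R := xc (f (z.2 *: v) (pt z.1.1 z.1.2)).
Definition family_y (z : V) : R := yc (f (z.2 *: v) (pt z.1.1 z.1.2)).

Lemma differentiable_scale_cst (W : normedModType R) (w : W) (h : V -> R) z :
  differentiable h z -> differentiable (fun z => h z *: w) z.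
Proof. by move=> dh; exact: differentiableZl. Qed.

Lemma line_lift_linear (h : R) (u z : V) : line_lift (h *: u + z) = h *: line_lift u + line_lift z.
Proof.
rewrite [RHS](_ : _ = (h *: (u.2 *: v) + z.2 *: v, h *: (u.1.1 *: pt 1 0 + u.1.2 *: pt 0 1) + (z.1.1 *: pt 1 0 + z.1.2 *: pt 0 1)))//.
rewrite /line_lift /=; congr (_, _); first by rewrite scalerDl scalerA.
rewrite !scalerDl scalerDr !scalerA addrACA //.
Qed.

Lemma differentiable_line_lift z : differentiable line_lift z.
Proof.
apply: differentiable_pair; first by apply: differentiable_scale_cst; exact: differentiable_c3.
by apply: differentiableD; apply: differentiable_scale_cst; [exact: differentiable_c1|exact: differentiable_c2].
Qed.

Lemma smooth_family_x : smooth_on setT family_x.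
Proof.
have := @smooth_pullback _ _ _ _ _ line_lift_linear differentiable_line_lift _ 0 hf.
by congr smooth_on; apply/funext => z; rewrite /family_x ptE.
Qed.

Lemma smooth_family_y : smooth_on setT family_y.
Proof.
have := @smooth_pullback _ _ _ _ _ line_lift_linear differentiable_line_lift _ 1 hf.
by congr smooth_on; apply/funext => z; rewrite /family_y ptE.
Qed.

Lemma xc_pt x y : xc (pt x y : 'rV[R]_2) = x. Proof. by rewrite /xc mxE. Qed.
Lemma yc_pt x y : yc (pt x y : 'rV[R]_2) = y. Proof. by rewrite /yc mxE. Qed.
Lemma pt_xc_yc (p : 'rV[R]_2) : pt (xc p) (yc p) = p.
Proof.
apply/rowP => -[[|[|]]]// h; rewrite mxE /= /xc /yc; congr (p _ _); exact: val_inj.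
Qed.

Lemma iter_skew_family k (x y e : R) : iter k (skew family_x family_y) (x, y, e) =
  (xc (iter k (f (e *: v)) (pt x y)), yc (iter k (f (e *: v)) (pt x y)), e).
Proof.
elim: k => [|k IH] /=; first by rewrite xc_pt yc_pt.
by rewrite IH /skew /family_x /family_y /= pt_xc_yc.
Qed.

End FamilySkew.

Lemma near0_norm (R : realType) (W : normedModType R) (P : W -> Prop) : (\forall x \near (0 : W), P x) ->
  exists2 d : R, 0 < d & forall x, `|x| < d -> P x.
Proof.
move=> /nbhs_normP[d d0 h]; exists d => // x xd; apply: h => /=.
by rewrite sub0r normrN.
Qed.

(** * A region of the normal form that contains the passage *)

Section SaddleHull.
Variables (R : realType) (N : set 'rV[R]_2) (s0 : R).
Hypotheses (Nopen : open N) (Nconvex : convex_set (N : set (convex_lmodType 'rV[R]_2))).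
Hypotheses (N0 : N (pt 0 0)) (N1 : N (pt 1 0)) (Na : N (pt 0 (1 / s0))) (Nb : N (pt 0 (1 / s0 ^+ 2))).

Lemma convex_mem (t : R) (x y : 'rV[R]_2) : 0 <= t <= 1 -> N x -> N y ->
  N (t *: x + (1 - t) *: y).
Proof.
move=> /andP[t0 t1] Nx Ny.
have := Nconvex (Itv01 t0 t1) (mem_set (Nx : (N : set (convex_lmodType 'rV[R]_2)) x)) (mem_set Ny).
by move/set_mem.
Qed.

Lemma pt00 : pt 0 0 = 0 :> 'rV[R]_2.
Proof. by apply/rowP => i; rewrite !mxE; case: ifP. Qed.

Lemma subconvex_mem (s t : R) (x y : 'rV[R]_2) : 0 <= s -> 0 <= t -> s + t <= 1 -> N x -> N y ->
  N (s *: x + t *: y).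
Proof.
move=> s0' t0 st1 Nx Ny; have [st0|st0] := eqVneq (s + t) 0.
  have s00 : s = 0 by apply/eqP; rewrite eq_le s0' andbT -st0 lerDl.
  have t00 : t = 0 by move: st0; rewrite s00 add0r.
  by rewrite s00 t00 !scale0r addr0 -pt00.
have stp : 0 < s + t by rewrite lt_neqAle eq_sym st0 addr_ge0.
have h : N ((s / (s + t)) *: x + (1 - s / (s + t)) *: y).
  apply: convex_mem => //; apply/andP; split; first by rewrite divr_ge0// ltW.
  by rewrite ler_pdivrMr// mul1r lerDl.
have := @convex_mem (s + t) _ (pt 0 0) _ h N0; rewrite (ltW stp) st1 => /(_ isT).
rewrite pt00 scaler0 addr0 scalerDr !scalerA mulrCA mulfV// mulr1.
by rewrite mulrBr mulr1 mulrCA mulfV// mulr1 addrAC subrr add0r.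
Qed.

Lemma subconvex3_mem (s t r : R) (x y z : 'rV[R]_2) : 0 <= s -> 0 <= t -> 0 <= r -> s + t + r <= 1 ->
  N x -> N y -> N z -> N (s *: x + t *: y + r *: z).
Proof.
move=> s0' t0 r0 str1 Nx Ny Nz; have [st0|st0] := eqVneq (s + t) 0.
  have s00 : s = 0 by apply/eqP; rewrite eq_le s0' andbT -st0 lerDl.
  have t00 : t = 0 by move: st0; rewrite s00 add0r.
  rewrite s00 t00 scale0r (scale0r y) addr0; rewrite -(scale0r x); apply: subconvex_mem => //.
  by move: str1; rewrite s00 t00 !add0r.
have stp : 0 < s + t by rewrite lt_neqAle eq_sym st0 addr_ge0.
have -> : s *: x + t *: y = (s + t) *: ((s / (s + t)) *: x + (t / (s + t)) *: y).
  by rewrite scalerDr !scalerA ![(s + t) * _]mulrC !divfK.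
apply: subconvex_mem => //; first exact: ltW.
apply: subconvex_mem => //; rewrite ?divr_ge0// ?(ltW stp)//.
by rewrite -mulrDl divff.
Qed.

(* The convex hull of (0, 0), (1, 0), (0, 1 / s0), (0, 1 / s0^2), dilated by [1 + eta]. *)
Definition saddle_hull (eta x y : R) := 0 <= x /\ exists p q : R,
  [/\ 0 <= p, 0 <= q, x + p + q <= 1 + eta & y = p / s0 + q / s0 ^+ 2].

(** Openness of N at the three vertices other than the origin leaves room for a small dilation;
    convexity gives the rest. *)
Lemma saddle_hull_sub : exists2 eta : R, 0 < eta <= 1 & forall x y, saddle_hull eta x y -> N (pt x y).
Proof.
have near_dilate (w : 'rV[R]_2) : N w -> \forall eta \near (0 : R), N ((1 + eta) *: w).
  move=> Nw; have : (fun eta : R => (1 + eta) *: w) @ (0 : R) --> w.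
    rewrite -[X in _ --> X]scale1r -[X in X *: w]addr0.
    apply: cvgZ; last exact: cvg_cst.
    by apply: cvgD; [exact: cvg_cst|exact: cvg_id].
  by move=> h; apply: h; apply: open_nbhs_nbhs.
have [d d0 dP] := near0_norm (filterI (near_dilate _ N1) (filterI (near_dilate _ Na) (near_dilate _ Nb))).
pose eta := Num.min 1 (d / 2).
have eta0 : 0 < eta by rewrite lt_min ltr01 divr_gt0.
have [h1 [ha hb]] : N ((1 + eta) *: pt 1 0) /\ N ((1 + eta) *: pt 0 (1 / s0)) /\ N ((1 + eta) *: pt 0 (1 / s0 ^+ 2)).
  apply: dP; rewrite gtr0_norm//.
  by rewrite gt_min; apply/orP; right; rewrite ltr_pdivrMr// ltr_pMr// ltr1n.
have e1 : 0 < 1 + eta by rewrite addr_gt0.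
exists eta; first by rewrite eta0 ge_min lexx.
move=> x y [x0 [p [q [p0 q0 le ->]]]].
have h : N ((x / (1 + eta)) *: ((1 + eta) *: pt 1 0) + (p / (1 + eta)) *: ((1 + eta) *: pt 0 (1 / s0)) +
    (q / (1 + eta)) *: ((1 + eta) *: pt 0 (1 / s0 ^+ 2))).
  apply: subconvex3_mem => //; rewrite ?divr_ge0// ?(ltW e1)//.
  by rewrite -!mulrDl ler_pdivrMr// mul1r.
have -> : pt x (p / s0 + q / s0 ^+ 2) = x *: pt 1 0 + p *: pt 0 (1 / s0) + q *: pt 0 (1 / s0 ^+ 2).
  by apply/rowP => i; rewrite !mxE; case: ifP => _; rewrite ?mulr1 ?mulr0 ?addr0 ?add0r ?mul1r.
by move: h; rewrite !scalerA !divfK// gt_eqF.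
Qed.

Lemma saddle_hull_rect eta x y s t : saddle_hull eta x y -> 0 <= s <= 1 -> 0 <= t <= 1 ->
  saddle_hull eta (s * x) (t * y).
Proof.
move=> [x0 [p [q [p0 q0 le ->]]]] /andP[s0' s1] /andP[t0 t1]; split; first exact: mulr_ge0.
exists (t * p), (t * q); split; rewrite ?mulr_ge0//; last by rewrite mulrDr !mulrA.
apply: le_trans le; apply: lerD; last by rewrite ler_piMl.
by apply: lerD; rewrite ler_piMl.
Qed.

Lemma saddle_hull_bound eta x y : 0 < eta <= 1 -> saddle_hull eta x y ->
  `|x| <= 2 * (1 + `|s0^-1| + `|s0^-1 ^+ 2|) /\ `|y| <= 2 * (1 + `|s0^-1| + `|s0^-1 ^+ 2|).
Proof.
move=> /andP[e0 e1] [x0 [p [q [p0 q0 le ->]]]].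
have le2 : x + p + q <= 2 by apply: (le_trans le); rewrite -[leRHS]/(1 + 1 : R) lerD2l.
rewrite -exprVn; set A := s0^-1.
have x2 : x <= 2 by apply: le_trans le2; rewrite -addrA lerDl addr_ge0.
have p2 : p <= 2 by apply: le_trans le2; rewrite addrAC lerDr addr_ge0.
have q2 : q <= 2 by apply: le_trans le2; rewrite lerDr addr_ge0.
split.
  rewrite ger0_norm//; apply: (le_trans x2); rewrite ler_peMr// -addrA lerDl addr_ge0//.
apply: (le_trans (ler_normD _ _)); rewrite !normrM (ger0_norm p0) (ger0_norm q0).
rewrite mulrDr mulrDr; apply: lerD; last by rewrite -normrM ler_wpM2r.
apply: (@le_trans _ _ (2 * `|A|)); first by rewrite ler_wpM2r.
by rewrite lerDr mulr1.
Qed.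

End SaddleHull.

(** When i steps remain, y = ze / (ch / al)^i. Its sign may alternate, so odd i uses the vertex 1 /
    s0 with weight al^(i - 1) ze and even i the vertex 1 / s0^2 with weight al^(i - 2) ze. The
    weights of x and y sum to at most 1 + eta because numbers a, b of [0, 1] satisfy a + b <= 1 + a
    b, and here a b is small once k is large; the 2 in the bound on k pays for the shifted
    exponent. *)
Lemma saddle_hull_orbit (R : realType) (al ch eta : R) : 0 < al < 1 -> ch = 1 \/ ch = -1 -> 0 < eta <= 1 ->
  exists k0, forall k j xi ze, (k0 <= k)%N -> (j < k)%N ->
  `|xi - 1| <= eta / 4 -> `|ze - 1| <= eta / 4 ->
  saddle_hull (ch / al) eta (al ^+ j * xi) ((ch / al) ^+ j / (ch / al) ^+ k * ze).
Proof.
move=> /andP[al0 al1] chE /andP[e0 e1].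
have s0n : ch / al != 0 by rewrite mulf_neq0 ?invr_eq0 ?(gt_eqF al0)//; case: chE => ->; rewrite ?oppr_eq0 oner_eq0.
have s2 : (ch / al) ^+ 2 = al ^- 2 by rewrite expr_div_n; case: chE => ->; rewrite ?sqrrN expr1n mul1r.
have s2V : ((ch / al) ^+ 2)^-1 = al ^+ 2 by rewrite s2 invrK.
have : (fun k => al ^+ k) @ \oo --> (0 : R) by apply: cvg_expr; rewrite ger0_norm// ltW.
move=> /cvgrPdist_lt/(_ (eta / 4)) []; first by rewrite divr_gt0.
move=> M _ hM; exists (M + 2)%N => k j xi ze Mk jk hxi hze.
have aM (i : nat) : (M <= i)%N -> al ^+ i <= eta / 4.
  move=> Mi; have := hM i Mi; rewrite /= sub0r normrN gtr0_norm ?exprn_gt0//; exact: ltW.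
have xi0 : 0 <= xi <= 1 + eta / 4 by move: hxi; rewrite ler_norml => /andP[]; move=> ? ?; apply/andP; split; lra.
have ze0 : 0 <= ze <= 1 + eta / 4 by move: hze; rewrite ler_norml => /andP[]; move=> ? ?; apply/andP; split; lra.
have mix (i : nat) : (M <= j + i)%N -> al ^+ j * xi + al ^+ i * ze <= 1 + eta.
  move=> /aM hji; have aj : 0 <= al ^+ j <= 1 by rewrite exprn_ge0 ?exprn_ile1 ?ltW.
  have ai : 0 <= al ^+ i <= 1 by rewrite exprn_ge0 ?exprn_ile1 ?ltW.
  rewrite exprD in hji; move: (al ^+ j) (al ^+ i) aj ai hji xi0 ze0 => a b aj ai hab xi0 ze0.
  have h1 : a * xi + b * ze <= (a + b) * (1 + eta / 4) by nra.
  have h2 : a + b <= 1 + eta / 4 by nra.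
  by nra.
split.
  by apply: mulr_ge0; [rewrite exprn_ge0// ltW|case/andP: xi0].
have kj : k = (j + (k - j))%N by rewrite subnKC// ltnW.
have -> : (ch / al) ^+ j / (ch / al) ^+ k = ((ch / al) ^+ (k - j))^-1.
  by rewrite {1}kj exprD invfM mulrA divff ?mul1r// expf_neq0.
have i1 : (0 < k - j)%N by rewrite subn_gt0.
have Mk' : (M + 2 <= j + (k - j))%N by rewrite -kj.
move: (k - j)%N i1 Mk' => i i1 Mk'; clear kj jk Mk.
have [io|ie] := boolP (odd i).
- exists (al ^+ i.-1 * ze), 0; split => //; first by rewrite mulr_ge0 ?exprn_ge0 ?(ltW al0)//; case/andP: ze0.
    by rewrite addr0; apply: mix; clear - i1 Mk' io; lia.
  rewrite mul0r addr0 [in LHS](_ : i = (i.-1./2.*2 + 1)%N); last by clear - i1 Mk' io; lia.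
  rewrite exprD expr1 -mul2n exprM s2 invfM -exprVn invrK -exprM.
  rewrite (_ : (2 * i.-1./2)%N = i.-1); last by clear - i1 Mk' io; lia.
  by rewrite mulrAC.
- exists 0, (al ^+ (i - 2) * ze); split => //; first by rewrite mulr_ge0 ?exprn_ge0 ?(ltW al0)//; case/andP: ze0.
    by rewrite addr0; apply: mix; clear - i1 Mk' ie; lia.
  rewrite mul0r add0r s2V [in LHS](_ : i = (2 * i./2)%N); last by clear - i1 Mk' ie; lia.
  rewrite exprM s2 -exprVn invrK -exprM.
  rewrite mulrAC -exprD; congr (_ ^+ _ * _); clear - i1 Mk' ie; lia.
Qed.

(** * Estimates for one coordinate of the normal form *)

Section SaddleHalf.
Variable R : realType.
Local Notation V := (R * R * R)%type.
Variables (F : V -> R) (a b : V) (KK NN : R -> R -> Prop) (lam a1 : R -> R) (CT B La E0 dl x1 y1 : R).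
Let P (s t e : R) : V := s *: a + t *: b + e *: ((0, 0, 1) : V).
Hypothesis sF : smooth_on setT F.
Hypothesis Pbox : forall B0 s t e, `|s| <= B0 -> `|t| <= B0 -> `|e| <= 1 -> 
  inbox (B0 + 1) (B0 + 1) (P s t e).
Hypothesis KB : forall x y, KK x y -> `|x| <= B /\ `|y| <= B.
Hypothesis Kr : forall x y s t, KK x y -> 0 <= s <= 1 -> 0 <= t <= 1 -> KK (s * x) (t * y).
Hypothesis KN : forall x y, KK x y -> NN x y.
Hypotheses (dl0 : 0 < dl) (Ndl : NN dl dl).
Hypotheses (K1 : KK x1 y1) (x10 : x1 != 0) (y10 : y1 != 0).
Hypothesis E00 : 0 < E0 <= 1.
Hypothesis Fform : forall e x y, `|e| < E0 -> NN x y -> exists2 r : R, `|r| <= CT * (x ^+ 2 * y ^+ 2) &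
  F (P x y e) = lam e * x * (1 + a1 e * (x * y) + r).
Hypothesis lamB : forall e, `|e| < E0 -> `|lam e| <= La.
Let l (e : R) := 'D_a F (P 0 0 e).
Let l' (e : R) := D3 ('D_a F) (P 0 0 e).

(* [a1] need not be continuous: [lam * a1] is bounded by solving the expansion for it
   at the single point [(dl, dl)]. *)
Lemma saddle_remainder_bound : exists2 C : R, 0 < C & forall e x y, `|e| < E0 -> KK x y ->
  `|F (P x y e) - lam e * x| <= C * (x ^+ 2 * `|y|).
Proof.
have cF : continuous F by move=> z; apply: differentiable_continuous; exact: (sF [::]).
have [M M0 MP] := continuous_box_bounded (`|dl| + 1) cF.
have [E0p E01] := andP E00.
have La0 : 0 <= La by apply: le_trans (lamB (e := 0) _); rewrite ?normr0.
have CT0 : 0 <= CT.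
  have [|r h _] := Fform (e := 0) _ Ndl; first by rewrite normr0.
  move: (le_trans (normr_ge0 _) h); rewrite pmulr_lge0// mulr_gt0// exprn_gt0//.
pose A := (M + La * dl + La * dl * (CT * (dl ^+ 2 * dl ^+ 2))) / dl ^+ 3.
have aB e : `|e| < E0 -> `|lam e * a1 e| <= A.
  move=> eE; have [r h FE] := Fform eE Ndl.
  have FM : `|F (P dl dl e)| <= M.
    by apply: MP; apply: Pbox; rewrite ?ler_norm ?normr_id// ?(le_trans (ltW eE)).
  have lB := lamB eE.
  have -> : lam e * a1 e = (F (P dl dl e) - lam e * dl - lam e * dl * r) / dl ^+ 3.
    by rewrite FE; field; rewrite gt_eqF.
  rewrite normrM normfV normrX (gtr0_norm dl0); apply: ler_wpM2r.
    by rewrite invr_ge0 exprn_ge0// ltW.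
  apply: (le_trans (ler_normB _ _)); apply: lerD.
    apply: (le_trans (ler_normB _ _)); apply: lerD => //.
    by rewrite normrM (gtr0_norm dl0) ler_wpM2r// ltW.
  rewrite !normrM (gtr0_norm dl0); apply: ler_pM => //; first by rewrite mulr_ge0// ltW.
  by rewrite ler_wpM2r// ltW.
have B0 : 0 <= B by have [h _] := KB K1; exact: le_trans h.
have A0 : 0 <= A by apply: le_trans (aB 0 _); rewrite ?normr0.
exists (A + La * CT * B ^+ 2 + 1).
  by rewrite ltr_wpDl// addr_ge0// mulr_ge0 ?mulr_ge0 ?exprn_ge0.
move=> e x y eE Kxy; have [r h ->] := Fform eE (KN Kxy); have [xB yB] := KB Kxy.
have -> : lam e * x * (1 + a1 e * (x * y) + r) - lam e * x = lam e * a1 e * (x ^+ 2 * y) + lam e * x * r by ring.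
apply: (le_trans (ler_normD _ _)); rewrite !mulrDl; rewrite -[leRHS]addrA; apply: lerD.
  rewrite normrM [`|_ * y|]normrM normrX real_normK ?num_real//.
  apply: ler_wpM2r; first by rewrite mulr_ge0 ?sqr_ge0.
  exact: aB.
apply: (@le_trans _ _ (La * CT * B ^+ 2 * (x ^+ 2 * `|y|))); last first.
  by rewrite lerDl mul1r mulr_ge0// sqr_ge0.
rewrite !normrM.
apply: (@le_trans _ _ (La * `|x| * (CT * (x ^+ 2 * y ^+ 2)))).
  by apply: ler_pM => //; apply: ler_wpM2r => //; exact: lamB.
rewrite -(real_normK (num_real y)).
have -> : La * `|x| * (CT * (x ^+ 2 * `|y| ^+ 2)) = La * CT * (x ^+ 2 * `|y|) * (`|x| * `|y|) by ring.
have -> : La * CT * B ^+ 2 * (x ^+ 2 * `|y|) = La * CT * (x ^+ 2 * `|y|) * (B * B) by ring.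
apply: ler_wpM2l.
  by apply: mulr_ge0; [exact: mulr_ge0|apply: mulr_ge0 => //; exact: sqr_ge0].
exact: ler_pM.
Qed.

(** Written for arbitrary directions a and b, so that it serves the first coordinate and, with the
    axes exchanged, the second. It identifies the eigenvalue with a derivative of F at the origin of
    the plane, which makes it smooth along the parameter line. *)
Lemma saddle_half : exists C E : R, [/\ 0 < C, 0 < E <= E0,
  forall e, `|e| < E -> [/\ lam e = l e, `|l e - l 0| <= C * `|e| & `|l' e| <= C],
  forall e x y, `|e| < E -> KK x y -> `|F (P x y e) - l e * x| <= C * (x ^+ 2 * `|y|)
  & forall e x y, `|e| < E -> KK x y -> x != 0 -> y != 0 ->
    [/\ `|'D_a F (P x y e) - l e| <= C * `|x * y|,
        `|'D_b F (P x y e)| <= C * x ^+ 2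
      & `|D3 F (P x y e) - x * l' e| <= C * (x ^+ 2 * `|y|)]].
Proof.
have sums (p q r t : R) : 0 <= p -> 0 <= q -> 0 <= r -> 0 <= t ->
    [/\ p <= p + q + r + t, q <= p + q + r + t, r <= p + q + r + t & t <= p + q + r + t].
  by move=> p0 q0 r0 t0; split; lra.
have [C1 C10 HC1] := saddle_remainder_bound; have [E0p E01] := andP E00.
have [C2 C20 HC2] := saddle_bounds sF E01 (Pbox (B0 := B)) KB Kr HC1.
(* [saddle_bounds] speaks of points off the axes, so one such point of the region is needed for each
   e. *)
have lE e : `|e| < E0 -> lam e = l e by move=> eE; have [] := HC2 _ _ _ eE K1 x10 y10.
have dDa : differentiable ('D_a F) (P 0 0 0) by exact: (sF [:: a]).
have [d d0 dP] := differentiable_littleo dDa ltr01.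
have c3 : continuous (D3 ('D_a F)).
  by rewrite D3.unlock => z; apply: differentiable_continuous; exact: (sF [:: (0, 0, 1); a]).
have [C3 C30 HC3] := continuous_box_bounded (0 + 1) c3.
pose D := `|D3 ('D_a F) (P 0 0 0)|.
exists (C1 + C2 + C3 + (D + 1)), (Num.min E0 d).
have D0 : 0 <= D by exact: normr_ge0.
have [c1 c2 c3' c4] : [/\ C1 <= C1 + C2 + C3 + (D + 1), C2 <= C1 + C2 + C3 + (D + 1),
    C3 <= C1 + C2 + C3 + (D + 1) & D + 1 <= C1 + C2 + C3 + (D + 1)].
  by apply: sums; rewrite ?addr_ge0// ltW.
split.
- by rewrite (lt_le_trans C10).
- by rewrite lt_min E0p d0 ge_min lexx.
- move=> e; rewrite lt_min => /andP[eE ed]; split; first exact: lE.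
  + have cn : `|(0, 0, e) : V| = `|e| by rewrite !prod_normE/= normr0 /Num.max ltxx; case: ltP => //; rewrite normr_le0 => /eqP ->; rewrite normr0.
    have Pe : P 0 0 e = P 0 0 0 + (0, 0, e).
      rewrite /P !scale0r !add0r.
      by rewrite -[e *: _]/((e * 0, e * 0, e * 1) : V) !mulr0 mulr1.
    have := dP (0, 0, e); rewrite cn mul1r -Pe => /(_ ed).
    have -> : 'd ('D_a F) (P 0 0 0) ((0, 0, e) : V) = e * D3 ('D_a F) (P 0 0 0).
      rewrite -(@deriveE _ _ _ ('D_a F) (P 0 0 0) ((0, 0, e) : V))//.
      by rewrite (@deriveV3E _ ('D_a F))//= !mul0r !add0r.
    rewrite -/(l e) -/(l 0) => h.
    rewrite -[l e - l 0](subrK (e * D3 ('D_a F) (P 0 0 0))).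
    apply: (le_trans (ler_normD _ _)); apply: le_trans (_ : (D + 1) * `|e| <= _); last exact: ler_wpM2r.
    by rewrite mulrDl mul1r addrC; apply: lerD => //; rewrite normrM mulrC.
  + apply: le_trans c3'; apply: HC3; apply: Pbox; rewrite ?normr0//.
    exact: le_trans (ltW eE) E01.
- move=> e x y; rewrite lt_min => /andP[eE ed] Kxy; rewrite -lE//.
  by apply: (le_trans (HC1 _ _ _ eE Kxy)); rewrite ler_wpM2r// mulr_ge0// sqr_ge0.
- move=> e x y; rewrite lt_min => /andP[eE ed] Kxy x0 y0.
  have [_ h1 h2 h3] := HC2 _ _ _ eE Kxy x0 y0; rewrite -lE//; split.
  + by apply: (le_trans h1); rewrite ler_wpM2r.
  + by apply: (le_trans h2); rewrite ler_wpM2r// sqr_ge0.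
  + by apply: (le_trans h3); rewrite ler_wpM2r// mulr_ge0// sqr_ge0.
Qed.

End SaddleHalf.

Lemma coord3E (R : realType) (s t e : R) :
  s *: ((1, 0, 0) : R * R * R) + t *: ((0, 1, 0) : R * R * R) + e *: ((0, 0, 1) : R * R * R) = (s, t, e).
Proof.
rewrite [LHS](_ : _ = (s * 1 + t * 0 + e * 0, s * 0 + t * 1 + e * 0, s * 0 + t * 0 + e * 1))//.
by rewrite !mulr0 !mulr1 !addr0 !add0r.
Qed.

Lemma coord3E' (R : realType) (s t e : R) :
  s *: ((0, 1, 0) : R * R * R) + t *: ((1, 0, 0) : R * R * R) + e *: ((0, 0, 1) : R * R * R) = (t, s, e).
Proof. by rewrite -(coord3E t s e) [_ + t *: _]addrC. Qed.

(** The left-hand side is (1 + a u + r) (1 - a u + s) - 1: with a_1 + b_1 = 0 the terms linear in u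
    = x y cancel. *)
Lemma product_form_bound (R : realType) (a u r s CT U : R) : `|u| <= U -> 0 <= CT ->
  `|r| <= CT * `|u| ^+ 2 -> `|s| <= CT * `|u| ^+ 2 ->
  `|r + s + a * u * s - a * u * r + r * s - a ^+ 2 * u ^+ 2| <=
    (`|a| ^+ 2 + 2 * CT + 2 * (`|a| * CT * U) + CT ^+ 2 * U ^+ 2) * `|u| ^+ 2.
Proof.
move=> uU CT0 hr hs; have U0 : 0 <= U by exact: le_trans uU.
have h1 : `|a * u * s| <= `|a| * U * (CT * `|u| ^+ 2).
  by rewrite !normrM; apply: ler_pM => //; apply: ler_wpM2l.
have h2 : `|a * u * r| <= `|a| * U * (CT * `|u| ^+ 2).
  by rewrite !normrM; apply: ler_pM => //; apply: ler_wpM2l.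
have h3 : `|r * s| <= CT * U ^+ 2 * (CT * `|u| ^+ 2).
  rewrite normrM; apply: ler_pM => //; apply: (le_trans hr); apply: ler_wpM2l => //.
  by rewrite !expr2; apply: ler_pM.
have h4 : `|a ^+ 2 * u ^+ 2| <= `|a| ^+ 2 * `|u| ^+ 2 by rewrite normrM !normrX.
have -> : (`|a| ^+ 2 + 2 * CT + 2 * (`|a| * CT * U) + CT ^+ 2 * U ^+ 2) * `|u| ^+ 2 =
  CT * `|u| ^+ 2 + CT * `|u| ^+ 2 + `|a| * U * (CT * `|u| ^+ 2) + `|a| * U * (CT * `|u| ^+ 2) +
  CT * U ^+ 2 * (CT * `|u| ^+ 2) + `|a| ^+ 2 * `|u| ^+ 2 by ring.
do 2![apply: (le_trans (ler_normD _ _)); rewrite ?normrN; apply: lerD => //].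
do 2![apply: (le_trans (ler_normD _ _)); rewrite ?normrN; apply: lerD => //].
by apply: (le_trans (ler_normD _ _)); apply: lerD.
Qed.

Section LocalForm.
Variables (R : realType) (n : nat).
Local Notation V := (R * R * R)%type.
Variables (f : 'rV[R]_n -> 'rV[R]_2 -> 'rV[R]_2) (v : 'rV[R]_n).
Hypothesis hf : smooth_family f.
Variables (lambda sigma a1 b1 : 'rV[R]_n -> R) (al ch : R) (N : set 'rV[R]_2).
Hypotheses (cl : {for 0, continuous lambda}) (cs : {for 0, continuous sigma}).
Hypotheses (al01 : 0 < al < 1) (chE : ch = 1 \/ ch = -1).
Hypotheses (lambda0 : lambda 0 = al) (sigma0 : sigma 0 = ch / al).
Hypotheses (Nopen : open N) (Nconvex : convex_set (N : set (convex_lmodType 'rV[R]_2))).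
Hypotheses (N0 : N (pt 0 0)) (N1 : N (pt 1 0)).
Hypotheses (Na : N (pt 0 (1 / sigma 0))) (Nb : N (pt 0 (1 / sigma 0 ^+ 2))).
Hypothesis hT0 : local_form f lambda sigma a1 b1 N.
Hypothesis hab : a1 0 + b1 0 = 0.

Lemma near_line (P : 'rV[R]_n -> Prop) : (\forall mu \near (0 : 'rV[R]_n), P mu) ->
  exists2 d : R, 0 < d & forall e : R, `|e| < d -> P (e *: v).
Proof.
move=> /near0_norm[d d0 dP]; have v1 : 0 < `|v| + 1 by rewrite ltr_wpDl.
exists (d / (`|v| + 1)); first by rewrite divr_gt0.
move=> e; rewrite ltr_pdivlMr// => h; apply: dP; rewrite normrZ.
by apply: le_lt_trans h; rewrite ler_wpM2l// lerDl.
Qed.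

Lemma near_bounded (g : 'rV[R]_n -> R) : {for 0, continuous g} ->
  \forall mu \near (0 : 'rV[R]_n), `|g mu| <= `|g 0| + 1.
Proof.
move=> /cvgrPdist_lt/(_ 1 ltr01); apply: filterS => mu h.
have := ler_normB (g 0) (g 0 - g mu); rewrite subKr => h'; apply: (le_trans h').
by rewrite lerD2l ltW.
Qed.

Lemma local_form_saddle : exists eta E C : R, let F1 := family_x f v in let F2 := family_y f v in
  [/\ 0 < eta <= 1,
      saddle F1 F2 al ch (saddle_hull (ch / al) eta)
        (fun e => D1 F1 (0, 0, e)) (fun e => D2 F2 (0, 0, e))
        (fun e => D3 (D1 F1) (0, 0, e)) (fun e => D3 (D2 F2) (0, 0, e)) E C,
      forall e, `|e| < E -> lambda (e *: v) = D1 F1 (0, 0, e) /\ sigma (e *: v) = D2 F2 (0, 0, e)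
    & forall x y, saddle_hull (ch / al) eta x y ->
        `|F1 (x, y, 0) * F2 (x, y, 0) - ch * (x * y)| <= C * `|x * y| ^+ 3].
Proof.
have [al0 al1] := andP al01.
have s0n : ch / al != 0 by rewrite mulf_neq0 ?invr_eq0 ?(gt_eqF al0)//; case: chE => ->; rewrite ?oppr_eq0 oner_eq0.
have hN : exists2 eta : R, 0 < eta <= 1 & forall x y, saddle_hull (ch / al) eta x y -> N (pt x y).
  by apply: saddle_hull_sub; rewrite -?sigma0.
have [eta eta01 KN] := hN.
have [CT hT] := hT0.
have [d1 d10 hd1] := near_line hT.
have [d2 d20 hd2] := near_line (near_bounded cl).
have [d3 d30 hd3] := near_line (near_bounded cs).
pose E0 := Num.min 1 (Num.min d1 (Num.min d2 d3)).
have E00 : 0 < E0 <= 1 by rewrite !lt_min ltr01 d10 d20 d30 ge_min lexx.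
have E1 (e : R) : `|e| < E0 -> [/\ `|e| < d1, `|e| < d2 & `|e| < d3] by rewrite !lt_min => /and4P[].
(* A point of N off the axes, at which the unknown coefficients a1 and b1 can be bounded. *)
have [dl dl0 Ndl] : exists2 dl : R, 0 < dl & N (pt dl dl).
  have h : (fun d : R => pt d d : 'rV[R]_2) @ (0 : R) --> pt 0 0.
    rewrite [X in X @ _](_ : _ = fun d : R => d *: pt 1 1); last first.
      by apply/funext => d; apply/rowP => i; rewrite !mxE; case: ifP; rewrite mulr1.
    rewrite (_ : pt 0 0 = 0 *: pt 1 1); last by rewrite scale0r; exact: pt00.
    by apply: cvgZ; [exact: cvg_id|exact: cvg_cst].
  have [d d0 dP] := near0_norm (h N (open_nbhs_nbhs (conj Nopen N0))).
  by exists (d / 2); [rewrite divr_gt0|apply: dP; rewrite gtr0_norm ?divr_gt0// ltr_pdivrMr// ltr_pMr// ltr1n].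
pose KK := saddle_hull (ch / al) eta.
pose B : R := 2 * (1 + `|(ch / al)^-1| + `|(ch / al)^-1 ^+ 2|).
have KB x y : KK x y -> `|x| <= B /\ `|y| <= B by exact: saddle_hull_bound.
have Kr x y s t : KK x y -> 0 <= s <= 1 -> 0 <= t <= 1 -> KK (s * x) (t * y) by exact: saddle_hull_rect.
have half0 : (2^-1 : R) != 0 by rewrite invr_eq0 pnatr_eq0.
have y1n : 2^-1 / (ch / al) != 0 by rewrite mulf_neq0// invr_eq0.
have K1 : KK 2^-1 (2^-1 / (ch / al)).
  split; first by rewrite invr_ge0.
  exists 2^-1, 0; split => //; rewrite ?invr_ge0// ?mul0r ?addr0//.
  have [e0 _] := andP eta01; rewrite -[X in X + X]div1r -splitr lerDl; exact: ltW.
have box1 (B0 s t e : R) : `|s| <= B0 -> `|t| <= B0 -> `|e| <= 1 -> inbox (B0 + 1) (B0 + 1) ((s, t, e) : V).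
  move=> h1 h2 h3; have B00 : 0 <= B0 by exact: le_trans h1.
  by split => /=; [apply: (le_trans h1)|apply: (le_trans h2)|apply: (le_trans h3)]; rewrite ?lerDl ?lerDr.
have form1 e x y : `|e| < E0 -> N (pt x y) -> exists2 r : R, `|r| <= CT * (x ^+ 2 * y ^+ 2) &
    family_x f v (x, y, e) = lambda (e *: v) * x * (1 + a1 (e *: v) * (x * y) + r).
  move=> /E1[ed _ _] Nxy; have [r [s [h1 h2 h3]]] := hd1 _ ed x y Nxy.
  by exists r => //; rewrite /family_x /= h3 xc_pt.
have form2 e x y : `|e| < E0 -> N (pt y x) -> exists2 r : R, `|r| <= CT * (x ^+ 2 * y ^+ 2) &
    family_y f v (y, x, e) = sigma (e *: v) * x * (1 + b1 (e *: v) * (x * y) + r).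
  move=> /E1[ed _ _] Nxy; have [r [s [h1 h2 h3]]] := hd1 _ ed y x Nxy.
  by exists s; [rewrite mulrC [x ^+ 2 * _]mulrC mulrC|rewrite /family_y /= h3 yc_pt [y * x]mulrC].
have bx1 (B0 s t e : R) : `|s| <= B0 -> `|t| <= B0 -> `|e| <= 1 ->
    inbox (B0 + 1) (B0 + 1) (s *: ((1, 0, 0) : V) + t *: ((0, 1, 0) : V) + e *: ((0, 0, 1) : V)).
  by rewrite coord3E; exact: box1.
have fm1 (e x y : R) : `|e| < E0 -> N (pt x y) -> exists2 r : R, `|r| <= CT * (x ^+ 2 * y ^+ 2) &
    family_x f v (x *: ((1, 0, 0) : V) + y *: ((0, 1, 0) : V) + e *: ((0, 0, 1) : V)) =
    lambda (e *: v) * x * (1 + a1 (e *: v) * (x * y) + r).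
  by rewrite coord3E; exact: form1.
have lb1 (e : R) : `|e| < E0 -> `|lambda (e *: v)| <= `|lambda 0| + 1 by move=> /E1[_ h _]; exact: hd2.
have [C1 [E1' [C10 /andP[E10 E1E0] l1 F1b dF1]]] := @saddle_half R (family_x f v) (1, 0, 0) (0, 1, 0) KK (fun x y => N (pt x y))
  (fun e => lambda (e *: v)) (fun e => a1 (e *: v)) CT B (`|lambda 0| + 1) E0 dl 2^-1 (2^-1 / (ch / al))
  (smooth_family_x v hf) bx1 KB Kr KN dl0 Ndl K1 half0 y1n E00 fm1 lb1.
have box2 (B0 s t e : R) : `|s| <= B0 -> `|t| <= B0 -> `|e| <= 1 -> inbox (B0 + 1) (B0 + 1) ((t, s, e) : V).
  by move=> h1 h2; exact: box1.
have KB' x y : KK y x -> `|x| <= B /\ `|y| <= B by move=> /KB[].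
have Kr' x y s t : KK y x -> 0 <= s <= 1 -> 0 <= t <= 1 -> KK (t * y) (s * x).
  by move=> h h1 h2; exact: Kr.
have KN' x y : KK y x -> N (pt y x) by exact: KN.
have bx2 (B0 s t e : R) : `|s| <= B0 -> `|t| <= B0 -> `|e| <= 1 ->
    inbox (B0 + 1) (B0 + 1) (s *: ((0, 1, 0) : V) + t *: ((1, 0, 0) : V) + e *: ((0, 0, 1) : V)).
  by rewrite coord3E'; exact: box2.
have fm2 (e x y : R) : `|e| < E0 -> N (pt y x) -> exists2 r : R, `|r| <= CT * (x ^+ 2 * y ^+ 2) &
    family_y f v (x *: ((0, 1, 0) : V) + y *: ((1, 0, 0) : V) + e *: ((0, 0, 1) : V)) =
    sigma (e *: v) * x * (1 + b1 (e *: v) * (x * y) + r).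
  by rewrite coord3E'; exact: form2.
have lb2 (e : R) : `|e| < E0 -> `|sigma (e *: v)| <= `|sigma 0| + 1 by move=> /E1[_ _ h]; exact: hd3.
have [C2 [E2 [C20 /andP[E20 E2E0] l2 F2b dF2]]] := @saddle_half R (family_y f v) (0, 1, 0) (1, 0, 0) (fun x y => KK y x)
  (fun x y => N (pt y x)) (fun e => sigma (e *: v)) (fun e => b1 (e *: v)) CT B (`|sigma 0| + 1) E0 dl
  (2^-1 / (ch / al)) 2^-1 (smooth_family_y v hf) bx2 KB' Kr' KN' dl0 Ndl K1 y1n half0 E00 fm2 lb2.
clear Kr' KN' KB' box1 box2 bx1 bx2 fm1 fm2.
have [C3 C30 HC3] : exists2 C : R, 0 < C & forall x y, KK x y ->
    `|family_x f v (x, y, 0) * family_y f v (x, y, 0) - ch * (x * y)| <= C * `|x * y| ^+ 3.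
  pose A := `|a1 0|; pose U := B * B.
  have CT0 : 0 <= CT.
    have [|r h _] := form1 0 dl dl _ Ndl; first by rewrite normr0; case/andP: E00.
    move: (le_trans (normr_ge0 _) h); rewrite pmulr_lge0// mulr_gt0// exprn_gt0//.
  have U0 : 0 <= U by have [h _] := KB _ _ K1; apply: mulr_ge0; exact: le_trans h.
  have A0 : 0 <= A by exact: normr_ge0.
  exists (A ^+ 2 + 2 * CT + 2 * (A * CT * U) + CT ^+ 2 * U ^+ 2 + 1).
    by rewrite ltr_wpDl// !addr_ge0// ?sqr_ge0// !mulr_ge0// sqr_ge0.
  move=> x y Kxy; have Nxy := KN _ _ Kxy.
  have e0 : `|0 : R| < E0 by rewrite normr0; case/andP: E00.
  have [r h1 ->] := form1 0 x y e0 Nxy; have [s h2 ->] := form2 0 y x e0 Nxy.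
  rewrite scale0r lambda0 sigma0 (_ : b1 0 = - a1 0); last by apply/eqP; rewrite -addr_eq0 addrC hab.
  rewrite [y * x]mulrC [y ^+ 2 * _]mulrC in h2 *.
  clear l1 l2 dF1 dF2 F1b F2b.
  have [xB yB] := KB _ _ Kxy.
  set u := x * y; have uU : `|u| <= U by rewrite normrM; apply: ler_pM.
  rewrite -exprMn -/u -[u ^+ 2](real_normK (num_real u)) in h1 h2.
  have -> : al * x * (1 + a1 0 * u + r) * (ch / al * y * (1 + - a1 0 * u + s)) - ch * u =
     ch * u * (r + s + a1 0 * u * s - a1 0 * u * r + r * s - a1 0 ^+ 2 * u ^+ 2).
    by rewrite /u; field; rewrite gt_eqF.
  have chn : `|ch| = 1 by case: chE => ->; rewrite ?normrN normr1.
  rewrite normrM [`|ch * u|]normrM chn mul1r [`|u| ^+ 3]exprS [leRHS]mulrCA; apply: ler_wpM2l => //.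
  apply: (le_trans (product_form_bound (a1 0) uU CT0 h1 h2)).
  by rewrite ler_wpM2r ?exprn_ge0// lerDl.
exists eta, (Num.min E1' E2), (C1 + C2 + C3) => F1 F2.
have lam1 e : `|e| < E1' -> lambda (e *: v) = D1 F1 (0, 0, e).
  by move=> /l1[-> _ _]; rewrite coord3E D1.unlock.
have sig1 e : `|e| < E2 -> sigma (e *: v) = D2 F2 (0, 0, e).
  by move=> /l2[-> _ _]; rewrite coord3E' D2.unlock.
have c1 : C1 <= C1 + C2 + C3 by rewrite -addrA lerDl addr_ge0// ltW.
have c2 : C2 <= C1 + C2 + C3 by rewrite addrAC lerDr addr_ge0// ltW.
have c3 : C3 <= C1 + C2 + C3 by rewrite lerDr addr_ge0// ltW.
split => //.
- split => //.
  + by rewrite lt_min E10.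
  + by rewrite !addr_gt0.
  + move=> e x y; rewrite lt_min => /andP[e1 e2] Kxy; have := F1b e x y e1 Kxy.
    rewrite !coord3E D1.unlock => h; apply: (le_trans h).
    by rewrite ler_wpM2r// mulr_ge0// sqr_ge0.
  + move=> e x y; rewrite lt_min => /andP[e1 e2] Kxy; have := F2b e y x e2 Kxy.
    rewrite !coord3E' D2.unlock => h; apply: (le_trans h).
    by rewrite ler_wpM2r// mulr_ge0// sqr_ge0.
  + move=> e x y; rewrite lt_min => /andP[e1 e2] Kxy x0 y0; have := dF1 e x y e1 Kxy x0 y0.
    rewrite !coord3E D1.unlock D2.unlock => -[h1 h2 h3]; split.
    * by apply: (le_trans h1); rewrite ler_wpM2r.
    * by apply: (le_trans h2); rewrite ler_wpM2r// sqr_ge0.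
    * by apply: (le_trans h3); rewrite ler_wpM2r// mulr_ge0// sqr_ge0.
  + move=> e x y; rewrite lt_min => /andP[e1 e2] Kxy x0 y0; have := dF2 e y x e2 Kxy y0 x0.
    rewrite !coord3E' D1.unlock D2.unlock => -[h1 h2 h3]; split.
    * by rewrite [x * y]mulrC; apply: (le_trans h1); rewrite ler_wpM2r.
    * by apply: (le_trans h2); rewrite ler_wpM2r// sqr_ge0.
    * by apply: (le_trans h3); rewrite ler_wpM2r// mulr_ge0// sqr_ge0.
  + move=> e; rewrite lt_min => /andP[e1 e2]; have [le h _] := l1 e e1.
    have h0 : D1 F1 (0, 0, 0) = al by rewrite -lam1 ?normr0// scale0r.
    rewrite -h0; move: h; rewrite !coord3E D1.unlock => h; apply: (le_trans h).
    by rewrite ler_wpM2r.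
  + move=> e; rewrite lt_min => /andP[e1 e2]; have [le h _] := l2 e e2.
    have h0 : D2 F2 (0, 0, 0) = ch / al by rewrite -sig1 ?normr0// scale0r.
    rewrite -h0; move: h; rewrite !coord3E' D2.unlock => h; apply: (le_trans h).
    by rewrite ler_wpM2r.
  + move=> e; rewrite lt_min => /andP[e1 e2]; have [_ _ h] := l1 e e1.
    by move: h; rewrite !coord3E D1.unlock => h; exact: le_trans h c1.
  + move=> e; rewrite lt_min => /andP[e1 e2]; have [_ _ h] := l2 e e2.
    by move: h; rewrite !coord3E' D2.unlock => h; exact: le_trans h c2.
- by move=> e; rewrite lt_min => /andP[e1 e2]; rewrite lam1// sig1.
- move=> x y Kxy; apply: (le_trans (HC3 x y Kxy)); rewrite ler_wpM2r// exprn_ge0//.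
Qed.

End LocalForm.

(** * Derivatives of the global map at the base point *)

Section ReturnTaylor.
Variables (R : realType) (n : nat).
Local Notation V := (R * R * R)%type.
Variables (f : 'rV[R]_n -> 'rV[R]_2 -> 'rV[R]_2) (v : 'rV[R]_n).
Hypothesis hf : smooth_family f.
Variables (m : nat) (c0 c1 c2 d0 d1 d2 d3 d4 d5 : 'rV[R]_n -> R).
Hypotheses (hT1x : taylor_x f m c0 c1 c2) (hT1y : taylor_y f m d0 d1 d2 d3 d4 d5).
Let T := skew (family_x f v) (family_y f v).
Let gx (z : V) := (iter m T z).1.1.
Let gy (z : V) := (iter m T z).1.2.
Let b0 : V := (0, 1, 0).

Lemma bigO_pt_bound k (h : 'rV[R]_2 -> R) :
  (h : 'rV[R]_2 -> R^o) =O_ (nbhs (pt 0 1)) (fun p => `|p - pt 0 1| ^+ k : R^o) ->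
  exists K d : R, [/\ 0 < d, 0 <= K & forall x y r : R, `|x| <= r -> `|y| <= r -> r < d ->
    `|h (pt x (1 + y))| <= K * r ^+ k].
Proof.
move=> /eqO_exP[K K0 hK]; have /nbhs_normP[d d0' dP] := hK.
exists K, d; split => //; first exact: ltW.
move=> x y r xr yr rd.
have pn : `|pt x (1 + y) - pt 0 1| <= r.
  by apply: rv2_norm_le; rewrite !mxE/= ?subr0// addrC addKr.
have r0 : 0 <= r by exact: le_trans xr.
have := dP (pt x (1 + y)); rewrite /= distrC => /(_ (le_lt_trans pn rd)) h'.
apply: (le_trans h'); apply: ler_wpM2l; first exact: ltW.
by rewrite normrX normr_id; apply: lerXn2r; rewrite ?nnegrE.
Qed.

Lemma gxE (x y e : R) : gx (x, y, e) = xc (iter m (f (e *: v)) (pt x y)).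
Proof. by rewrite /gx iter_skew_family. Qed.

Lemma gyE (x y e : R) : gy (x, y, e) = yc (iter m (f (e *: v)) (pt x y)).
Proof. by rewrite /gy iter_skew_family. Qed.

Lemma gx_taylor : exists K d : R, [/\ 0 < d, 0 <= K & forall x y r : R, `|x| <= r -> `|y| <= r -> r < d ->
  `|gx (x, 1 + y, 0) - (c0 0 + c1 0 * x + c2 0 * y)| <= K * r ^+ 2].
Proof.
have [K [d [d0' K0 h]]] := bigO_pt_bound (nbhs_singleton hT1x).
exists K, d; split => // x y r xr yr rd; have := h x y r xr yr rd.
by rewrite gxE scale0r xc_pt yc_pt [1 + y - 1]addrAC subrr add0r.
Qed.

Lemma gy_taylor : exists K d : R, [/\ 0 < d, 0 <= K & forall x y r : R, `|x| <= r -> `|y| <= r -> r < d ->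
  `|gy (x, 1 + y, 0) - (d0 0 + d1 0 * x + d2 0 * y + d3 0 * x ^+ 2 + d4 0 * (x * y) + d5 0 * y ^+ 2)|
    <= K * r ^+ 3].
Proof.
have [K [d [d0' K0 h]]] := bigO_pt_bound (nbhs_singleton hT1y).
exists K, d; split => // x y r xr yr rd; have := h x y r xr yr rd.
by rewrite gyE scale0r xc_pt yc_pt [1 + y - 1]addrAC subrr add0r.
Qed.

Lemma C2_return : C2 gx /\ C2 gy.
Proof. by apply: C2_iter; apply: C2_smooth; [exact: smooth_family_x|exact: smooth_family_y]. Qed.

Lemma base_line (s t : R) : b0 + s *: ((1, 0, 0) : V) + t *: ((0, 1, 0) : V) = (s, 1 + t, 0).
Proof.
rewrite [LHS](_ : _ = (0 + s * 1 + t * 0, 1 + s * 0 + t * 1, 0 + s * 0 + t * 0))//.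
by rewrite !mulr0 !mulr1 !addr0 !add0r.
Qed.

Lemma gx_coefficients : [/\ gx b0 = c0 0, D1 gx b0 = c1 0 & D2 gx b0 = c2 0].
Proof.
have [[dgx _] _] := C2_return; have [K [d [dp K0 h]]] := gx_taylor.
have g0 : gx b0 = c0 0.
  have := h 0 0 0; rewrite normr0 lexx => /(_ isT isT dp).
  by rewrite expr0n/= !mulr0 !addr0 normr_le0 subr_eq0 => /eqP.
have dh : 0 < d / 2 by rewrite divr_gt0.
have hd2 : d / 2 < d by rewrite ltr_pdivrMr// ltr_pMr// ltr1n.
split => //; [rewrite D1.unlock|rewrite D2.unlock].
- apply: (@derive1_line _ _ gx b0 (1, 0, 0) (c0 0) _ K (d / 2)) => // t /andP[t0 t1].
  have := h t 0 t; rewrite normr0 ger0_norm// lexx t0 => /(_ isT isT (le_lt_trans t1 hd2)).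
  by rewrite -base_line scale0r addr0 mulr0 addr0.
- apply: (@derive1_line _ _ gx b0 (0, 1, 0) (c0 0) _ K (d / 2)) => // t /andP[t0 t1].
  have := h 0 t t; rewrite normr0 ger0_norm// lexx t0 => /(_ isT isT (le_lt_trans t1 hd2)).
  by rewrite -base_line scale0r addr0 mulr0 addr0.
Qed.

Lemma gy_coefficients : [/\ gy b0 = d0 0, D1 gy b0 = d1 0 & D2 gy b0 = d2 0] /\
  (D1 (D2 gy) b0 = d4 0 /\ D2 (D2 gy) b0 = 2 * d5 0).
Proof.
have [_ [dgy ddgy]] := C2_return; have [K [d [dp K0 h]]] := gy_taylor.
have g0 : gy b0 = d0 0.
  have := h 0 0 0; rewrite normr0 lexx => /(_ isT isT dp).
  by rewrite !expr0n/= !mulr0 !addr0 normr_le0 subr_eq0 => /eqP.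
have dh : 0 < d / 2 by rewrite divr_gt0.
have hd2 : d / 2 < d by rewrite ltr_pdivrMr// ltr_pMr// ltr1n.
have lb s t r : 0 <= s <= r -> 0 <= t <= r -> r <= d / 2 ->
    `|gy (b0 + s *: ((1, 0, 0) : V) + t *: ((0, 1, 0) : V)) -
      (d0 0 + d1 0 * s + d2 0 * t + d3 0 * s ^+ 2 + d4 0 * (s * t) + d5 0 * t ^+ 2)| <= K * r ^+ 3.
  move=> /andP[s0 sr] /andP[t0 tr] rd; rewrite base_line; apply: h.
  - by rewrite ger0_norm.
  - by rewrite ger0_norm.
  - exact: le_lt_trans hd2.
have [e1 _] : 'D_(1, 0, 0) gy b0 = d1 0 /\ 'D_(1, 0, 0) ('D_(1, 0, 0) gy) b0 = 2 * d3 0.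
  apply: (@derive2_line _ _ gy b0 _ (d0 0) _ _ K (d / 2)) => // t td; have /andP[t0 t1] := td.
  have := lb t 0 t; rewrite lexx t0 t1 lexx => /(_ isT isT isT).
  by rewrite scale0r addr0 !mulr0 expr0n/= !mulr0 !addr0.
have [e2 e22] : 'D_(0, 1, 0) gy b0 = d2 0 /\ 'D_(0, 1, 0) ('D_(0, 1, 0) gy) b0 = 2 * d5 0.
  apply: (@derive2_line _ _ gy b0 _ (d0 0) _ _ K (d / 2)) => // t td; have /andP[t0 t1] := td.
  have := lb 0 t t; rewrite lexx t0 t1 lexx => /(_ isT isT isT).
  by rewrite scale0r addr0 mulr0 mul0r !expr0n/= !mulr0 !addr0.
rewrite D1.unlock D2.unlock; split; split => //.
exact: (@derive_mixed_line _ _ gy b0 (1, 0, 0) (0, 1, 0) (d0 0) (d1 0) (d2 0) (d3 0) (d4 0) (d5 0) K (d / 2)).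
Qed.

Lemma gy_section : d0 0 = 0 -> (fun x : R => (gy (x, 1, 0) - d1 0 * x) / x ^+ 2) @ 0^' --> d3 0.
Proof.
move=> d00; have [K [d [dp K0 h]]] := gy_taylor.
apply/cvgrPdist_le => e e0.
have K1 : 0 < K + 1 by rewrite ltr_wpDl.
near=> x.
have xd : `|x| < d.
  near: x; apply: nbhs_dnbhs; apply/nbhs_normP; exists d => // x /=; by rewrite sub0r normrN.
have xe : `|x| < e / (K + 1).
  near: x; apply: nbhs_dnbhs; apply/nbhs_normP; exists (e / (K + 1)); first by rewrite /= divr_gt0.
  by move=> x /=; rewrite sub0r normrN.
have x0 : x != 0 by near: x; exact: nbhs_dnbhs_neq.
have := h x 0 `|x|; rewrite normr0 lexx normr_ge0 addr0 d00 add0r => /(_ isT isT xd).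
move: (gy _) => G hG; rewrite distrC.
have -> : (G - d1 0 * x) / x ^+ 2 - d3 0 = (G - (d1 0 * x + d2 0 * 0 + d3 0 * x ^+ 2 + d4 0 * (x * 0) + d5 0 * 0 ^+ 2)) / x ^+ 2.
  by field.
rewrite normrM normfV normrX ler_pdivrMr ?exprn_gt0 ?normr_gt0//.
apply: (le_trans hG); rewrite exprS mulrA ler_wpM2r ?exprn_ge0//.
move: xe; rewrite ltr_pdivlMr// mulrC => xe; apply: le_trans (ltW xe).
by rewrite ler_wpM2r// lerDl.
Unshelve. all: by end_near.
Qed.

End ReturnTaylor.

(** * The gradients as derivatives along the parameter line *)

Section Gradients.
Variables (R : realType) (n : nat).
Local Notation V := (R * R * R)%type.

Lemma derive_near_line (U1 U2 : normedModType R) (g1 : U1 -> R) (g2 : U2 -> R) p q u w :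
  (\forall h \near (0 : R), g1 (h *: u + p) = g2 (h *: w + q)) -> 'D_u g1 p = 'D_w g2 q.
Proof.
move=> gE; have g0 : g1 p = g2 q by have := nbhs_singleton gE; rewrite !scale0r !add0r.
rewrite /derive; set F1 := (X in lim (X @ _)); set F2 := (X in _ = lim (X @ _)).
suff -> : F1 @ 0^' = F2 @ 0^' by [].
have FE : \forall h \near 0^', F1 h = F2 h.
  by apply: nbhs_dnbhs; apply: filterS gE => h hE; rewrite /F1 /F2 /= hE g0.
apply/seteqP; split=> A hA.
  by have hA' : \forall h \near 0^', A (F1 h) := hA; change (\forall h \near 0^', A (F2 h)); apply: filterS2 FE hA' => h <-.
by have hA' : \forall h \near 0^', A (F2 h) := hA; change (\forall h \near 0^', A (F1 h)); apply: filterS2 FE hA' => h ->.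
Qed.

Lemma dot_gradient (g : 'rV[R]_n -> R) (p v : 'rV[R]_n) : differentiable g p ->
  dot (gradient g p) v = 'D_v g p.
Proof.
move=> dg; rewrite deriveE// [in RHS](row_sum_delta v) linear_sum/=.
by apply: eq_bigr => i _; rewrite linearZ/= mxE deriveE// mulrC.
Qed.

Lemma gradient_near (g h : 'rV[R]_n -> R) (p : 'rV[R]_n) : (\forall x \near p, g x = h x) ->
  gradient g p = gradient h p.
Proof. by move=> gh; apply/rowP => i; rewrite !mxE; exact: near_eq_derive. Qed.

Variables (f : 'rV[R]_n -> 'rV[R]_2 -> 'rV[R]_2) (v : 'rV[R]_n).
Hypothesis hf : smooth_family f.

Lemma differentiable_iter_family m (q : 'rV[R]_n * 'rV[R]_2) :
  differentiable (fun q : 'rV[R]_n * 'rV[R]_2 => iter m (f q.1) q.2) q.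
Proof.
have dfst (z : 'rV[R]_n * 'rV[R]_2) : differentiable fst z.
  by apply: linear_differentiable => x; exact: cvg_fst.
have dsnd (z : 'rV[R]_n * 'rV[R]_2) : differentiable snd z.
  by apply: linear_differentiable => x; exact: cvg_snd.
elim: m q => [|m IH] q /=; first exact: dsnd.
apply: (@differentiable_comp _ _ _ _ (fun q : 'rV[R]_n * 'rV[R]_2 => (q.1, iter m (f q.1) q.2))
  (fun q : 'rV[R]_n * 'rV[R]_2 => f q.1 q.2)).
  by apply: differentiable_pair; [exact: dfst|exact: IH].
exact: (hf [::]).
Qed.

(** At the base point the expansion of T_1 reduces to its constant term, so near 0 the function d0
    is the second coordinate of f^m at (0, 1). Its differentiability follows from that of the
    family. *)
Lemma tangency_gradient m (d0 d1 d2 d3 d4 d5 : 'rV[R]_n -> R) : taylor_y f m d0 d1 d2 d3 d4 d5 ->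
  D3 (fun z : V => (iter m (skew (family_x f v) (family_y f v)) z).1.2) (0, 1, 0) = dot (gradient d0 0) v.
Proof.
move=> hT; pose H (mu : 'rV[R]_n) := yc (iter m (f mu) (pt 0 1)).
have d0E : \forall mu \near (0 : 'rV[R]_n), d0 mu = H mu.
  apply: filterS hT => mu /bigO_pt_bound[K [d [dp K0 h]]].
  have := h 0 0 0; rewrite normr0 lexx => /(_ isT isT dp).
  rewrite addr0 xc_pt yc_pt subrr !expr0n/= !mulr0 !addr0 normr_le0 subr_eq0 => /eqP.
  by rewrite /H => ->.
rewrite (gradient_near d0E).
have dH : differentiable H 0.
  apply: (@differentiable_comp _ _ _ _ (fun mu : 'rV[R]_n => iter m (f mu) (pt 0 1)) (fun M : 'rV[R]_2 => M 0 1)); last exact: differentiable_coord.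
  apply: (@differentiable_comp _ _ _ _ (fun mu : 'rV[R]_n => (mu, pt 0 1 : 'rV[R]_2))
    (fun q : 'rV[R]_n * 'rV[R]_2 => iter m (f q.1) q.2)); last exact: differentiable_iter_family.
  by apply: differentiable_pair; [exact: ex_diff|exact: differentiable_cst].
rewrite dot_gradient// D3.unlock; apply: derive_near_line; near=> h.
have -> : h *: ((0, 0, 1) : V) + (0, 1, 0) = (0, 1, h).
  rewrite [LHS](_ : _ = (h * 0 + 0, h * 0 + 1, h * 1 + 0))//.
  by rewrite !mulr0 mulr1 !addr0 add0r.
by rewrite iter_skew_family addr0.
Unshelve. all: by end_near.
Qed.

Lemma eigenvalue_gradient (lambda sigma : 'rV[R]_n -> R) (E : R) : let F1 := family_x f v in let F2 := family_y f v in
  0 < E -> differentiable lambda 0 -> differentiable sigma 0 ->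
  (forall e, `|e| < E -> lambda (e *: v) = D1 F1 (0, 0, e) /\ sigma (e *: v) = D2 F2 (0, 0, e)) ->
  dot (gradient (fun mu => lambda mu * sigma mu) 0) v =
    lambda 0 * D3 (D2 F2) (0, 0, 0) + sigma 0 * D3 (D1 F1) (0, 0, 0).
Proof.
move=> F1 F2 E0 dl ds hE.
have nE : \forall h \near (0 : R), `|h| < E.
  by apply/nbhs_normP; exists E => // h /=; rewrite sub0r normrN.
have zE (h : R) : h *: ((0, 0, 1) : V) + (0, 0, 0) = (0, 0, h).
  rewrite [LHS](_ : _ = (h * 0 + 0, h * 0 + 0, h * 1 + 0))//.
  by rewrite !mulr0 mulr1 !addr0.
have el : 'D_v lambda 0 = D3 (D1 F1) (0, 0, 0).
  rewrite D3.unlock; apply: derive_near_line; apply: filterS nE => h /hE[h1 _].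
  by rewrite zE addr0.
have es : 'D_v sigma 0 = D3 (D2 F2) (0, 0, 0).
  rewrite D3.unlock; apply: derive_near_line; apply: filterS nE => h /hE[_ h1].
  by rewrite zE addr0.
have dls : differentiable (fun mu => lambda mu * sigma mu) 0 by exact: differentiableM.
rewrite dot_gradient// -el -es.
rewrite [LHS](@deriveM _ _ lambda sigma)//; exact: diff_derivable.
Qed.

End Gradients.

(** * Windows of the family *)

Section FamilyOrbit.
Variables (R : realType) (n : nat).
Local Notation V := (R * R * R)%type.
Variables (f : 'rV[R]_n -> 'rV[R]_2 -> 'rV[R]_2) (v : 'rV[R]_n).
Hypothesis hf : smooth_family f.
Let T := skew (family_x f v) (family_y f v).
Let Xp (p : nat) (z : V) := (iter p T z).1.1.
Let Yp (p : nat) (z : V) := (iter p T z).1.2.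

Lemma differentiable_iter_at p (mu : 'rV[R]_n) (z : 'rV[R]_2) : differentiable (iter p (f mu)) z.
Proof.
apply: (@differentiable_comp _ _ _ _ (fun z : 'rV[R]_2 => (mu, z))
  (fun q : 'rV[R]_n * 'rV[R]_2 => iter p (f q.1) q.2)); last exact: differentiable_iter_family.
by apply: differentiable_pair; [exact: differentiable_cst|exact: ex_diff].
Qed.

Lemma jacobian_coord (G : 'rV[R]_2 -> 'rV[R]_2) (z : 'rV[R]_2) i j : differentiable G z ->
  'J G z i j = 'D_(delta_mx 0 i) (fun w => G w 0 j) z.
Proof.
move=> dG.
rewrite (@derive_pullback _ _ _ _ (fun w : 'rV[R]_2 => w) (fun _ _ _ => erefl) G j _ z dG).
by rewrite deriveEjacobian// -rowE [RHS]mxE.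
Qed.

Lemma jacobian_skew p (x y e : R) : let J := 'J (iter p (f (e *: v))) (pt x y) in
  \tr J = jtr (Xp p) (Yp p) (x, y, e) /\ \det J = jdet (Xp p) (Yp p) (x, y, e).
Proof.
move=> J; have dG := differentiable_iter_at p (e *: v) (pt x y).
have E1 (h : R) : h *: delta_mx 0 0 + pt x y = pt (h + x) y :> 'rV[R]_2.
  by apply/rowP => -[[|[|]]]// i; rewrite !mxE/= ?mulr1 ?mulr0 ?add0r.
have E2 (h : R) : h *: delta_mx 0 1 + pt x y = pt x (h + y) :> 'rV[R]_2.
  by apply/rowP => -[[|[|]]]// i; rewrite !mxE/= ?mulr1 ?mulr0 ?add0r.
have V1 (h : R) : h *: ((1, 0, 0) : V) + (x, y, e) = (h + x, y, e).
  rewrite [LHS](_ : _ = (h * 1 + x, h * 0 + y, h * 0 + e))//.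
  by rewrite !mulr0 mulr1 !add0r.
have V2 (h : R) : h *: ((0, 1, 0) : V) + (x, y, e) = (x, h + y, e).
  rewrite [LHS](_ : _ = (h * 0 + x, h * 1 + y, h * 0 + e))//.
  by rewrite !mulr0 mulr1 !add0r.
have J00 : J 0 0 = D1 (Xp p) (x, y, e).
  rewrite /J jacobian_coord// D1.unlock; apply: derive_near_line; near=> h.
  by rewrite E1 V1 /Xp iter_skew_family.
have J01 : J 0 1 = D1 (Yp p) (x, y, e).
  rewrite /J jacobian_coord// D1.unlock; apply: derive_near_line; near=> h.
  by rewrite E1 V1 /Yp iter_skew_family.
have J10 : J 1 0 = D2 (Xp p) (x, y, e).
  rewrite /J jacobian_coord// D2.unlock; apply: derive_near_line; near=> h.
  by rewrite E2 V2 /Xp iter_skew_family.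
have J11 : J 1 1 = D2 (Yp p) (x, y, e).
  rewrite /J jacobian_coord// D2.unlock; apply: derive_near_line; near=> h.
  by rewrite E2 V2 /Yp iter_skew_family.
rewrite tr_mx22 det_mx22 J00 J01 J10 J11; split => //.
by rewrite /jdet [D1 (Yp p) _ * _]mulrC.
Unshelve. all: by end_near.
Qed.

Variables (m k : nat) (X Y e : R).
Let z : V := (X, Y, e).
Hypotheses (m1 : (1 <= m)%N) (mk : (m <= k)%N).
Hypotheses (Xfix : Xp (k + m) z = X) (Yfix : Yp (k + m) z = Y).
Hypothesis noreturn : forall j, (0 < j <= k)%N -> (iter j T (iter m T z)).1.1 < (iter m T z).1.1.

Lemma family_fixed : iter (k + m) (f (e *: v)) (pt X Y) = pt X Y.
Proof.
move: Xfix Yfix; rewrite /Xp /Yp /z iter_skew_family /= => h1 h2.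
by rewrite -[LHS]pt_xc_yc h1 h2.
Qed.

(* Along the passage near the saddle the [x]-coordinate stays below its initial
   value, which rules out a smaller period. *)
Lemma family_periodic : periodic_point (f (e *: v)) (k + m) (pt X Y).
Proof.
split; [by rewrite addn_gt0 m1 orbT|exact: family_fixed|].
set F := f (e *: v); set u := iter m F (pt X Y).
have nr j : (0 < j <= k)%N -> iter j F u <> u.
  move=> /noreturn h hj; move: h; rewrite /z -iterD !iter_skew_family /= iterD -/F -/u hj.
  by rewrite ltxx.
have up : iter (k + m) F u = u by rewrite /u -iterD addnC iterD family_fixed.
move=> j /andP[j0 jP] hj.
have hu : iter j F u = u by rewrite /u -iterD addnC iterD hj.
have [jk|kj] := leqP j k; first by apply: (nr j); rewrite ?j0.
(* If j > k, the complementary number k + m - j also fixes u; it is less than m and hence at most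
   k. *)
apply: (nr (k + m - j)%N); first by apply/andP; split; lia.
by rewrite -{1}hu -iterD subnK// ltnW.
Qed.

Lemma family_stable : let J := jtr (Xp (k + m)) (Yp (k + m)) z in
  let D := jdet (Xp (k + m)) (Yp (k + m)) z in
  0 < 1 - J + D -> 0 < 1 + J + D -> D < 1 ->
  asymptotically_stable_solution (f (e *: v)) (k + m) (pt X Y).
Proof.
move=> J D h1 h2 h3 i; apply: asymptotically_stable_iter.
- by move=> w; apply: differentiable_continuous; exact: (differentiable_iter_at 1).
- by rewrite addn_gt0 m1 orbT.
have [tE dE] := jacobian_skew (k + m) X Y e.
apply: jury_stable; rewrite ?tE ?dE//; [exact: differentiable_iter_at|exact: family_fixed].
Qed.

Lemma family_multiplier (a : R) :
  a ^+ 2 - a * jtr (Xp (k + m)) (Yp (k + m)) z + jdet (Xp (k + m)) (Yp (k + m)) z = 0 ->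
  has_multiplier (f (e *: v)) (k + m) (pt X Y) a.
Proof.
move=> h; exists 0%N; apply: eigenvalue22.
by have [-> ->] := jacobian_skew (k + m) X Y e.
Qed.

End FamilyOrbit.

Section Windows.
Variables (R : realType) (n : nat).
Local Notation V := (R * R * R)%type.
Variables (f : 'rV[R]_n -> 'rV[R]_2 -> 'rV[R]_2) (v : 'rV[R]_n).
Hypothesis hf : smooth_family f.
Let T := skew (family_x f v) (family_y f v).
Variables (m : nat) (al ch chi : R) (om : nat -> R) (rate : int -> R) (Co : R).
Hypothesis m1 : (1 <= m)%N.
Hypothesis omR : forall k : nat, `|om k| <= Co * `|rate k|.
Let Xk (k : nat) (z : V) := (iter (k + m) T z).1.1.
Let Yk (k : nat) (z : V) := (iter (k + m) T z).1.2.

(** The conclusion of [return_branch] for one k, in the rescaled parameter. *)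
Definition branch_data (L : R) (k : nat) (em ep : R) (X Y : R -> R) : Prop :=
  let z e := (X e, Y e, om k * e) in
  [/\ [/\ - L <= em, em < 0, 0 < ep & ep <= L],
      cont_on em ep X /\ cont_on em ep Y,
      forall e : R, em <= e <= ep -> [/\ `|X e / al ^+ k - 1| <= k%:R ^+ 2 * al ^+ k,
        `|Y e - 1| <= L * al ^+ k, Xk k (z e) = X e, Yk k (z e) = Y e
        & forall j, (0 < j <= k)%N -> (iter j T (iter m T (z e))).1.1 < (iter m T (z e)).1.1],
      forall e : R, em < e < ep -> [/\ 0 < 1 - jtr (Xk k) (Yk k) (z e) + jdet (Xk k) (Yk k) (z e),
        0 < 1 + jtr (Xk k) (Yk k) (z e) + jdet (Xk k) (Yk k) (z e)
        & jdet (Xk k) (Yk k) (z e) < 1]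
    & 1 - jtr (Xk k) (Yk k) (z em) + jdet (Xk k) (Yk k) (z em) = 0 /\
      1 + jtr (Xk k) (Yk k) (z ep) + jdet (Xk k) (Yk k) (z ep) = 0].

Lemma pt_cont_within (a b : R) (X Y : R -> R) : cont_on a b X -> cont_on a b Y ->
  {within `[a, b], continuous (fun e => pt (X e) (Y e) : 'rV[R]_2)}.
Proof.
move=> /cont_on_within cX /cont_on_within cY.
rewrite (_ : (fun e => _) = fun e => X e *: pt 1 0 + Y e *: pt 0 1); last first.
  by apply/funext => e; rewrite -ptE.
move=> x; apply: cvgD; apply: cvgZ; [exact: cX|exact: cvg_cst|exact: cY|exact: cvg_cst].
Qed.

(* The window in the actual parameter is the rescaled one multiplied by [om k],
   whose sign decides which end carries the saddle-node. *)
Definition window (L : R) (k : nat) (sn pd : R) (a b : R) (z : R -> 'rV[R]_2) : Prop :=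
  let F (eps : R) := f (eps *: v) in
  [/\ a < 0 < b, `|a| <= L * Co * `|rate k| /\ `|b| <= L * Co * `|rate k|,
     {within `[a, b], continuous z} /\
       forall eps, a <= eps <= b -> periodic_point (F eps) (k + m) (z eps),
     forall eps, a < eps < b -> asymptotically_stable_solution (F eps) (k + m) (z eps)
   & saddle_node (F sn) (k + m) (z sn) /\ period_doubling (F pd) (k + m) (z pd)].

Lemma branch_window L k em ep X Y : (m <= k)%N -> om k != 0 -> branch_data L k em ep X Y ->
  let z eps := pt (X (eps / om k)) (Y (eps / om k)) in
  (0 < om k -> window L k (om k * em) (om k * ep) (om k * em) (om k * ep) z) /\
  (om k < 0 -> window L k (om k * em) (om k * ep) (om k * ep) (om k * em) z).
Proof.
move=> mk o0 [[h1 h2 h3 h4] [h5 h5'] h6 h7 [h8 h9]] z.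
have oK eps : om k * (eps / om k) = eps by rewrite mulrCA divff// mulr1.
have oK' e : om k * e / om k = e by rewrite mulrAC divff// mul1r.
have L0 : 0 <= L by apply: le_trans h4; exact: ltW.
have em0 : `|em| <= L by rewrite ler_norml h1 (le_trans (ltW h2)).
have ep0 : `|ep| <= L by rewrite ler_norml h4 andbT (le_trans _ (ltW h3))// oppr_le0.
have bd e : `|e| <= L -> `|om k * e| <= L * Co * `|rate k|.
  move=> eL; rewrite normrM mulrC -mulrA; apply: ler_pM => //; exact: omR.
have per eps : em <= eps / om k <= ep -> periodic_point (f (eps *: v)) (k + m) (z eps).
  move=> he; have [_ _ e1 e2 e3] := h6 _ he; rewrite oK in e1 e2 e3.
  exact: (family_periodic m1 mk e1 e2 e3).
have st eps : em < eps / om k < ep -> asymptotically_stable_solution (f (eps *: v)) (k + m) (z eps).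
  move=> he; have he' : em <= eps / om k <= ep by case/andP: he => ? ?; rewrite !ltW.
  have [_ _ e1 e2 e3] := h6 _ he'; have [s1 s2 s3] := h7 _ he; rewrite oK in e1 e2 e3 s1 s2 s3.
  exact: (family_stable hf m1 e1 e2 s1 s2 s3).
have mult : saddle_node (f ((om k * em) *: v)) (k + m) (z (om k * em)) /\
    period_doubling (f ((om k * ep) *: v)) (k + m) (z (om k * ep)).
  rewrite /z !oK'; split; apply: family_multiplier => //.
    by rewrite expr1n mul1r.
  by rewrite sqrrN expr1n mulN1r opprK.
have cc a b : (forall eps, a <= eps <= b -> em <= eps / om k <= ep) -> {within `[a, b], continuous z}.
  move=> hab; have cd : cont_on a b (fun eps => eps / om k).
    by move=> x _ e e0; exists (e * `|om k|); [rewrite mulr_gt0// normr_gt0|move=> y _; rewrite -mulrBl normrM normfV ltr_pdivrMr ?normr_gt0].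
  by apply: pt_cont_within; apply: cont_on_comp cd hab _.
split=> [op|on].
- have op' : 0 < (om k)^-1 by rewrite invr_gt0.
  have tr1 eps : om k * em <= eps <= om k * ep -> em <= eps / om k <= ep.
    by rewrite ler_pdivlMr// ler_pdivrMr// [em * _]mulrC [ep * _]mulrC.
  have tr2 eps : om k * em < eps < om k * ep -> em < eps / om k < ep.
    by rewrite ltr_pdivlMr// ltr_pdivrMr// [em * _]mulrC [ep * _]mulrC.
  split => //.
  + by rewrite pmulr_rlt0// h2 mulr_gt0.
  + by split; apply: bd.
  + by split; [exact: cc|move=> eps /tr1; exact: per].
  + by move=> eps /tr2; exact: st.
- have tr1 eps : om k * ep <= eps <= om k * em -> em <= eps / om k <= ep.
    by rewrite ler_ndivlMr// ler_ndivrMr// [em * _]mulrC [ep * _]mulrC andbC.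
  have tr2 eps : om k * ep < eps < om k * em -> em < eps / om k < ep.
    by rewrite ltr_ndivlMr// ltr_ndivrMr// [em * _]mulrC [ep * _]mulrC andbC.
  split => //.
  + by rewrite nmulr_rlt0// h3 nmulr_rgt0.
  + by split; apply: bd.
  + by split; [exact: cc|move=> eps /tr1; exact: per].
  + by move=> eps /tr2; exact: st.
Qed.

Lemma windows_of_branches :
  (forall k, (0 < k)%N -> 0 < om k) \/ (forall k, (0 < k)%N -> om k < 0) ->
  (exists (N : nat) (L : R), 0 < L /\ forall k, (N <= k)%N -> ch ^+ k = chi ->
    exists (em ep : R) (X Y : R -> R), branch_data L k em ep X Y) ->
  stable_windows f m ch chi v rate.
Proof.
move=> osgn [N [L [L0 HL]]].
(* The sign of [om] is the same for all k > 0, so one alternative about the ends of the window holds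
   for all k at once. *)
pose sg : bool := `[< forall k, (0 < k)%N -> 0 < om k >].
(* Taking k >= m makes k positive and gives [family_periodic] its hypothesis m <= k. Outside [K] the
   triple is a placeholder. *)
have win (k : int) : exists t : R * R * (R -> 'rV[R]_2), K ch chi (maxn N m)%:Z k ->
    exists k' : nat, k = k'%:Z /\ (0 < k')%N /\
    let s := if sg then t.1.1 else t.1.2 in let p := if sg then t.1.2 else t.1.1 in
    window L k' s p t.1.1 t.1.2 t.2.
  have [[k0 chk]|nk] := pselect (K ch chi (maxn N m)%:Z k); last by exists (0, 0, fun=> 0).
  case: k k0 chk => [k'|k'] // k0 chk.
  have : (maxn N m <= k')%N by rewrite -lez_nat.
  rewrite geq_max => /andP[Nk mk].
  have kp : (0 < k')%N by exact: leq_trans mk.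
  have [em [ep [X [Y bd]]]] := HL k' Nk chk.
  have o0 : om k' != 0 by case: osgn => h; have := h _ kp; [move/lt0r_neq0|move/ltr0_neq0].
  have [w1 w2] := branch_window mk o0 bd.
  have [sgT|sgF] := boolP sg.
  - exists (om k' * em, om k' * ep, fun eps => pt (X (eps / om k')) (Y (eps / om k'))) => _.
    exists k'; split => //; split => //=; apply: w1; move: sgT => /asboolP; exact.
  - exists (om k' * ep, om k' * em, fun eps => pt (X (eps / om k')) (Y (eps / om k'))) => _.
    exists k'; split => //; split => //=; apply: w2.
    by case: osgn => [h|]; [move: sgF => /asboolP|exact].
have [t tP] := choice win.
exists (maxn N m)%:Z, (fun k => (t k).1.1), (fun k => (t k).1.2), (fun k => (t k).2) => Kmin p.
have pE (k' : nat) : p k'%:Z = (k' + m)%N by [].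
split.
- by move=> k /tP[k' [-> [kp [h _ _ _ _]]]]; split => //; rewrite -PoszD ltz_nat addn_gt0 kp.
- exists (L * Co) => k /tP[k' [-> [_ [_ h _ _ _]]]]; exact: h.
- move=> k /tP[k' [-> [_ [_ _ h _ _]]]]; rewrite pE; exact: h.
- move=> k /tP[k' [-> [_ [_ _ _ h _]]]]; rewrite pE; exact: h.
- have [sgT|sgF] := boolP sg; [left|right] => k /tP[k' [-> [_ [_ _ _ _ h]]]]; rewrite pE.
    by move: h; rewrite sgT.
  by move: h; rewrite (negPf sgF) => -[].
Qed.

End Windows.

Lemma natr_mul_geometric_le (R : realType) (a : R) (k : nat) : 0 < a < 1 -> k%:R * a ^+ k <= (1 - a)^-1.
Proof.
move=> /andP[a0 a1]; have h : 0 < 1 - a by rewrite subr_gt0.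
rewrite -[leRHS]div1r ler_pdivlMr//; suff : k%:R * a ^+ k * (1 - a) <= 1 - a ^+ k.
  by move=> hk; apply: (le_trans hk); rewrite gerBl exprn_ge0// ltW.
elim: k => [|k IH]; first by rewrite mul0r mul0r expr0 subrr.
have ak : 0 <= a ^+ k <= 1 by rewrite exprn_ge0 ?exprn_ile1// ltW.
rewrite -natr1 exprS; move: IH ak; move: (a ^+ k) (k%:R : R) => x y IH /andP[x0 x1].
have -> : (y + 1) * (a * x) * (1 - a) = a * (y * x * (1 - a)) + a * x * (1 - a) by ring.
have : a * (y * x * (1 - a)) <= a * (1 - x) by rewrite ler_wpM2l// ltW.
have : 0 <= (1 - a) * (1 - a * x) by apply: mulr_ge0; rewrite ?subr_ge0 ?mulr_ile1// ltW.
move=> t1 t2; nra.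
Qed.

Theorem theorem4p4p1 (R : realType) (n : nat)
    (f : 'rV[R]_n -> 'rV[R]_2 -> 'rV[R]_2)
    (hf : smooth_family f)
    (Omega : set 'rV[R]_n) (hOmega : open Omega) (hOmega0 : Omega 0)
    (lambda sigma : 'rV[R]_n -> R)
    (hlambda : smooth_on Omega lambda) (hsigma : smooth_on Omega sigma)
    (hfix : origin_fixed_with_eigenvalues f lambda sigma Omega)
    (alpha chi_eig chi : R)
    (halpha : 0 < alpha < 1)
    (hchi_eig : chi_eig = 1 \/ chi_eig = -1)
    (hchi : chi = 1 \/ chi = -1)
    (hlambda0 : lambda 0 = alpha) (hsigma0 : sigma 0 = chi_eig / alpha)
    (a1 b1 : 'rV[R]_n -> R)
    (N : set 'rV[R]_2) (hNopen : open N)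
    (hNconvex : convex_set (N : set (convex_lmodType 'rV[R]_2)))
    (hN0 : N (pt 0 0)) (hN1 : N (pt 1 0)) (hN2 : N (pt (lambda 0) 0))
    (hN3 : N (pt 0 (1 / sigma 0))) (hN4 : N (pt 0 (1 / sigma 0 ^+ 2)))
    (hT0 : local_form f lambda sigma a1 b1 N)
    (hab : chi_eig = -1 ->
       \forall mu \near (0 : 'rV[R]_n), a1 mu = 0 /\ b1 mu = 0)
    (m : nat) (hm : (1 <= m)%N)
    (c0 c1 c2 d0 d1 d2 d3 d4 d5 : 'rV[R]_n -> R)
    (hT1x : taylor_x f m c0 c1 c2)
    (hT1y : taylor_y f m d0 d1 d2 d3 d4 d5)
    (hc0 : c0 0 = 1) (hd0 : d0 0 = 0) (hd1 : d1 0 = chi)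
    (hd2 : d2 0 = 0) (hd5 : d5 0 <> 0)
    (hab0 : a1 0 + b1 0 = 0)
    (Delta0 : R)
    (hDelta0E : Delta0 = (1 - c2 0 - chi * d4 0) ^+ 2
                         - 4 * d5 0 * (d3 0 + chi * c1 0))
    (hDelta0 : 0 < Delta0)
    (hc2 : -1 < c2 0 < 1 - Num.sqrt Delta0 / 2)
    (n_tang n_eig : 'rV[R]_n)
    (hn_tang : n_tang = gradient d0 0)
    (hn_eig : n_eig = gradient (fun mu => lambda mu * sigma mu) 0)
    (v : 'rV[R]_n) :
  (dot n_tang v <> 0 ->
     stable_windows f m chi_eig chi v (fun k : int => alpha ^ (2 * k)))
  /\
  (dot n_tang v = 0 -> dot n_eig v <> 0 ->
     stable_windows f m chi_eig chi v (fun k : int => alpha ^ k / k%:~R)).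

Proof.
have dl : differentiable lambda 0 by exact: (hlambda [::]).
have ds : differentiable sigma 0 by exact: (hsigma [::]).
have [eta [E [C [eta01 sd lsE HP]]]] := local_form_saddle v hf (differentiable_continuous dl)
  (differentiable_continuous ds) halpha hchi_eig hlambda0 hsigma0 hNopen hNconvex hN0 hN1 hN3 hN4 hT0 hab0.
have [k0 HKK] := saddle_hull_orbit halpha hchi_eig eta01.
have rho01 : 0 < eta / 4 <= 1 / 2 by case/andP: eta01 => e0 e1; apply/andP; split; lra.
set F1 := family_x f v in sd lsE HP *; set F2 := family_y f v in sd lsE HP *.
have sF1 : smooth_on setT F1 by exact: smooth_family_x.
have sF2 : smooth_on setT F2 by exact: smooth_family_y.
have [gx0 gx1 gx2] := gx_coefficients v hf hT1x.
have [[gy0 gy1 gy2] [gy21 gy22]] := gy_coefficients v hf hT1y.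
have gyS := gy_section v hT1y hd0.
rewrite hc0 in gx0; rewrite hd0 in gy0; rewrite hd1 in gy1 gyS; rewrite hd2 in gy2.
have axis_cont (g : R * R * R -> R) : continuous g -> {for 0, continuous (fun e : R => g (0, 0, e))}.
  move=> cg; apply: (@continuous_comp _ _ _ (fun e : R => (0, 0, e) : R * R * R) g); last exact: cg.
  apply: differentiable_continuous; apply: differentiable_pair; first exact: differentiable_cst.
  exact: ex_diff.
have cla : {for 0, continuous (fun e : R => D3 (D1 F1) (0, 0, e))}.
  apply: axis_cont; rewrite D3.unlock D1.unlock => z; apply: differentiable_continuous.
  exact: (sF1 [:: (0, 0, 1); (1, 0, 0)]).
have csi : {for 0, continuous (fun e : R => D3 (D2 F2) (0, 0, e))}.
  apply: axis_cont; rewrite D3.unlock D2.unlock => z; apply: differentiable_continuous.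
  exact: (sF2 [:: (0, 0, 1); (0, 1, 0)]).
have d50 : d5 0 != 0 by apply/eqP.
have chi2 : chi * chi = 1 by case: hchi => ->; ring.
have che2 : chi_eig * chi_eig = 1 by case: hchi_eig => ->; ring.
have chi0 : chi != 0 by case: hchi => ->; rewrite ?oppr_eq0 oner_eq0.
have che0 : chi_eig != 0 by case: hchi_eig => ->; rewrite ?oppr_eq0 oner_eq0.
have /andP[al0 al1] := halpha.
have b0 : (2 * chi * d5 0)^-1 != 0 by rewrite invr_eq0 !mulf_neq0// pnatr_eq0.
have tangE := tangency_gradient v hf hT1y; rewrite -hn_tang in tangE.
have eigE := eigenvalue_gradient (sd_E sd) dl ds lsE; rewrite -hn_eig in eigE.
have CF1 := C2_smooth sF1; have CF2 := C2_smooth sF2.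
split=> [ht|ht he].
(* Solves [hbeta] with Th = 0 and q = o (n_tang . v) chi. *)
- pose o := - (2 * chi * d5 0)^-1 * chi / dot n_tang v.
  have o0 : o != 0 by rewrite !mulf_neq0// ?invr_eq0 ?oppr_eq0//; apply/eqP.
  pose om (k : nat) := o * alpha ^+ (2 * k).
  apply: (@windows_of_branches _ _ f v hf m alpha chi_eig chi om _ `|o|) => //.
  + move=> k; rewrite normrM -exprnP; exact: lexx.
  + case: (ltgtP o 0) => oS; [right|left|by rewrite oS eqxx in o0].
      by move=> k _; rewrite /om pmulr_llt0 // exprn_gt0.
    by move=> k _; rewrite /om mulr_gt0 // exprn_gt0.
  have W0 : 0 <= `|o| * (1 - alpha)^-1 by rewrite mulr_ge0// invr_ge0 subr_ge0 ltW.
  have omW k : k%:R * `|om k| <= `|o| * (1 - alpha)^-1 * alpha ^+ k.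
    rewrite /om normrM normrX (gtr0_norm al0) mulnC exprM expr2.
    have -> : k%:R * (`|o| * (alpha ^+ k * alpha ^+ k)) = `|o| * (k%:R * alpha ^+ k) * alpha ^+ k by ring.
    by rewrite ler_wpM2r ?exprn_ge0 ?(ltW al0)// ler_wpM2l// natr_mul_geometric_le.
  have hTh : (fun k => om k * k%:R / alpha ^+ k) @ \oo --> (0 : R).
    rewrite (_ : (fun k => _) = fun k => o * (k%:R * alpha ^+ k)); last first.
      apply/funext => k; rewrite /om mulnC exprM expr2.
      have : alpha ^+ k != 0 by rewrite expf_neq0// gt_eqF.
      by move: (alpha ^+ k) => x x0; field.
    by rewrite -(mulr0 o); apply: cvgMr; exact: cvg_natr_geometric.
  have hq L (L1 : 1 <= L) := pf_q_square sd CF1 CF2 L1 W0 omW gy0 gy1 gy2 hchi (fun k => erefl (om k)).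
  apply: (return_branch sd CF1 CF2 rho01 W0 omW HKK gx0 gy0 gy1 gy2 erefl gx2 gy21 gy22 hchi cla csi hTh hq gyS HP
    d50 hDelta0 _ hc2); first by rewrite gx1.
  rewrite mul0r addr0 tangE /o; have dn : dot n_tang v != 0 by apply/eqP.
  by rewrite divfK// -[LHS]mulrA chi2 mulr1.
(* Solves [hbeta] with q = 0 and Th = o. *)
- pose o := - (2 * chi * d5 0)^-1 * chi_eig / dot n_eig v.
  have dn : dot n_eig v != 0 by apply/eqP.
  have o0 : o != 0 by rewrite !mulf_neq0// ?invr_eq0 ?oppr_eq0//.
  pose om (k : nat) := o * alpha ^+ k / k%:R.
  apply: (@windows_of_branches _ _ f v hf m alpha chi_eig chi om _ `|o|) => //.
  + by move=> k; rewrite /om -mulrA normrM -exprnP pmulrn.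
  + case: (ltgtP o 0) => oS; [right|left|by rewrite oS eqxx in o0].
      by move=> k k0'; rewrite /om -mulrA nmulr_rlt0// divr_gt0 ?exprn_gt0// ltr0n.
    by move=> k k0'; rewrite /om -mulrA pmulr_rgt0// divr_gt0 ?exprn_gt0// ltr0n.
  have omE k : (0 < k)%N -> om k * k%:R = o * alpha ^+ k.
    by move=> k0'; rewrite /om divfK// pnatr_eq0 -lt0n.
  have omW k : k%:R * `|om k| <= `|o| * alpha ^+ k.
    have ak : 0 <= alpha ^+ k by rewrite exprn_ge0// ltW.
    (* At k = 0 the identity [omE] fails, since 0 has inverse 0, but the left-hand side vanishes. *)
    case: k ak => [|k] ak; first by rewrite mul0r mulr_ge0.
    by rewrite -normr_nat mulrC -normrM omE// normrM [`|alpha ^+ _|]ger0_norm.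
  have hTh : (fun k => om k * k%:R / alpha ^+ k) @ \oo --> o.
    apply: (@cvg_trans _ ((fun=> o) @ \oo)); last exact: cvg_cst.
    apply: near_eq_cvg; exists 1%N => // k /= k0'; rewrite omE// mulfK// expf_neq0// gt_eqF//.
  have hq L (L1 : 1 <= L) := pf_q_tangent sd CF1 CF2 L1 (normr_ge0 o) omW gy0 gy1 gy2 hchi (etrans tangE ht).
  apply: (return_branch sd CF1 CF2 rho01 (normr_ge0 o) omW HKK gx0 gy0 gy1 gy2 erefl gx2 gy21 gy22 hchi cla csi hTh hq gyS HP
    d50 hDelta0 _ hc2); first by rewrite gx1.
  rewrite add0r; move: eigE; rewrite hlambda0 hsigma0 -/F1 -/F2.
  rewrite /o; move: (D3 (D2 F2) _) (D3 (D1 F1) _) (dot n_eig v) dn => s l w w0 wE.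
  (* The sum of the logarithmic derivatives of the eigenvalues is the derivative of lambda sigma
     divided by chi_eig, and chi_eig is its own inverse. *)
  have -> : l / alpha + s / (chi_eig / alpha) = w * chi_eig.
    rewrite wE; transitivity ((chi_eig * chi_eig) * (l / alpha) + s / (chi_eig / alpha)).
      by rewrite che2 mul1r.
    have -> : s / (chi_eig / alpha) = chi_eig * chi_eig * (s / (chi_eig / alpha)) by rewrite che2 mul1r.
    by field; rewrite che0 gt_eqF.
  by rewrite mulrA divfK// -[LHS]mulrA che2 mulr1.
Qed.
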